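(* Let $(u,v,P,\eta,U)$ be a solitary wave of elevation with $\sup u<c$ (supremum over the fluid domain) satisfying, for some $0<\alpha<1$ and $r=2/(1-\alpha)$, the regularity $u,v,P\in W^{1,r}_{\mathrm{loc}}(\overline{D_\eta})$, $\eta\in C^{1+\alpha}(\mathbb{R})$, $U\in W^{1,r}(-d,0)$. Let $$\Lambda=\max_{-d\le y\le0}\frac{c-U(0)}{c-U(y)}$$ and suppose that $\Lambda<2/\sqrt3$. Then the Froude number $F$ satisfies the upper bound $$F<\Big(1-\tfrac34\Lambda^2\Big)^{-1/2}.$$
   Context: Fix constants $g>0$ (gravity), $d>0$ (asymptotic depth), $c>0$ (wave speed). A solitary wave consists of functions $\eta:\mathbb{R}\to\mathbb{R}$ with $\eta>-d$, functions $u,v,P$ on $\overline{D_\eta}$, where $D_\eta=\{(x,y): -d<y<\eta(x)\}$ is the fluid domain, and $U:[-d,0]\to\mathbb{R}$, satisfying the steady incompressible Euler equations (in $L^r_{\mathrm{loc}}(\overline{D_\eta})$) $$(u-c)u_x+vu_y=-P_x,\quad (u-c)v_x+vv_y=-P_y-g,\quad u_x+v_y=0 ,$$ the pointwise boundary conditions $v=0$ on $y=-d$, $v=(u-c)\eta_x$ and $P=0$ on $y=\eta(x)$, and the asymptotic conditions $\eta\to0$, $v\to 0$, $u\to U(y)$ as $x\to\pm\infty$, uniformly in $y$. Here $w\in W^{1,r}_{\mathrm{loc}}(\overline{D_\eta})$ means $w\in W^{1,r}(D')$ whenever $\overline{D'}\subset\overline{D_\eta}$ is compact. The wave is a wave of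 elevation if $\eta(x)\ge0$ for all $x$ but $\eta\not\equiv0$. The Froude number $F>0$ is defined by $\displaystyle \frac1{F^2}=g\int_{-d}^0\frac{dy}{(c-U(y))^2}$ (note $U<c$ when $\sup u<c$). *)

(* Defs.v *)
From HB Require Import structures.
From mathcomp Require Import all_boot all_order all_algebra.
From mathcomp Require Import all_classical all_reals all_analysis.

Set Implicit Arguments.
Unset Strict Implicit.
Unset Printing Implicit Defensive.

Import Order.TTheory GRing.Theory Num.Theory.
Import numFieldNormedType.Exports.

Local Open Scope classical_set_scope.
Local Open Scope ring_scope.

Section SobolevSpaces.
Variable R : realType.

Definition mu1 := @lebesgue_measure R.
Definition mu2 := (@lebesgue_measure R \x @lebesgue_measure R)%E.

Definition e1 : R * R := (1, 0).
Definition e2 : R * R := (0, 1).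

(* [supp phi] compact and contained in [D] *)
Definition supported_in (T : topologicalType) (D : set T) (phi : T -> R) :=
  let supp := closure [set z | phi z != 0] in compact supp /\ supp `<=` D.

(* As in Gilbarg-Trudinger, weak first derivatives are tested against compactly
   supported functions of class C^1. *)
Definition test1 (D : set R) (phi : R -> R) :=
  [/\ forall x, derivable phi x 1, continuous (derive1 phi) & supported_in D phi].

Definition test2 (D : set (R * R)) (phi : R * R -> R) :=
  [/\ forall z, derivable phi z e1 /\ derivable phi z e2,
      continuous ('D_e1 phi), continuous ('D_e2 phi) & supported_in D phi].

(* [w \_ D] is [w] extended by zero outside [D]. *)
Definition in_Lr1 (r : R) (D : set R) (w : R -> R) :=
  (w \_ D : measurableTypeR R -> R) \in Lfun mu1 r%:E.

Definition in_Lr2 (r : R) (D : set (R * R)) (w : R * R -> R) :=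
  (w \_ D : measurableTypeR R * measurableTypeR R -> R) \in Lfun mu2 r%:E.

Definition weak_deriv1 (D : set R) (w dw : R -> R) :=
  forall phi, test1 D phi ->
    \int[mu1]_(x in D) (w x * derive1 phi x) = - \int[mu1]_(x in D) (dw x * phi x).

Definition weak_deriv2 (D : set (R * R)) (e : R * R) (w dw : R * R -> R) :=
  forall phi, test2 D phi ->
    \int[mu2]_(z in D) (w z * 'D_e phi z) = - \int[mu2]_(z in D) (dw z * phi z).

Definition W1r_interval (r : R) (D : set R) (w : R -> R) :=
  exists dw, [/\ in_Lr1 r D w, in_Lr1 r D dw & weak_deriv1 D w dw].

(* [w] is in W^{1,r}(D) with weak gradient [(wx, wy)]. *)
Definition W1r (r : R) (D : set (R * R)) (w wx wy : R * R -> R) :=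
  [/\ in_Lr2 r D w, in_Lr2 r D wx, in_Lr2 r D wy,
      weak_deriv2 D e1 w wx & weak_deriv2 D e2 w wy].

(* W^{1,r}_loc of the closure of [D]: integrability holds up to the boundary. *)
Definition W1r_loc_closure (r : R) (D : set (R * R)) (w wx wy : R * R -> R) :=
  forall D' : set (R * R), open D' -> compact (closure D') ->
    closure D' `<=` closure D -> W1r r D' w wx wy.

(* The Banach space C^{1+alpha}(R): bounds are uniform on the whole line. *)
Definition holder_C1 (alpha : R) (f : R -> R) :=
  [/\ forall x, derivable f x 1, continuous (derive1 f) &
      exists K : R, [/\ forall x, `|f x| <= K, forall x, `|derive1 f x| <= K &
        forall x y, `|derive1 f x - derive1 f y| <= K * `|x - y| `^ alpha]].

End SobolevSpaces.

Section SolitaryWaves.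
Variable R : realType.

Definition fluid (d : R) (eta : R -> R) : set (R * R) :=
  [set z | - d < z.2 /\ z.2 < eta z.1].

(* [|f x y| --> 0] as [x --> +-oo], uniformly over the fluid column
   [-d <= y <= eta x]. *)
Definition vanishes_at_infinity (d : R) (eta : R -> R) (f : R -> R -> R) :=
  forall e : R, 0 < e ->
    (\forall x \near +oo, forall y, - d <= y <= eta x -> `|f x y| < e) /\
    (\forall x \near -oo, forall y, - d <= y <= eta x -> `|f x y| < e).

(* The functions u, v, P (resp. U), determined by their Sobolev class up to a
   null set, are the representatives that are continuous on the closed fluid
   domain (resp. on [-d, 0]); they exist because r > 2, and the pointwise
   boundary and asymptotic conditions refer to them.
   In the asymptotic condition on u, the profile U is extended to y > 0 by the
   constant U(0): the fluid column -d <= y <= eta(x) may exceed [-d, 0]. *)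
Record solitary_wave (g d c r alpha : R) (u v P : R * R -> R)
    (eta U : R -> R) : Prop := SolitaryWave {
  sw_depth : forall x, - d < eta x;
  sw_eta : holder_C1 alpha eta;
  sw_U_cont : {within `[- d, 0], continuous U};
  sw_U : W1r_interval r `]- d, 0[ U;
  sw_u_cont : {within closure (fluid d eta), continuous u};
  sw_v_cont : {within closure (fluid d eta), continuous v};
  sw_P_cont : {within closure (fluid d eta), continuous P};
  sw_euler : exists ux uy vx vy Px Py : R * R -> R,
    [/\ W1r_loc_closure r (fluid d eta) u ux uy,
        W1r_loc_closure r (fluid d eta) v vx vy,
        W1r_loc_closure r (fluid d eta) P Px Py &
        {ae @mu2 R, forall z, fluid d eta z ->
          [/\ (u z - c) * ux z + v z * uy z = - Px z,
              (u z - c) * vx z + v z * vy z = - Py z - g &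
              ux z + vy z = 0]}];
  sw_bottom : forall x, v (x, - d) = 0;
  sw_kinematic : forall x, v (x, eta x) = (u (x, eta x) - c) * derive1 eta x;
  sw_dynamic : forall x, P (x, eta x) = 0;
  sw_eta_lim : eta x @[x --> +oo] --> 0 /\ eta x @[x --> -oo] --> 0;
  sw_v_lim : vanishes_at_infinity d eta (fun x y => v (x, y));
  sw_u_lim : vanishes_at_infinity d eta
    (fun x y => u (x, y) - U (Num.min y 0))
}.

Definition elevation (eta : R -> R) :=
  (forall x, 0 <= eta x) /\ exists x, eta x != 0.

(* supremum in the extended reals, so that [u] unbounded above is excluded *)
Definition sup_below (c : R) (D : set (R * R)) (u : R * R -> R) :=
  (ereal_sup [set (u z)%:E | z in D] < c%:E)%E.

Definition is_froude (g d c : R) (U : R -> R) (F : R) :=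
  0 < F /\ 1 / F ^+ 2 = g * \int[@mu1 R]_(y in `[- d, 0]) (1 / (c - U y) ^+ 2).

Definition is_max (A : set R) (m : R) := A m /\ ubound A m.

Definition shear_ratios (d c : R) (U : R -> R) : set R :=
  [set (c - U 0) / (c - U y) | y in `[- d, 0]].

End SolitaryWaves.

(* Main.v *)
Require Import Defs.
From mathcomp Require Import all_boot all_order all_algebra.
From mathcomp Require Import all_classical all_reals all_analysis.
From mathcomp Require Import ring lra.

(** Why the bound holds.

    Let [q = u - c], [W = c - U], let [mu = W 0 / Lambda] be the minimum of [W],
    and [I] the integral of [1 / W^2] over [- d, 0], so that [1 / F^2 = g I]. The
    claim amounts to [mu^2 (1 - g I) < 3/4 (W 0)^2], which is [froude_gap].

    Let [psi] be the stream function: [psi_y = - q], [psi_x = v], [psi = 0] on the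
    bed. The streamline [psi = t] comes from infinity, where its speed is [lam t],
    and Bernoulli's law [bernoulli_law] reads
    [P + (q^2 + v^2) / 2 + g y = (lam psi)^2 / 2].

    Multiply the vertical momentum law [(q v)_x + (v^2 + P)_y = - g] by
    [m = y + d - f psi], where [f 0 = 0], [f' = phi = (1 - mu^2 / lam^2) / lam], and
    integrate over a fluid column. No boundary terms arise, as [m] vanishes on
    the bed while [P = 0] and the surface is a streamline. The flow force, i.e.
    the column integral of [P + q^2], is a known constant ([flow_force]), integrals of
    [k psi * q] only depend on [k], and with Bernoulli's law the identity becomes
    ([deficit_column])
      [int N dy = J' + 3/2 g eta^2 - mu^2 (1 - g I) eta], [J = int q v m dy],
      [N = (lam^2 - mu^2) / (2 lam^3) * ((w - lam)^2 (w + 2 lam) + v^2 w)], [w = - q].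
    Here [N >= 0], and [J] tends to 0 at both ends. Integrating in [x], the function
    [3/2 g eta^2 - mu^2 (1 - g I) eta] has a nonnegative integral. But the speed is
    positive on the surface, so that [g eta < (W 0)^2 / 2] by Bernoulli's law, and
    if [froude_gap] failed that function would be nonpositive, and negative
    wherever [eta > 0].

    The fields only have Sobolev regularity, so the flow enters through weak
    conservation laws [A_x + C_y = E] with continuous fluxes. The quadratic and
    cubic fluxes are differentiated by the Leibniz rule [weak_Leibniz], whose proof
    rests on averages over small squares. [column_identity] then integrates a
    conservation law, with a weight, over columns up to the boundary: cut-offs near
    the bed and the surface, du Bois-Reymond's lemma in [x], and a passage to the
    limit in the thickness of the cut-offs.

    Bernoulli's law is itself derived from these identities. Energy conservation
    shows that the column integral of [B q (k psi)], with [B] the Bernoulli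
    function, is constant in [x] for every [k]. To evaluate it without a limit of
    the pressure, the vertical momentum law with weight a primitive of [k] at [psi]
    is subtracted, which leaves convergent terms and the derivative of a quantity
    that tends to 0 ([bernoulli_moment]). Then [B - (lam psi)^2 / 2] is orthogonal
    to all [q (k psi)] on each column, hence zero. *)

Set Implicit Arguments.
Unset Strict Implicit.
Unset Printing Implicit Defensive.
Import Order.TTheory GRing.Theory Num.Theory.
Import numFieldNormedType.Exports.
Local Open Scope classical_set_scope.
Local Open Scope ring_scope.

(** * Oriented integrals of continuous functions *)

Section OrientedIntegral.
Variable R : realType.
Implicit Types (f g F G : R -> R) (a b c x y : R).

Definition deriv_of F f := forall x, is_derive x 1 F (f x).

(** The primitive that vanishes at 0, for [y] of either sign. Integrals with
    bounds in any order are differences of its values. *)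
Definition prim f y : R :=
  \int[@mu1 R]_(t in `[0, y]) f t - \int[@mu1 R]_(t in `[y, 0]) f t.

Definition oint a b f : R := prim f b - prim f a.

Lemma continuous_integrable_itv f a b : continuous f ->
  (@mu1 R).-integrable `[a, b] (EFin \o f).
Proof.
move=> cf; apply: continuous_compact_integrable; first exact: segment_compact.
exact: continuous_subspaceT.
Qed.

(** The fundamental theorem of calculus is available to the right of a base
    point; this moves the base point to the left of [y]. *)
Lemma prim_shift f a y : continuous f -> a <= 0 -> a <= y ->
  prim f y = \int[@mu1 R]_(t in `[a, y]) f t - \int[@mu1 R]_(t in `[a, 0]) f t.
Proof.
move=> cf a0 ay; rewrite /prim.
have E p q : a <= p -> p <= q -> \int[@mu1 R]_(t in `[a, q]) f t =
   \int[@mu1 R]_(t in `[a, p]) f t + \int[@mu1 R]_(t in `[p, q]) f t.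
  move=> ap pq.
  have := @Rintegral_itvB R f (BLeft a) (BRight q) p (continuous_integrable_itv _ _ cf).
  rewrite !bnd_simp ap pq => /(_ isT isT) H.
  rewrite -(@Rintegral_itv_obnd_cbnd R p (BRight q)); last first.
    apply: integrableS (@continuous_integrable_itv f p q cf) => //.
    exact: subset_itv_oc_cc.
  by rewrite -H addrC subrK.
case: (leP 0 y) => [y0|/ltW y0].
- rewrite (E 0 y)// [in RHS]addrAC subrr add0r; case: (eqVneq y 0) => [->|yn0].
    by rewrite set_itv1 Rintegral_set1 subr0.
  rewrite [X in _ - X](_ : _ = 0) ?subr0//.
  by rewrite set_itv_ge ?Rintegral_set0// bnd_simp -ltNge lt_neqAle eq_sym yn0.
- rewrite (E y 0)// opprD addrA subrr sub0r; case: (eqVneq y 0) => [->|yn0].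
    by rewrite set_itv1 Rintegral_set1 sub0r.
  rewrite [X in X - _](_ : _ = 0) ?sub0r//.
  by rewrite set_itv_ge ?Rintegral_set0// bnd_simp -ltNge lt_neqAle yn0.
Qed.

Lemma is_derive_prim f x : continuous f -> is_derive x 1 (prim f) (f x).
Proof.
move=> cf; pose a := Num.min x 0 - 1.
have ax : a < x by rewrite /a; case: (leP x 0) => H; lra.
have a0 : a <= 0 by rewrite /a; case: (leP x 0) => H; lra.
have x1 : x < x + 1 by lra.
have [dF F'] := @continuous_FTC1_closed R f a x (x+1) x1
  (continuous_integrable_itv _ _ cf) ax (cf x).
pose G y := \int[@mu1 R]_(t in `[a, y]) f t.
have dG : is_derive x 1 G (f x) by apply: DeriveDef; [exact: dF|rewrite -derive1E; exact: F'].
have dGa : is_derive x 1 (fun y => G y - G 0) (f x).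
  by rewrite -[f x]subr0; exact: (is_deriveB dG (is_derive_cst (G 0) x 1)).
apply: near_eq_is_derive dGa.
by near=> y; apply/esym/prim_shift => //; near: y; exact: lt_le_nbhsr.
Unshelve. all: by end_near.
Qed.

Lemma oint_xx a f : oint a a f = 0.
Proof. by rewrite /oint subrr. Qed.

Lemma oint_chasles b a c f : oint a c f = oint a b f + oint b c f.
Proof. by rewrite /oint; ring. Qed.

Lemma oint_sym a b f : oint b a f = - oint a b f.
Proof. by rewrite /oint; ring. Qed.

Lemma is_derive_oint a x f : continuous f ->
  is_derive x 1 (fun y => oint a y f) (f x).
Proof.
move=> cf; apply: is_derive_eq; last exact: subr0.
by apply: is_deriveB; exact: is_derive_prim.
Qed.

Lemma is_derive_continuous f (df : R -> R) :
  deriv_of f df -> continuous f.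
Proof.
move=> h x; apply: differentiable_continuous.
by apply/derivable1_diffP; have [] := h x.
Qed.

Lemma continuous_prim f : continuous f -> continuous (prim f).
Proof.
by move=> cf; apply: (@is_derive_continuous _ f) => x; exact: is_derive_prim.
Qed.

Lemma oint_FTC2 a b F f : continuous f -> deriv_of F f ->
  oint a b f = F b - F a.
Proof.
move=> cf h.
have : prim f a - F a = prim f b - F b.
  apply: (@is_derive_0_is_cst _ (fun x => prim f x - F x)) => x.
  by rewrite -(subrr (f x)); apply: is_deriveB; [exact: is_derive_prim|exact: h].
by rewrite /oint => H; lra.
Qed.

Lemma ointD a b f g : continuous f -> continuous g ->
  oint a b (fun x => f x + g x) = oint a b f + oint a b g.
Proof.
move=> cf cg; rewrite (@oint_FTC2 a b (fun x => prim f x + prim g x)).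
- by rewrite /oint; ring.
- by move=> x; apply: cvgD; [exact: cf|exact: cg].
- by move=> x; apply: is_deriveD; exact: is_derive_prim.
Qed.

Lemma ointZ a b k f : continuous f -> oint a b (fun x => k * f x) = k * oint a b f.
Proof.
move=> cf; rewrite (@oint_FTC2 a b (fun x => k * prim f x)).
- by rewrite /oint; ring.
- by move=> x; apply: cvgM; [exact: cvg_cst|exact: cf].
- by move=> x; apply: is_deriveZ; exact: is_derive_prim.
Qed.

Lemma ointN a b f : continuous f -> oint a b (fun x => - f x) = - oint a b f.
Proof.
move=> cf; rewrite -mulN1r -ointZ//; congr (oint _ _ _).
by apply/funext => x; rewrite mulN1r.
Qed.

Lemma ointB a b f g : continuous f -> continuous g ->
  oint a b (fun x => f x - g x) = oint a b f - oint a b g.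
Proof.
move=> cf cg; rewrite ointD//; first by rewrite ointN.
by move=> x; apply: cvgN; exact: cg.
Qed.

Lemma oint_cst a b k : oint a b (fun=> k) = k * (b - a).
Proof.
rewrite (@oint_FTC2 a b (fun x => k * x)); first by ring.
- exact: cst_continuous.
- by move=> x; apply: is_derive_eq; exact: mulr1.
Qed.

Lemma oint_comp a b f G g : continuous f -> continuous g ->
  deriv_of G g ->
  oint a b (fun x => f (G x) * g x) = oint (G a) (G b) f.
Proof.
move=> cf cg dG; rewrite (@oint_FTC2 a b (fun x => prim f (G x)))//.
- have cG := is_derive_continuous dG.
  move=> x; apply: cvgM; last exact: cg.
  by apply: continuous_comp; [exact: cG|exact: cf].
- by move=> x; apply: is_derive1_comp; [exact: is_derive_prim|exact: dG].
Qed.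

Lemma oint_shift a b k f : continuous f ->
  oint a b (fun x => f (x + k)) = oint (a + k) (b + k) f.
Proof.
move=> cf; rewrite -(@oint_comp a b f (fun x => x + k) (fun=> 1))//.
- by congr (oint _ _ _); apply/funext => x; rewrite mulr1.
- exact: cst_continuous.
- by move=> x; apply: is_derive_eq; exact: addr0.
Qed.

Lemma oint_parts a b F f G g : continuous f -> continuous g ->
  deriv_of F f -> deriv_of G g ->
  oint a b (fun x => f x * G x) =
    F b * G b - F a * G a - oint a b (fun x => F x * g x).
Proof.
move=> cf cg dF dG.
have cF := is_derive_continuous dF; have cG := is_derive_continuous dG.
have c1 : continuous (fun x => f x * G x) by move=> x; apply: cvgM; [exact: cf|exact: cG].
have c2 : continuous (fun x => F x * g x) by move=> x; apply: cvgM; [exact: cF|exact: cg].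
rewrite -(@oint_FTC2 a b (fun x => F x * G x) (fun x => f x * G x + F x * g x)).
- by rewrite ointD//; ring.
- by move=> x; apply: cvgD; [exact: c1|exact: c2].
- move=> x; apply: is_derive_eq.
    exact: is_deriveM.
  by rewrite /GRing.scale/=; ring.
Qed.

Lemma oint_gt0_mvt a b f : a < b -> continuous f ->
  exists2 c, a < c < b & oint a b f = f c * (b - a).
Proof.
move=> ab cf; have [||c] := @MVT R (prim f) f a b ab.
- by move=> x _; exact: is_derive_prim.
- by apply: continuous_subspaceT; exact: continuous_prim.
by rewrite in_itv/=; exists c.
Qed.

Lemma oint_ge0 a b f : a <= b -> continuous f ->
  (forall x, a <= x <= b -> 0 <= f x) -> 0 <= oint a b f.
Proof.
rewrite le_eqVlt => /predU1P[<- _ _|ab cf f0]; first by rewrite oint_xx.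
have [c /andP[ac cb] ->] := oint_gt0_mvt ab cf.
by rewrite mulr_ge0 ?subr_ge0 ?(ltW ab)// f0// (ltW ac) (ltW cb).
Qed.

Lemma le_oint a b f g : a <= b -> continuous f -> continuous g ->
  (forall x, a <= x <= b -> f x <= g x) -> oint a b f <= oint a b g.
Proof.
move=> ab cf cg fg; rewrite -subr_ge0 -ointB//; apply: oint_ge0 => //.
- by move=> x; apply: cvgB; [exact: cg|exact: cf].
- by move=> x /fg; rewrite subr_ge0.
Qed.

Lemma eq_oint a b f g : continuous f -> continuous g ->
  (forall x, Num.min a b <= x <= Num.max a b -> f x = g x) ->
  oint a b f = oint a b g.
Proof.
move=> cf cg.
wlog ab : a b / a <= b.
  move=> H; case: (leP a b) => [ab|/ltW ab] fg.
    by apply: H; rewrite ?(min_l ab)// ?(max_r ab).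
  rewrite oint_sym [RHS]oint_sym (H b a)//.
  by rewrite (min_l ab) (max_r ab).
rewrite (min_l ab) (max_r ab) => fg.
by apply/eqP; rewrite eq_le !le_oint// => x /fg ->.
Qed.

(** If the integral vanished, so would all the partial integrals, and hence
    their derivative [f] inside the interval; but [f] is positive near [x0], and
    every neighbourhood of [x0] meets the open interval. *)
Lemma oint_gt0 a b f x0 : a < b -> continuous f ->
  (forall x, a <= x <= b -> 0 <= f x) -> a <= x0 <= b -> 0 < f x0 ->
  0 < oint a b f.
Proof.
move=> ab cf f0 x0ab fx0.
rewrite lt_neqAle oint_ge0 ?(ltW ab)// andbT eq_sym; apply/negP => /eqP i0.
have z x : a <= x <= b -> oint a x f = 0.
  move=> /andP[ax xb].
  have h1 : 0 <= oint a x f.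
    by apply: oint_ge0 => // t /andP[at_ tx]; apply: f0; rewrite at_ (le_trans tx).
  have h2 : 0 <= oint x b f.
    by apply: oint_ge0 => // t /andP[at_ tx]; apply: f0; rewrite tx (le_trans ax).
  by have := oint_chasles x a b f; lra.
have h x : a < x < b -> f x = 0.
  move=> /andP[ax xb].
  have H0 : is_derive x 1 (fun y => oint a y f) 0.
    apply: (@near_eq_is_derive R R R (cst 0)).
    near=> y; apply/esym/z/andP; split; near: y.
      exact: lt_le_nbhsr.
    exact: lt_le_nbhsl.
  by have := @is_derive_oint a x f cf; move=> [_ <-]; move: H0 => [_ ->].
have [lo hi] := andP x0ab.
have : \forall x \near x0, 0 < f x by exact: (cvgr_gt _ (cf x0)).
move=> /nbhs_ballP[e /= e0 be].
have [y [yab yb]] : exists y, a < y < b /\ ball x0 e y.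
  pose r := Num.min (e / 2) ((b - a) / 4).
  have r0 : 0 < r by rewrite /r lt_min; apply/andP; split; lra.
  have re : r <= e/2 by rewrite /r ge_min lexx.
  have rb : r <= (b - a)/4 by rewrite /r ge_min lexx orbT.
  case: (ltP x0 ((a+b)/2)) => H; [exists (x0 + r)|exists (x0 - r)]; split.
  - by apply/andP; split; lra.
  - by rewrite /ball/= ltr_norml; apply/andP; split; lra.
  - by apply/andP; split; lra.
  - by rewrite /ball/= ltr_norml; apply/andP; split; lra.
by have := be _ yb; rewrite h// ltxx.
Unshelve. all: by end_near.
Qed.

Lemma oint_norm_le a b f M : continuous f ->
  (forall x, Num.min a b <= x <= Num.max a b -> `|f x| <= M) ->
  `|oint a b f| <= M * `|b - a|.
Proof.
move=> cf; wlog ab : a b / a <= b.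
  move=> H; case: (leP a b) => [ab|/ltW ab] fg.
    by apply: H; rewrite ?(min_l ab)// ?(max_r ab).
  rewrite oint_sym normrN [`|b - a|]distrC; apply: (H b a) => //.
  by rewrite (min_l ab) (max_r ab).
rewrite (min_l ab) (max_r ab) => fM.
rewrite (ger0_norm (_ : 0 <= b - a)) ?subr_ge0// ler_norml -mulNr -!oint_cst.
apply/andP; split; apply: le_oint => //; try exact: cst_continuous.
- by move=> x /fM; rewrite ler_norml => /andP[].
- by move=> x /fM; rewrite ler_norml => /andP[].
Qed.

Lemma oint_Rintegral a b f : a <= b -> continuous f ->
  oint a b f = \int[@mu1 R]_(t in `[a, b]) f t.
Proof.
move=> ab cf; pose c := Num.min a 0.
have ca : c <= a by rewrite /c ge_min lexx.
have c0 : c <= 0 by rewrite /c ge_min lexx orbT.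
rewrite /oint (@prim_shift f c a)// (@prim_shift f c b) ?(le_trans ca ab)//.
have := @Rintegral_itvB R f (BLeft c) (BRight b) a (continuous_integrable_itv _ _ cf).
rewrite !bnd_simp ca ab => /(_ isT isT) H.
rewrite -(@Rintegral_itv_obnd_cbnd R a (BRight b)); last first.
  apply: integrableS (@continuous_integrable_itv f a b cf) => //.
  exact: subset_itv_oc_cc.
by rewrite -H /mu1; ring.
Qed.

Lemma der1_add F G x a b : is_derive x 1 F a -> is_derive x 1 G b ->
  is_derive x 1 (fun t => F t + G t) (a + b).
Proof. by move=> ? ?; exact: is_deriveD. Qed.

Lemma der1_sub F G x a b : is_derive x 1 F a -> is_derive x 1 G b ->
  is_derive x 1 (fun t => F t - G t) (a - b).
Proof. by move=> ? ?; exact: is_deriveB. Qed.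

Lemma der1_mul F G x a b : is_derive x 1 F a -> is_derive x 1 G b ->
  is_derive x 1 (fun t => F t * G t) (a * G x + F x * b).
Proof.
move=> h1 h2; apply: is_derive_eq.
by rewrite /GRing.scale/=; ring.
Qed.

Lemma der1_cst x k : is_derive x 1 (fun=> k : R) 0.
Proof. exact: is_derive_cst. Qed.

Lemma der1_id x : is_derive x 1 (fun t : R => t) 1.
Proof. exact: is_derive_id. Qed.

Lemma der1_comp F G x a b : is_derive (G x) 1 F a -> is_derive x 1 G b ->
  is_derive x 1 (fun t => F (G t)) (a * b).
Proof. by move=> ? ?; exact: is_derive1_comp. Qed.

Lemma der1_eq F x a b : is_derive x 1 F a -> a = b -> is_derive x 1 F b.
Proof. by move=> ? <-. Qed.

Lemma der1_near F G x a : (\near x, F x = G x) -> is_derive x 1 F a ->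
  is_derive x 1 G a.
Proof. by move=> h ?; exact: near_eq_is_derive h _. Qed.

End OrientedIntegral.

(** * Integrals depending on a parameter *)

Section TwoVariables.
Variable R : realType.
Implicit Types (F G h : R * R -> R) (f g : R -> R) (a b c x y : R).

Lemma continuous2 (T S U V : topologicalType) (F : S * U -> V) (f : T -> S) (g : T -> U) :
  continuous F -> continuous f -> continuous g ->
  continuous (fun t => F (f t, g t)).
Proof.
move=> cF cf cg t.
apply: (@continuous_comp _ _ _ (fun t => (f t, g t)) F); last exact: cF.
by apply: cvg_pair; [exact: cf|exact: cg].
Qed.

Lemma cont_fst : continuous (fun z : R * R => z.1).
Proof. by move=> z; exact: cvg_fst. Qed.

Lemma cont_snd : continuous (fun z : R * R => z.2).
Proof. by move=> z; exact: cvg_snd. Qed.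

Lemma cont_id : continuous (fun x : R => x).
Proof. by move=> x; exact: cvg_id. Qed.

Lemma cont_cst (T : topologicalType) (k : R) : continuous (fun _ : T => k).
Proof. by move=> x; exact: cvg_cst. Qed.

Lemma cont_add (T : topologicalType) (f g : T -> R) : continuous f -> continuous g ->
  continuous (fun t => f t + g t).
Proof. by move=> cf cg t; apply: cvgD; [exact: cf|exact: cg]. Qed.

Lemma cont_opp (T : topologicalType) (f : T -> R) : continuous f ->
  continuous (fun t => - f t).
Proof. by move=> cf t; apply: cvgN; exact: cf. Qed.

Lemma cont_sub (T : topologicalType) (f g : T -> R) : continuous f -> continuous g ->
  continuous (fun t => f t - g t).
Proof. by move=> cf cg t; apply: cvgB; [exact: cf|exact: cg]. Qed.

Lemma cont_mul (T : topologicalType) (f g : T -> R) : continuous f -> continuous g ->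
  continuous (fun t => f t * g t).
Proof. by move=> cf cg t; apply: cvgM; [exact: cf|exact: cg]. Qed.

Lemma cont_inv (T : topologicalType) (f : T -> R) : (forall t, f t != 0) -> continuous f ->
  continuous (fun t => (f t)^-1).
Proof. by move=> f0 cf t; apply: cvgV; [exact: f0|exact: cf]. Qed.

Lemma cont_exp (T : topologicalType) (f : T -> R) n : continuous f ->
  continuous (fun t => f t ^+ n).
Proof.
move=> cf; elim: n => [|n IH]; first by under eq_fun do rewrite expr0; exact: cont_cst.
by under eq_fun do rewrite exprS; exact: cont_mul.
Qed.

Lemma cont_comp (T S U : topologicalType) (f : S -> U) (g : T -> S) :
  continuous f -> continuous g -> continuous (fun t => f (g t)).
Proof. by move=> cf cg t; apply: continuous_comp; [exact: cg|exact: cf]. Qed.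

(** Compactness of the segment makes the continuity in the parameter uniform in
    the integration variable. *)
Lemma tube (T : topologicalType) (F : T * R -> R) a b (x0 : T) (e : R) :
  continuous F -> 0 < e ->
  \forall x \near x0, forall t, a <= t <= b -> `|F (x, t) - F (x0, t)| < e.
Proof.
move=> cF e0.
have /compact_near_coveringP := @segment_compact R a b.
move=> /(_ T (nbhs x0) (fun (x : T) t => `|F (x, t) - F (x0, t)| < e) _).
move=> H; apply: filterS (H _) => [x Hx t tab|].
  by apply: Hx; rewrite /= in_itv.
move=> t _.
have e2 : 0 < e / 2 by lra.
have /cvgrPdist_lt/(_ _ e2) := cF (x0, t).
case=> -[A B] /= [A0 B0] AB.
exists (B, A) => //=; move=> [s x] /= [Bs Ax].
have h1 := AB (x, s) (conj Ax Bs).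
have h2 := AB (x0, s) (conj (nbhs_singleton A0) Bs).
move: h1 h2 => /=; rewrite !ltr_norml => /andP[h1 h2] /andP[h3 h4].
by apply/andP; split; lra.
Qed.

Lemma prim0 f : prim f 0 = 0.
Proof. by rewrite /prim subrr. Qed.

Lemma continuous_prim2 (T : topologicalType) (F : T * R -> R) : continuous F ->
  continuous (fun z : T * R => prim (fun t => F (z.1, t)) z.2).
Proof.
move=> cF [x0 y0]; apply/cvgrPdist_lt => e e0 /=.
have cS (x : T) : continuous (fun t => F (x, t)).
  by apply: continuous2 => //; [exact: cst_continuous|exact: cont_id].
pose M := `|y0| + 1.
have M0 : 0 < M by rewrite /M ltr_wpDl.
have eM : 0 < e / (2 * M) by rewrite divr_gt0 ?mulr_gt0.
have H1 := @tube _ F (- M) M x0 _ cF eM.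
have e2 : 0 < e / 2 by lra.
have H2 : \forall y \near y0, `|prim (fun t => F (x0, t)) y0 - prim (fun t => F (x0, t)) y| < e / 2.
  by have /cvgrPdist_lt/(_ _ e2) := @continuous_prim _ _ (cS x0) y0.
have H3 : \forall y \near y0, `|y| <= M.
  have /cvgrPdist_lt/(_ 1 ltr01) := @cvg_id _ (nbhs y0).
  apply: filterS => y /= h; rewrite /M.
  have := ler_normD (y - y0) y0; rewrite subrK distrC => /le_trans; apply.
  by rewrite addrC lerD2l ltW.
have : \forall z \near (x0, y0), (forall t, - M <= t <= M -> `|F (z.1, t) - F (x0, t)| < e / (2 * M)) /\
   (`|prim (fun t => F (x0, t)) y0 - prim (fun t => F (x0, t)) z.2| < e / 2 /\ `|z.2| <= M).
  exists ([set x | forall t, - M <= t <= M -> `|F (x, t) - F (x0, t)| < e / (2 * M)],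
    [set y | `|prim (fun t => F (x0, t)) y0 - prim (fun t => F (x0, t)) y| < e / 2 /\ `|y| <= M]).
    by split => //=; apply: filterI.
  by move=> [x y] /= [].
apply: filterS => -[x y] /= [h1 [h2 h3]].
have h : `|prim (fun t => F (x, t)) y - prim (fun t => F (x0, t)) y| <= e / 2.
  have -> : prim (fun t => F (x, t)) y - prim (fun t => F (x0, t)) y =
      oint 0 y (fun t => F (x, t) - F (x0, t)).
    by rewrite ointB// /oint !prim0 !subr0.
  apply: (@le_trans _ _ (e / (2 * M) * `|y - 0|)).
    apply: oint_norm_le.
      by apply: cont_sub.
    move=> t ht; apply/ltW/h1; move: ht h3; rewrite ler_norml.
    case: (leP 0 y) => _ /andP[? ?] /andP[? ?]; apply/andP; split; lra.
  rewrite subr0; apply: (@le_trans _ _ (e / (2 * M) * M)).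
    by rewrite ler_pM2l.
  by rewrite le_eqVlt; apply/orP; left; apply/eqP; field; rewrite gt_eqF.
apply: (le_lt_trans (ler_distD (prim (fun t => F (x0, t)) y) _ _)).
rewrite [X in _ + X]distrC; lra.
Qed.

Lemma continuous_oint2 (T S : topologicalType) (F : S * R -> R) (x : T -> S) (p q : T -> R) :
  continuous F -> continuous x -> continuous p -> continuous q ->
  continuous (fun z => oint (p z) (q z) (fun t => F (x z, t))).
Proof.
move=> cF cx cp cq; rewrite /oint.
have cP := continuous_prim2 cF.
apply: cont_sub; exact: (continuous2 cP).
Qed.

Lemma der1_littleo f x l :
  (forall e : R, 0 < e -> exists2 d : R, 0 < d & forall k, `|k| < d ->
     `|f (x + k) - f x - k * l| <= e * `|k|) -> is_derive x 1 f l.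
Proof.
move=> H.
have C : h^-1 *: (f (h *: 1 + x) - f x) @[h --> (0:R)^'] --> l.
  apply/cvgrPdist_le => e e0.
  have [d d0 Hd] := H e e0.
  near=> k.
  have k0 : k != 0 by near: k; exact: nbhs_dnbhs_neq.
  have kd : `|k| < d.
    near: k; apply: dnbhs0_lt => //.
  have Hk := Hd k kd.
  rewrite /GRing.scale/= mulr1 (addrC k).
  have -> : l - k^-1 * (f (x + k) - f x) = - (k^-1 * (f (x + k) - f x - k * l)).
    by field.
  rewrite normrN normrM normfV.
  by rewrite ler_pdivrMl ?normr_gt0// [leRHS]mulrC.
have D : derivable f x 1 by apply/cvg_ex; exists l.
by split => //; apply: cvg_lim.
Unshelve. all: by end_near.
Qed.

(** The mean value theorem rewrites the difference quotient of [h] as a value of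
    [hx] at a nearby parameter, and [tube] makes its convergence uniform. *)
Lemma is_derive_oint_param h hx a b x0 : continuous h -> continuous hx ->
  (forall x y, is_derive x 1 (fun s => h (s, y)) (hx (x, y))) ->
  is_derive x0 1 (fun s => oint a b (fun t => h (s, t))) (oint a b (fun t => hx (x0, t))).
Proof.
move=> ch chx dh.
have cS (H : R * R -> R) (x : R) : continuous H -> continuous (fun t => H (x, t) : R).
  by move=> cH; apply: (continuous2 cH); [exact: cst_continuous|exact: cont_id].
apply: der1_littleo => e e0.
pose L := `|b - a| + 1.
have L0 : 0 < L by rewrite /L ltr_wpDl.
have eL : 0 < e / L by rewrite divr_gt0.
have := @tube _ hx (Num.min a b) (Num.max a b) x0 _ chx eL.
move=> /nbhs_ballP[d /= d0 Hd]; exists d => // k kd.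
have c1 : continuous (fun t => h (x0 + k, t) - h (x0, t)).
  by apply: cont_sub; exact: cS.
have c2 : continuous (fun t => k * hx (x0, t)).
  by apply: cont_mul; [exact: cst_continuous|exact: cS].
have -> : oint a b (fun t => h (x0 + k, t)) - oint a b (fun t => h (x0, t)) -
    k * oint a b (fun t => hx (x0, t)) =
    oint a b (fun t => h (x0 + k, t) - h (x0, t) - k * hx (x0, t)).
  by rewrite ointB// ointB ?ointZ//; exact: cS.
apply: (@le_trans _ _ (e / L * `|k| * `|b - a|)).
  apply: oint_norm_le; first exact: cont_sub.
  move=> t tab.
  have [xi xik ->] : exists2 xi, `|xi - x0| <= `|k| & h (x0 + k, t) - h (x0, t) = hx (xi, t) * k.
    have cc p q : {within `[p, q], continuous (fun s => h (s, t))}.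
      apply: continuous_subspaceT.
      by apply: (continuous2 ch); [exact: cont_id|exact: cst_continuous].
    case: (leP 0 k) => k0.
      have [||c cc' E] := @MVT_segment R (fun s => h (s, t)) (fun s => hx (s, t)) x0 (x0 + k).
      + lra.
      + exact: cc.
      exists c; last by rewrite E; ring.
      by move: cc'; rewrite in_itv/= => /andP[? ?]; rewrite !ger0_norm//; lra.
    have [||c cc' E] := @MVT_segment R (fun s => h (s, t)) (fun s => hx (s, t)) (x0 + k) x0.
    + lra.
    + exact: cc.
    exists c; last by apply: oppr_inj; rewrite opprB E; ring.
    by move: cc'; rewrite in_itv/= => /andP[? ?]; rewrite !ler0_norm//; lra.
  have -> : hx (xi, t) * k - k * hx (x0, t) = (hx (xi, t) - hx (x0, t)) * k by ring.
  rewrite normrM ler_wpM2r// ltW//; apply: Hd => //.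
  by rewrite /ball/= distrC (le_lt_trans xik).
rewrite -mulrA mulrCA mulrC ler_wpM2r// -[leRHS]mulr1.
rewrite -mulrA ler_pM2l// mulrC ler_pdivrMr// mul1r /L; lra.
Qed.

(** Both sides have the same derivative with respect to the upper bound [y]. *)
Lemma oint_swap F a b c y : continuous F ->
  oint a b (fun x => oint c y (fun t => F (x, t))) =
  oint c y (fun t => oint a b (fun x => F (x, t))).
Proof.
move=> cF.
have cF' : continuous (fun z : R * R => F (z.2, z.1)).
  by apply: (continuous2 cF); [exact: cont_snd|exact: cont_fst].
have E := @oint_FTC2 R c y (fun y => oint a b (fun x => oint c y (fun t => F (x, t))))
   (fun t => oint a b (fun x => F (x, t))).
rewrite E.
- have -> : (fun x => oint c c (fun t => F (x, t))) = (fun=> 0).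
    by apply/funext => x; rewrite oint_xx.
  by rewrite oint_cst mul0r subr0.
- apply: (@continuous_oint2 _ _ (fun z : R * R => F (z.2, z.1))) => //.
  + exact: cont_id.
  + exact: cst_continuous.
  + exact: cst_continuous.
- move=> t.
  apply: (@is_derive_oint_param (fun z : R * R => oint c z.1 (fun t => F (z.2, t)))
     (fun z : R * R => F (z.2, z.1))) => //.
    apply: (@continuous_oint2 _ _ F) => //; [exact: cont_snd|exact: cst_continuous|exact: cont_fst].
  move=> x s /=; apply: is_derive_oint.
  by apply: (continuous2 cF); [exact: cst_continuous|exact: cont_id].
Qed.

End TwoVariables.

(** * Integration over the plane *)

Section PlaneIntegral.
Variable R : realType.
Implicit Types (F G : R * R -> R) (f g : R -> R) (a b c x y N M : R).

Let mR := measurableTypeR R.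

(** An open set is the union of the countably many rational boxes inside it. *)
Lemma open2_measurable (U : set (mR * mR)) : @open (R * R)%type U -> measurable U.
Proof.
move=> oU.
pose r (q : rat * rat) : set (mR * mR) :=
  `]ratr q.1, ratr q.2[%classic `*` setT.
pose box (q : (rat * rat) * (rat * rat)) : set (mR * mR) :=
  `](ratr q.1.1 : R), ratr q.1.2[%classic `*` `](ratr q.2.1 : R), ratr q.2.2[%classic.
have -> : U = \bigcup_(q in [set q | box q `<=` U]) box q.
  apply/seteqP; split => [[x y] Uxy|z [q /= qU qz]]; last exact: qU.
  have /nbhs_ballP[e /= e0 He] : nbhs ((x, y) : R * R) U by apply: open_nbhs_nbhs; split.
  have rt (t : R) : exists q : rat * rat, [/\ ratr q.1 < t, t < ratr q.2,
      t - e < ratr q.1 & ratr q.2 < t + e].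
    have /rat_in_itvoo[p] : t - e < t by lra.
    have /rat_in_itvoo[q] : t < t + e by lra.
    rewrite !in_itv/= => /andP[? ?] /andP[? ?]; by exists (p, q); split.
  have [q [q1 q2 q3 q4]] := rt x; have [s [s1 s2 s3 s4]] := rt y.
  exists (q, s) => /=; last by split => /=; rewrite in_itv/=; apply/andP.
  move=> -[x' y'] [/=]; rewrite !in_itv/= => /andP[a1 a2] /andP[a3 a4].
  by apply: He; split; rewrite /ball/= ltr_norml; apply/andP; split; lra.
rewrite bigcup_mkcond; apply: countable_bigcupT_measurable; first exact: countableP.
move=> q; case: ifPn => // _; apply: measurableX; exact: measurable_itv.
Qed.

Lemma cont_measurable F : continuous F -> measurable_fun [set: mR * mR] F.
Proof.
move=> /continuousP cF; apply: (measurability _ (measurable_realfun.RGenOpens.measurableE R)).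
move=> _ [_ [a [b ->] <-]]; rewrite setTI; apply: open2_measurable.
exact/cF/interval_open.
Qed.

Definition boxed N F := forall z, F z != 0 -> `|z.1| < N /\ `|z.2| < N.

Lemma boxedM N F G : boxed N F -> boxed N (fun z => F z * G z).
Proof. by move=> h z; rewrite mulf_eq0 negb_or => /andP[/h]. Qed.

Lemma boxedMr N F G : boxed N F -> boxed N (fun z => G z * F z).
Proof. by move=> h z; rewrite mulf_eq0 negb_or => /andP[_ /h]. Qed.

Lemma boxedD N F G : boxed N F -> boxed N G -> boxed N (fun z => F z + G z).
Proof.
move=> hF hG z; case: (eqVneq (F z) 0) => [->|/hF//]; rewrite add0r; exact: hG.
Qed.

Lemma boxed_le N N' F : N <= N' -> boxed N F -> boxed N' F.
Proof. by move=> NN h z /h[? ?]; split; apply: lt_le_trans NN. Qed.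

Lemma boxed_bounded N F : continuous F -> boxed N F ->
  exists2 M, 0 <= M & forall z, `|F z| <= M.
Proof.
move=> cF bF.
have K : compact (`[- N, N]%classic `*` `[- N, N]%classic : set (R * R)).
  by apply: compact_setX; exact: segment_compact.
have /compact_bounded[M [_ HM]] : compact (F @` (`[- N, N]%classic `*` `[- N, N]%classic)).
  by apply: continuous_compact => //; exact: continuous_subspaceT.
exists (`|M| + 1) => [|z]; first by rewrite addr_ge0.
case: (eqVneq (F z) 0) => [->|Fz]; first by rewrite normr0 addr_ge0.
apply: HM; first by rewrite ltr_pwDr// ler_norm.
have [/ltW + /ltW] := bF _ Fz; rewrite !ler_norml => h1 h2.
by exists z => //; split; rewrite /= in_itv.
Qed.

Let box N : set (mR * mR) := `[- N, N]%classic `*` `[- N, N]%classic.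

Let measurable_box N : measurable (box N).
Proof. by apply: measurableX; exact: measurable_itv. Qed.

Let box_fin N : (@mu2 R (box N) < +oo)%E.
Proof.
rewrite /mu2/= product_measure1E; [|exact: measurable_itv|exact: measurable_itv].
have E : (@lebesgue_measure R `[(- N)%R, N]%classic < +oo)%E.
  by apply: compact_finite_measure; exact: segment_compact.
by apply: lte_mul_pinfty => //; rewrite ge0_fin_numE.
Qed.

Lemma bounded_set_fin N (D : set (mR * mR)) : measurable D ->
  (forall z, D z -> `|z.1| < N /\ `|z.2| < N) -> (@mu2 R D < +oo)%E.
Proof.
move=> mD DN; apply: le_lt_trans (box_fin N); apply: le_measure; rewrite ?inE//.
by move=> z /DN[/ltW + /ltW]; rewrite !ler_norml => ? ?; split; rewrite /= in_itv.
Qed.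

Lemma boxed_integrable N F : continuous F -> boxed N F ->
  (@mu2 R).-integrable setT (EFin \o F).
Proof.
move=> cF bF; have [M M0 HM] := boxed_bounded cF bF.
have H : (@mu2 R).-integrable (box N) (EFin \o F).
  apply: measurable_bounded_integrable => //; first exact: box_fin.
    apply: measurable_funS (cont_measurable cF) => //.
  by exists M; split; [rewrite num_real|move=> x Mx z _; apply: le_trans (HM _) (ltW Mx)].
move: H; rewrite integrable_mkcond//; apply: eq_integrable => //.
move=> z _; rewrite /patch; case: ifPn => // /negP zb.
case: (eqVneq (F z) 0) => [/= ->//|/bF[/ltW + /ltW]].
rewrite !ler_norml => h1 h2; exfalso; apply: zb; rewrite inE; split; rewrite /= in_itv//.
Qed.

(** Brings Lebesgue integrals of compactly supported functions back to the
    oriented integral, whose calculus is used everywhere else. *)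
Lemma integral_line N f : 0 <= N -> continuous f -> (forall x, f x != 0 -> `|x| < N) ->
  (\int[@mu1 R]_x (f x)%:E = (oint (- N) N f)%:E)%E.
Proof.
move=> N0 cf bf.
rewrite oint_Rintegral//; last by lra.
rewrite /Rintegral fineK; last first.
  apply: integrable_fin_num => //; exact: continuous_integrable_itv.
rewrite [RHS]integral_mkcond; apply: eq_integral => x _.
rewrite /patch; case: ifPn => // /negP xN.
case: (eqVneq (f x) 0) => [->//|/bf/ltW]; rewrite ler_norml => h.
by exfalso; apply: xN; rewrite inE/= in_itv.
Qed.

Lemma plane_fubini N F : 0 <= N -> continuous F -> boxed N F ->
  \int[@mu2 R]_z F z = oint (- N) N (fun x => oint (- N) N (fun y => F (x, y))).
Proof.
move=> N0 cF bF; rewrite /Rintegral /mu2.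
rewrite -integral12_prod_meas1; last exact: (boxed_integrable cF bF).
rewrite /fubini_F.
have -> : (fun x => \int[lebesgue_measure]_y (EFin \o F) (x, y))%E =
   (fun x : R => (oint (- N) N (fun y => F (x, y)))%:E).
  apply/funext => x; apply: (integral_line N0).
    by apply: (continuous2 cF); [exact: cst_continuous|exact: cont_id].
  by move=> y /bF[].
rewrite (integral_line N0)//.
- by apply: (continuous_oint2 cF); [exact: cont_id|exact: cst_continuous|exact: cst_continuous].
- move=> x Ix; rewrite ltNge; apply: contra Ix => Nx.
  have -> : (fun y => F (x, y)) = (fun=> 0).
    apply/funext => y; apply/eqP; apply: contraLR Nx => /bF[/= h _].
    by rewrite -ltNge.
  by rewrite oint_cst mul0r.
Qed.

End PlaneIntegral.

(** * Steklov averages *)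

Section Steklov.
Variable R : realType.
Implicit Types (F G f g : R * R -> R) (a b c x y k N : R).

Definition plane F := \int[@mu2 R]_z F z.

Definition stek1 k F (z : R * R) := k^-1 * oint z.1 (z.1 + k) (fun s => F (s, z.2)).
Definition stek2 k F (z : R * R) := k^-1 * oint z.2 (z.2 + k) (fun t => F (z.1, t)).
(** The average over a square of side [k] is [C^1] as soon as the function is
    continuous. For [k] and [- k], differentiation of averages is
    skew-adjoint ([stek_adjoint1], [stek_adjoint2]): this is the symmetry behind
    the Leibniz rule for products of two Sobolev functions. *)
Definition stek k F := stek1 k (stek2 k F).
Definition quot1 k F (z : R * R) := k^-1 * (F (z.1 + k, z.2) - F z).
Definition quot2 k F (z : R * R) := k^-1 * (F (z.1, z.2 + k) - F z).
(** Carries the facts about one variable over to the other. *)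
Definition swap_fun F (z : R * R) := F (z.2, z.1).

Lemma cont_swap F : continuous F -> continuous (swap_fun F).
Proof. by move=> cF; apply: (continuous2 cF); [exact: cont_snd|exact: cont_fst]. Qed.

Lemma cont_slice1 F y : continuous F -> continuous (fun x => F (x, y)).
Proof. by move=> cF; apply: (continuous2 cF); [exact: cont_id|exact: cont_cst]. Qed.

Lemma cont_slice2 F x : continuous F -> continuous (fun y => F (x, y)).
Proof. by move=> cF; apply: (continuous2 cF); [exact: cont_cst|exact: cont_id]. Qed.

Lemma cont_shift1 F k : continuous F -> continuous (fun z => F (z.1 + k, z.2)).
Proof.
move=> cF; apply: (continuous2 cF); last exact: cont_snd.
by apply: cont_add; [exact: cont_fst|exact: cont_cst].
Qed.

Lemma cont_stek2 k F : continuous F -> continuous (stek2 k F).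
Proof.
move=> cF; apply: cont_mul; first exact: cont_cst.
apply: (continuous_oint2 cF); [exact: cont_fst|exact: cont_snd|].
by apply: cont_add; [exact: cont_snd|exact: cont_cst].
Qed.

Lemma stek1_swap k F : stek1 k F = swap_fun (stek2 k (swap_fun F)).
Proof. by []. Qed.

Lemma quot2_swap k F : quot2 k F = swap_fun (quot1 k (swap_fun F)).
Proof. by rewrite /quot2 /swap_fun /quot1 /=; apply/funext => -[]. Qed.

Lemma cont_stek1 k F : continuous F -> continuous (stek1 k F).
Proof. by move=> cF; rewrite stek1_swap; apply/cont_swap/cont_stek2/cont_swap. Qed.

Lemma cont_quot1 k F : continuous F -> continuous (quot1 k F).
Proof.
move=> cF; apply: cont_mul; first exact: cont_cst.
by apply: cont_sub => //; exact: cont_shift1.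
Qed.

Lemma cont_quot2 k F : continuous F -> continuous (quot2 k F).
Proof. by move=> cF; rewrite quot2_swap; apply/cont_swap/cont_quot1/cont_swap. Qed.

Lemma is_derive_prim_shift (f : R -> R) k x : continuous f ->
  is_derive x 1 (fun y => prim f (y + k)) (f (x + k)).
Proof.
move=> cf; apply: (der1_eq (a := f (x + k) * (1 + 0))); last by ring.
apply: (@der1_comp _ (prim f) (fun y => y + k) x (f (x + k)) (1 + 0) (is_derive_prim _ cf)).
Qed.

Lemma is_derive_window (f : R -> R) k x : continuous f ->
  is_derive x 1 (fun y => k^-1 * oint y (y + k) f) (k^-1 * (f (x + k) - f x)).
Proof.
move=> cf; rewrite /oint.
apply: (der1_eq (a := 0 * (prim f (x + k) - prim f x) + k^-1 * (f (x + k) - f x))); last by ring.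
exact: (der1_mul (der1_cst x k^-1) (der1_sub (is_derive_prim_shift k x cf) (is_derive_prim x cf))).
Qed.

Lemma stek_derive1 k F x y : continuous F ->
  is_derive x 1 (fun s => stek k F (s, y)) (quot1 k (stek2 k F) (x, y)).
Proof.
by move=> cF; exact/(@is_derive_window (fun s => stek2 k F (s, y)))/cont_slice1/cont_stek2.
Qed.

(** The inner average is differentiated under the outer one; the result is the
    average of a difference quotient, not the quotient of an average. *)
Lemma stek_derive2 k F x y : continuous F ->
  is_derive y 1 (fun t => stek k F (x, t)) (stek1 k (quot2 k F) (x, y)).
Proof.
move=> cF; rewrite /stek /stek1 /=.
apply: (der1_eq (a := 0 * oint x (x + k) (fun s => stek2 k F (s, y)) +
   k^-1 * oint x (x + k) (fun s => quot2 k F (s, y)))); last by ring.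
apply: (der1_mul (der1_cst y k^-1)).
apply: (@is_derive_oint_param _ (swap_fun (stek2 k F)) (swap_fun (quot2 k F))).
- exact/cont_swap/cont_stek2.
- exact/cont_swap/cont_quot2.
- move=> s t; rewrite /swap_fun /stek2 /quot2 /=.
  by have := @is_derive_window (fun q => F (t, q)) k s (@cont_slice2 F t cF).
Qed.

Lemma oint_eq0 a b (f : R -> R) : continuous f ->
  (forall x, Num.min a b <= x <= Num.max a b -> f x = 0) -> oint a b f = 0.
Proof.
move=> cf f0; rewrite (@eq_oint _ a b f (fun=> 0))//; last exact: cont_cst.
by rewrite oint_cst mul0r.
Qed.

Lemma line_shift N k (f : R -> R) : continuous f -> (forall x, f x != 0 -> `|x| < N - `|k|) ->
  oint (- N) N (fun x => f (x + k)) = oint (- N) N f.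
Proof.
move=> cf f0; rewrite oint_shift//.
have z p : `|p| >= N -> oint p (p + k) f = 0.
  move=> Np; apply: oint_eq0 => // t tp; apply/eqP; apply: contraT => /f0.
  have : `|t - p| <= `|k|.
    move: tp; case: (leP p (p + k)) => h /andP[? ?].
      by rewrite !ger0_norm//; lra.
    by rewrite !ler0_norm//; lra.
  move: (ler_normD (p - t) t); rewrite subrK distrC; lra.
have h1 : oint N (N + k) f = 0 by apply: z; exact: ler_norm.
have h2 : oint (- N) (- N + k) f = 0 by apply: z; rewrite normrN ler_norm.
have := oint_chasles (- N) (- N + k) (N + k) f.
rewrite (oint_sym (- N)) h2 oppr0 add0r => ->.
by rewrite (oint_chasles N) h1 addr0.
Qed.

(** Both sides integrate [g y * f s] over the strip between [s = y] and
    [s = y + k], with the two orders of integration. *)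
Lemma line_adjoint N k (f g : R -> R) : continuous f -> continuous g ->
  (forall x, f x != 0 -> `|x| < N - `|k|) ->
  oint (- N) N (fun y => g y * oint y (y + k) f) =
  - oint (- N) N (fun y => oint y (y - k) g * f y).
Proof.
move=> cf cg f0.
pose P := fun y => oint y (y + k) f.
have dP y : is_derive y 1 P (f (y + k) - f y).
  exact: (der1_sub (is_derive_prim_shift k y cf) (is_derive_prim y cf)).
have cs (h : R -> R) q : continuous h -> continuous (fun y => h (y + q)).
  by move=> ch; apply: cont_comp => //; apply: cont_add; [exact: cont_id|exact: cont_cst].
have cP : continuous (prim g) by exact: continuous_prim.
rewrite (@oint_parts _ (- N) N (prim g) g P (fun y => f (y + k) - f y))//; last 2 first.
- by apply: cont_sub => //; exact: cs.
- by move=> y; exact: is_derive_prim.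
have z p : `|p| >= N -> P p = 0.
  move=> Np; apply: oint_eq0 => // t tp; apply/eqP; apply: contraT => /f0.
  have : `|t - p| <= `|k|.
    move: tp; case: (leP p (p + k)) => h /andP[? ?].
      by rewrite !ger0_norm//; lra.
    by rewrite !ler0_norm//; lra.
  move: (ler_normD (p - t) t); rewrite subrK distrC; lra.
rewrite (z N) ?ler_norm// (z (- N)) ?normrN ?ler_norm// !mulr0 subrr sub0r.
congr (- _).
have -> : (fun y => prim g y * (f (y + k) - f y)) =
  (fun y => prim g (y + k - k) * f (y + k) - prim g y * f y).
  by apply/funext => y; rewrite addrK mulrBr.
have c1 : continuous (fun y => prim g (y - k) * f y).
  by apply: cont_mul => //; exact: cs.
have c2 : continuous (fun y => prim g y * f y) by exact: cont_mul.
rewrite ointB//; last exact: (cs (fun y => prim g (y - k) * f y) k).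
rewrite (@line_shift N k (fun y => prim g (y - k) * f y))//; last first.
  by move=> y; rewrite mulf_eq0 negb_or => /andP[_ /f0].
by rewrite -ointB//; congr (oint _ _ _); apply/funext => y; rewrite -mulrBl.
Qed.

Lemma plane_swap N F : 0 <= N -> continuous F -> boxed N F ->
  plane (swap_fun F) = plane F.
Proof.
move=> N0 cF bF.
have bS : boxed N (swap_fun F) by move=> z /bF[].
rewrite /plane (plane_fubini N0 cF bF) (plane_fubini N0 (cont_swap cF) bS).
exact: (@oint_swap _ (swap_fun F) (- N) N (- N) N (cont_swap cF)).
Qed.

Lemma plane_shift1 N k F : 0 <= N -> continuous F -> boxed N F ->
  plane (fun z => F (z.1 + k, z.2)) = plane F.
Proof.
move=> N0 cF bF; pose M := N + `|k|.
have M0 : 0 <= M by rewrite addr_ge0.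
have bM : boxed M F by apply: boxed_le bF; rewrite lerDl.
have bS : boxed M (fun z => F (z.1 + k, z.2)).
  move=> z /bF[/= h1 h2]; split; last by rewrite (lt_le_trans h2)// lerDl.
  have := ler_normB (z.1 + k) k; rewrite addrK /M; lra.
rewrite /plane (plane_fubini M0 cF bM) (plane_fubini M0 (@cont_shift1 F k cF) bS).
apply: (@line_shift M k (fun x => oint (- M) M (fun y => F (x, y)))).
  by apply: (continuous_oint2 cF); [exact: cont_id|exact: cont_cst|exact: cont_cst].
move=> x; rewrite /M addrK => Fx; rewrite ltNge; apply: contra Fx => Fx.
rewrite oint_eq0//; first exact: cont_slice2.
by move=> y _; apply/eqP; apply: contraT => /bF[/=]; rewrite ltNge Fx.
Qed.

Lemma plane_adjoint2 N k F G : 0 <= N -> continuous F -> continuous G ->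
  boxed N F -> boxed N G ->
  plane (fun z => G z * stek2 k F z) = plane (fun z => stek2 (- k) G z * F z).
Proof.
move=> N0 cF cG bF bG; pose M := N + `|k|.
have M0 : 0 <= M by rewrite addr_ge0.
have NM : N <= M by rewrite lerDl.
have bM1 : boxed M (fun z => G z * stek2 k F z) by exact/boxedM/(boxed_le NM).
have bM2 : boxed M (fun z => stek2 (- k) G z * F z) by exact/boxedMr/(boxed_le NM).
rewrite /plane (plane_fubini M0 (cont_mul cG (@cont_stek2 k F cF)) bM1).
rewrite (plane_fubini M0 (cont_mul (@cont_stek2 (- k) G cG) cF) bM2).
congr (oint _ _ _); apply/funext => x; rewrite /stek2 /=.
have c1 : continuous (fun y => oint y (y + k) (fun t => F (x, t))).
  apply: (@continuous_oint2 _ _ _ F (fun=> x)) => //; [exact: cont_cst|exact: cont_id|].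
  by apply: cont_add; [exact: cont_id|exact: cont_cst].
have c2 : continuous (fun y => oint y (y - k) (fun t => G (x, t))).
  apply: (@continuous_oint2 _ _ _ G (fun=> x)) => //; [exact: cont_cst|exact: cont_id|].
  by apply: cont_sub; [exact: cont_id|exact: cont_cst].
have -> : (fun y => G (x, y) * (k^-1 * oint y (y + k) (fun t => F (x, t)))) =
  (fun y => k^-1 * (G (x, y) * oint y (y + k) (fun t => F (x, t)))).
  by apply/funext => y; ring.
have -> : (fun y => (- k)^-1 * oint y (y - k) (fun t => G (x, t)) * F (x, y)) =
  (fun y => - k^-1 * (oint y (y - k) (fun t => G (x, t)) * F (x, y))).
  by apply/funext => y; rewrite invrN; ring.
rewrite !ointZ; last 2 first.
- by apply: cont_mul => //; exact: cont_slice2.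
- by apply: cont_mul => //; exact: cont_slice2.
rewrite (@line_adjoint M k (fun t => F (x, t)) (fun t => G (x, t))); first by ring.
- exact: cont_slice2.
- exact: cont_slice2.
- by move=> y /bF[_ /=]; rewrite /M addrK.
Qed.

Lemma plane_adjoint1 N k F G : 0 <= N -> continuous F -> continuous G ->
  boxed N F -> boxed N G ->
  plane (fun z => G z * stek1 k F z) = plane (fun z => stek1 (- k) G z * F z).
Proof.
move=> N0 cF cG bF bG.
have := @plane_adjoint2 N k _ _ N0 (cont_swap cF) (cont_swap cG).
move=> /(_ _ _) H.
rewrite -(@plane_swap N)//; last 2 first.
- by apply: cont_mul => //; exact: cont_stek1.
- exact/boxedM.
rewrite -[RHS](@plane_swap N)//; last 2 first.
- by apply: cont_mul => //; exact: cont_stek1.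
- exact/boxedMr.
by apply: H => z; [move=> /bF[]|move=> /bG[]].
Qed.

Lemma planeD N F G : continuous F -> continuous G -> boxed N F -> boxed N G ->
  plane (fun z => F z + G z) = plane F + plane G.
Proof.
move=> cF cG bF bG; apply: RintegralD => //.
  exact: (boxed_integrable cF bF).
exact: (boxed_integrable cG bG).
Qed.

Lemma planeZ N k F : continuous F -> boxed N F ->
  plane (fun z => k * F z) = k * plane F.
Proof. by move=> cF bF; apply: RintegralZl => //; exact: (boxed_integrable cF bF). Qed.

Lemma plane_quot1 N k F G : 0 <= N -> continuous F -> continuous G ->
  boxed N G ->
  plane (fun z => G z * quot1 k F z) = - plane (fun z => quot1 (- k) G z * F z).
Proof.
move=> N0 cF cG bG; pose M := N + `|k|.
have NM : N <= M by rewrite lerDl.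
have bGk : boxed M (fun z => G (z.1 - k, z.2)).
  move=> z /bG[/= h1 h2]; split; last by rewrite (lt_le_trans h2).
  have := ler_normD (z.1 - k) k; rewrite subrK /M; lra.
have cGk : continuous (fun z => G (z.1 - k, z.2)) by exact: cont_shift1.
have E1 : plane (fun z => G z * F (z.1 + k, z.2)) = plane (fun z => G (z.1 - k, z.2) * F z).
  rewrite -(@plane_shift1 M k (fun z => G (z.1 - k, z.2) * F z))//.
  - by congr plane; apply/funext => -[x y] /=; rewrite addrK.
  - by rewrite addr_ge0.
  - exact: cont_mul.
  - exact: boxedM.
have bG' := boxed_le NM bG.
have -> : (fun z => G z * quot1 k F z) =
   (fun z => k^-1 * (G z * F (z.1 + k, z.2) + -1 * (G z * F z))).
  by apply/funext => z; rewrite /quot1; ring.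
have -> : (fun z => quot1 (- k) G z * F z) =
   (fun z => - k^-1 * (G (z.1 - k, z.2) * F z + -1 * (G z * F z))).
  by apply/funext => z; rewrite /quot1 invrN; ring.
have cGF : continuous (fun z => G z * F z) by exact: cont_mul.
have cGF' : continuous (fun z => - 1 * (G z * F z)) by apply: cont_mul => //; exact: cont_cst.
have cGFk : continuous (fun z => G z * F (z.1 + k, z.2)) by apply: cont_mul => //; exact: cont_shift1.
have cGkF : continuous (fun z => G (z.1 - k, z.2) * F z) by exact: cont_mul.
have b1 : boxed M (fun z => G z * F z) by exact: boxedM.
have b1' : boxed M (fun z => -1 * (G z * F z)) by exact: boxedMr.
have b2 : boxed M (fun z => G z * F (z.1 + k, z.2)) by exact: (@boxedM _ M G (fun z => F (z.1 + k, z.2)) bG').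
have b3 : boxed M (fun z => G (z.1 - k, z.2) * F z) by exact: boxedM.
rewrite (@planeZ M); [|exact: cont_add|exact: boxedD].
rewrite (@planeZ M); [|exact: cont_add|exact: boxedD].
by rewrite (@planeD M)// (@planeD M)// E1; ring.
Qed.

Lemma plane_quot2 N k F G : 0 <= N -> continuous F -> continuous G ->
  boxed N G ->
  plane (fun z => G z * quot2 k F z) = - plane (fun z => quot2 (- k) G z * F z).
Proof.
move=> N0 cF cG bG; pose M := N + `|k|.
have M0 : 0 <= M by rewrite addr_ge0.
have NM : N <= M by rewrite lerDl.
rewrite -(@plane_swap N)//; last 2 first.
- by apply: cont_mul => //; exact: cont_quot2.
- exact/boxedM.
rewrite -(@plane_swap M (fun z => quot2 (- k) G z * F z))//; last 2 first.
- by apply: cont_mul => //; exact: cont_quot2.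
- apply: boxedM => z; rewrite mulf_eq0 negb_or => /andP[_].
  case: (eqVneq (G z) 0) => [->|/bG[h1 h2 _]]; last first.
    by split; apply: lt_le_trans NM.
  rewrite subr0 => /bG[/= h1 h2]; split; first by rewrite (lt_le_trans h1).
  have := ler_normD (z.2 - k) k; rewrite subrK /M; lra.
have E u H : swap_fun (quot2 u H) = quot1 u (swap_fun H).
  by rewrite quot2_swap; apply/funext => -[].
have := @plane_quot1 N k (swap_fun F) (swap_fun G) N0 (cont_swap cF) (cont_swap cG).
rewrite -!E; apply.
by move=> z /bG[].
Qed.

Lemma boxed_quot1 N k F : boxed N F -> boxed (N + `|k|) (quot1 k F).
Proof.
move=> bF z; rewrite mulf_eq0 negb_or => /andP[_].
have NM : N <= N + `|k| by rewrite lerDl.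
case: (eqVneq (F z) 0) => [->|/bF[h1 h2 _]]; last by split; apply: lt_le_trans NM.
rewrite subr0 => /bF[/= h1 h2]; split; last by rewrite (lt_le_trans h2).
have := ler_normB (z.1 + k) k; rewrite addrK; lra.
Qed.

Lemma boxed_quot2 N k F : boxed N F -> boxed (N + `|k|) (quot2 k F).
Proof.
move=> bF z; rewrite mulf_eq0 negb_or => /andP[_].
have NM : N <= N + `|k| by rewrite lerDl.
case: (eqVneq (F z) 0) => [->|/bF[h1 h2 _]]; last by split; apply: lt_le_trans NM.
rewrite subr0 => /bF[/= h1 h2]; split; first by rewrite (lt_le_trans h1).
have := ler_normB (z.2 + k) k; rewrite addrK; lra.
Qed.

Lemma stek2_quot1 k l F : continuous F -> stek2 l (quot1 k F) = quot1 k (stek2 l F).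
Proof.
move=> cF; apply/funext => z; rewrite /stek2 /quot1 /=.
rewrite ointZ; last by apply: cont_sub; exact: cont_slice2.
by rewrite ointB; [ring|exact: cont_slice2|exact: cont_slice2].
Qed.

Lemma stek_adjoint1 N k F G : 0 <= N -> continuous F -> continuous G ->
  boxed N F -> boxed N G ->
  plane (fun z => G z * quot1 k (stek2 k F) z) =
  - plane (fun z => quot1 (- k) (stek2 (- k) G) z * F z).
Proof.
move=> N0 cF cG bF bG.
rewrite (@plane_quot1 N)//; last exact: cont_stek2.
have bq : boxed (N + `|k|) (quot1 (- k) G) by rewrite -(normrN k); exact: boxed_quot1.
rewrite (@plane_adjoint2 (N + `|k|) k F (quot1 (- k) G)) ?addr_ge0//.
- by rewrite stek2_quot1.
- exact: cont_quot1.
- by apply: boxed_le bF; rewrite lerDl.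
Qed.

Lemma boxed_stek1 N k F : continuous F -> boxed N F ->
  boxed (N + `|k|) (stek1 k F).
Proof.
move=> cF bF z; rewrite /stek1 => H; apply/andP; apply: contraT => Hz.
have E : oint z.1 (z.1 + k) (fun s => F (s, z.2)) = 0.
  apply: oint_eq0; first exact: cont_slice1.
  move=> s hs; apply/eqP; apply: contraT => /bF[/= s1 s2]; move: Hz.
  have : `|s - z.1| <= `|k|.
    move: hs; case: (leP z.1 (z.1 + k)) => h /andP[? ?].
      by rewrite !ger0_norm//; lra.
    by rewrite !ler0_norm//; lra.
  have := ler_normD (z.1 - s) s; rewrite subrK distrC => h1 h2.
  have -> : `|z.1| < N + `|k| by lra.
  by rewrite (lt_le_trans s2)// lerDl.
by move: H; rewrite E mulr0 eqxx.
Qed.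

Lemma stek_adjoint2 N k F G : 0 <= N -> continuous F -> continuous G ->
  boxed N F -> boxed N G ->
  plane (fun z => G z * stek1 k (quot2 k F) z) =
  - plane (fun z => stek1 (- k) (quot2 (- k) G) z * F z).
Proof.
move=> N0 cF cG bF bG.
have h k' H : boxed N H -> boxed (N + `|k'|) (quot2 k' H) by exact: boxed_quot2.
have NM : N <= N + `|k| by rewrite lerDl.
have M0 : 0 <= N + `|k| by rewrite addr_ge0.
rewrite (@plane_adjoint1 (N + `|k|))//; [|exact: cont_quot2|exact: boxed_quot2|exact: boxed_le bG].
have Ec : stek1 (- k) (quot2 (- k) G) = quot2 (- k) (stek1 (- k) G).
  rewrite !stek1_swap !quot2_swap.
  have -> : swap_fun (swap_fun (quot1 (- k) (swap_fun G))) = quot1 (- k) (swap_fun G).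
    by apply/funext => -[].
  rewrite stek2_quot1; last exact: cont_swap.
  by congr swap_fun; congr quot1; apply/funext => -[].
rewrite Ec; apply: (@plane_quot2 (N + `|k|)) => //; first exact: cont_stek1.
by rewrite -(normrN k); exact: boxed_stek1.
Qed.

Lemma window_close a k (f : R -> R) c e : k != 0 -> continuous f ->
  (forall t, `|t - a| <= `|k| -> `|f t - c| <= e) ->
  `|k^-1 * oint a (a + k) f - c| <= e.
Proof.
move=> k0 cf H.
have -> : k^-1 * oint a (a + k) f - c = k^-1 * oint a (a + k) (fun t => f t - c).
  rewrite ointB//; last exact: cont_cst.
  rewrite oint_cst; have -> : a + k - a = k by ring.
  by field.
rewrite normrM normfV ler_pdivrMl ?normr_gt0// mulrC.
have := @oint_norm_le _ a (a + k) (fun t => f t - c) e.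
have -> : a + k - a = k by ring.
apply.
  by apply: cont_sub => //; exact: cont_cst.
move=> t ht; apply: H; move: ht; case: (leP a (a + k)) => h /andP[? ?].
  by rewrite !ger0_norm//; lra.
by rewrite !ler0_norm//; lra.
Qed.

(** Heine's theorem; outside a slightly larger square both values are 0. *)
Lemma boxed_unif N F (e : R) : continuous F -> boxed N F -> 0 < e ->
  exists2 r : R, 0 < r & forall x y x' y',
    `|x' - x| <= r -> `|y' - y| <= r -> `|F (x', y') - F (x, y)| <= e.
Proof.
move=> cF bF e0; pose M := N + 1.
have K : compact (`[- M, M]%classic `*` `[- M, M]%classic : set (R * R)).
  by apply: compact_setX; exact: segment_compact.
have /compact_near_coveringP := K.
move=> /(_ (R * R)%type (nbhs ((0, 0) : R * R))
   (fun h z => `|F (z.1 + h.1, z.2 + h.2) - F z| < e) _).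
case=> [z _|[A B]/= [A0 B0] AB].
  have c : continuous (fun p : (R * R) * (R * R) =>
      F (p.1.1 + p.2.1, p.1.2 + p.2.2) - F p.1).
    apply: cont_sub; last by apply: cont_comp => // p; exact: cvg_fst.
    apply: (continuous2 cF); apply: cont_add.
    - by apply: (@cont_comp _ _ _ fst fst) => p; exact: cvg_fst.
    - by apply: (@cont_comp _ _ _ fst snd) => p; [exact: cvg_fst|exact: cvg_snd].
    - by apply: (@cont_comp _ _ _ snd fst) => p; [exact: cvg_snd|exact: cvg_fst].
    - by apply: (@cont_comp _ _ _ snd snd) => p; exact: cvg_snd.
  have /cvgrPdist_lt/(_ _ e0) := c (z, (0, 0)).
  rewrite /= !addr0 -surjective_pairing subrr.
  by apply: filterS => -[z' h] /=; rewrite sub0r normrN.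
have /nbhs_ballP[r1 /= r10 H1] := A0; have /nbhs_ballP[r2 /= r20 H2] := B0.
pose r := Num.min 1 (Num.min r1 r2) / 2.
have m0 : 0 < Num.min 1 (Num.min r1 r2) by rewrite !lt_min ltr01 r10 r20.
have m1 : Num.min 1 (Num.min r1 r2) <= 1 by rewrite ge_min lexx.
have m2 : Num.min 1 (Num.min r1 r2) <= r1 by rewrite !ge_min lexx orbT.
have m3 : Num.min 1 (Num.min r1 r2) <= r2 by rewrite !ge_min lexx !orbT.
exists r => [|x y x' y' hx hy]; first by rewrite /r; lra.
case: (leP `|x| M) => [xM|xM].
- case: (leP `|y| M) => [yM|yM].
  + have /= := AB (x' - x, y' - y) _ (x, y) _.
    rewrite !(addrC _ (_ - _)) !subrK => H; apply/ltW/H.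
    * split => /=; [apply: H1|apply: H2]; rewrite /ball/= sub0r normrN;
      [apply: (le_lt_trans hx)|apply: (le_lt_trans hy)]; rewrite /r; lra.
    * by split; rewrite /= in_itv/= -ler_norml.
  + have -> : F (x, y) = 0.
      by apply/eqP; apply: contraT => /bF[_ /=]; rewrite /M in yM; lra.
    have -> : F (x', y') = 0.
      apply/eqP; apply: contraT => /bF[_ /=].
      have := ler_normD (y - y') y'; rewrite subrK distrC; rewrite /r in hy; rewrite /M in yM; lra.
    by rewrite subrr normr0 ltW.
- have -> : F (x, y) = 0.
    by apply/eqP; apply: contraT => /bF[/= + _]; rewrite /M in xM; lra.
  have -> : F (x', y') = 0.
    apply/eqP; apply: contraT => /bF[/= + _].
    have := ler_normD (x - x') x'; rewrite subrK distrC; rewrite /r in hx; rewrite /M in xM; lra.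
  by rewrite subrr normr0 ltW.
Qed.

Lemma stek_close N F (e : R) : continuous F -> boxed N F -> 0 < e ->
  exists2 r : R, 0 < r & forall k, k != 0 -> `|k| <= r ->
    forall z, `|stek k F z - F z| <= e.
Proof.
move=> cF bF e0; have [r r0 Hr] := boxed_unif cF bF e0.
exists r => // k k0 kr [x y]; apply: window_close => //.
  exact/cont_slice1/cont_stek2.
move=> s hs; apply: window_close => //; first exact: cont_slice2.
by move=> t ht; apply: Hr; apply: le_trans kr.
Qed.

End Steklov.

(** * Weak partial derivatives and the Leibniz rule *)

Section WeakDerivatives.
Variable R : realType.
Implicit Types (F G f g w : R * R -> R) (b : bool) (a c x y k N M e : R).

Record C1fun f f1 f2 : Prop := {
  C1_cont : continuous f;
  C1_cont1 : continuous f1;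
  C1_cont2 : continuous f2;
  C1_der1 : forall x y, is_derive x 1 (fun s => f (s, y)) (f1 (x, y));
  C1_der2 : forall x y, is_derive y 1 (fun t => f (x, t)) (f2 (x, y)) }.

Record C1test (D : set (R * R)) f f1 f2 : Prop := {
  C1t_C1 :> C1fun f f1 f2;
  C1t_supp : supported_in D f }.

Lemma is_derive_e1 f x y l : is_derive x 1 (fun s => f (s, y)) l ->
  is_derive (x, y) (e1 R) f l.
Proof.
move=> [dv vl].
have E : (fun h : R => h^-1 *: (f (h *: e1 R + (x, y)) - f (x, y))) =
  (fun h : R => h^-1 *: (f (h *: 1 + x, y) - f (x, y))).
  apply/funext => h; congr (_ *: (f _ - _)).
  by rewrite /e1; congr pair => /=; rewrite ?scaler0 ?add0r.
split; first by rewrite /derivable E.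
by rewrite /derive E.
Qed.

Lemma is_derive_e2 f x y l : is_derive y 1 (fun t => f (x, t)) l ->
  is_derive (x, y) (e2 R) f l.
Proof.
move=> [dv vl].
have E : (fun h : R => h^-1 *: (f (h *: e2 R + (x, y)) - f (x, y))) =
  (fun h : R => h^-1 *: (f (x, h *: 1 + y) - f (x, y))).
  apply/funext => h; congr (_ *: (f _ - _)).
  by rewrite /e2; congr pair => /=; rewrite ?scaler0 ?add0r.
split; first by rewrite /derivable E.
by rewrite /derive E.
Qed.

Lemma C1_D1 f f1 f2 : C1fun f f1 f2 -> 'D_(e1 R) f = f1.
Proof.
by move=> C; apply/funext => -[x y]; have [_ <-] := is_derive_e1 (C1_der1 C x y).
Qed.

Lemma C1_D2 f f1 f2 : C1fun f f1 f2 -> 'D_(e2 R) f = f2.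
Proof.
by move=> C; apply/funext => -[x y]; have [_ <-] := is_derive_e2 (C1_der2 C x y).
Qed.

Lemma C1test_test2 D f f1 f2 : C1test D f f1 f2 -> test2 D f.
Proof.
move=> [C S]; split => //.
- move=> [x y]; split; first by have [] := is_derive_e1 (C1_der1 C x y).
  by have [] := is_derive_e2 (C1_der2 C x y).
- by rewrite (C1_D1 C); exact: C1_cont1 C.
- by rewrite (C1_D2 C); exact: C1_cont2 C.
Qed.

Lemma C1M f f1 f2 g g1 g2 : C1fun f f1 f2 -> C1fun g g1 g2 ->
  C1fun (fun z => f z * g z) (fun z => f1 z * g z + f z * g1 z)
    (fun z => f2 z * g z + f z * g2 z).
Proof.
move=> [cf cf1 cf2 df1 df2] [cg cg1 cg2 dg1 dg2]; split.
- exact: cont_mul.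
- by apply: cont_add; apply: cont_mul.
- by apply: cont_add; apply: cont_mul.
- by move=> x y; exact: (der1_mul (df1 x y) (dg1 x y)).
- by move=> x y; exact: (der1_mul (df2 x y) (dg2 x y)).
Qed.

Lemma supported_sub D f g : supported_in D f -> (forall z, g z != 0 -> f z != 0) ->
  supported_in D g.
Proof.
move=> [cK KD] gf.
have S : closure [set z | g z != 0] `<=` closure [set z | f z != 0].
  by apply: closure_subset => z /=; exact: gf.
split; last exact: subset_trans KD.
by apply: subclosed_compact S => //; exact: closed_closure.
Qed.

Lemma C1testM D f f1 f2 g g1 g2 : C1test D f f1 f2 -> C1fun g g1 g2 ->
  C1test D (fun z => f z * g z) (fun z => f1 z * g z + f z * g1 z)
    (fun z => f2 z * g z + f z * g2 z).
Proof.
move=> [C S] C'; split; first exact: C1M.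
by apply: supported_sub S _ => z; rewrite mulf_eq0 negb_or => /andP[].
Qed.

Lemma compact_box (K : set (R * R)) : compact K ->
  exists2 N, 0 < N & forall z, K z -> `|z.1| < N /\ `|z.2| < N.
Proof.
move=> /compact_bounded[M [_ HM]]; exists (`|M| + 2); first by rewrite ltr_wpDl.
move=> z Kz; have H := HM (`|M| + 1) _ z Kz.
have {}H : `|z| <= `|M| + 1 by apply: H; rewrite ltr_pwDr// ler_norm.
move: H; rewrite prod_normE ge_max => /andP[? ?]; split; lra.
Qed.

Lemma off_support f x y : ~ closure [set z | f z != 0] (x, y) ->
  (\forall s \near x, f (s, y) = 0) /\ (\forall t \near y, f (x, t) = 0).
Proof.
move=> nc; have : nbhs (x, y) (~` closure [set z | f z != 0]).
  by apply: open_nbhs_nbhs; split => //; exact/closed_openC/closed_closure.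
have out z : ~ closure [set z | f z != 0] z -> f z = 0.
  by move=> nz; apply/eqP; apply: contraT => h; case: nz; exact: subset_closure.
case=> -[A B] /= [A0 B0] AB; split.
  by apply: filterS A0 => s As; apply/out/(AB (s, y)); split => //; exact: nbhs_singleton.
by apply: filterS B0 => t Bt; apply/out/(AB (x, t)); split => //; exact: nbhs_singleton.
Qed.

(** Off the closed support [f] vanishes locally, so that its derivative is 0. *)
Lemma derive_outside f (f' : R * R -> R) :
  (forall x y, is_derive x 1 (fun s => f (s, y)) (f' (x, y))) ->
  forall z, f' z != 0 -> closure [set z | f z != 0] z.
Proof.
move=> df [x y]; apply: contra_neqP => /off_support[H _].
have [_ <-] := df x y; have [_ ->] // : is_derive x 1 (fun s => f (s, y)) 0.
by apply: (der1_near (F := fun=> 0)) => //; apply: filterS H => s ->.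
Qed.

Lemma derive_outside2 f (f' : R * R -> R) :
  (forall x y, is_derive y 1 (fun t => f (x, t)) (f' (x, y))) ->
  forall z, f' z != 0 -> closure [set z | f z != 0] z.
Proof.
move=> df [x y]; apply: contra_neqP => /off_support[_ H].
have [_ <-] := df x y; have [_ ->] // : is_derive y 1 (fun t => f (x, t)) 0.
by apply: (der1_near (F := fun=> 0)) => //; apply: filterS H => s ->.
Qed.

(** The direction of a partial derivative is a boolean so that both Leibniz
    rules are proved at once. *)
Definition sel (b : bool) f1 f2 := if b then f1 else f2.

Lemma C1test_outside D f f1 f2 b z : C1test D f f1 f2 -> sel b f1 f2 z != 0 ->
  closure [set z | f z != 0] z.
Proof.
move=> [[_ _ _ d1 d2] _]; case: b => /=.
- exact: (derive_outside d1).
- exact: (derive_outside2 d2).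
Qed.

Lemma C1test_boxed D f f1 f2 : C1test D f f1 f2 ->
  exists2 N, 0 <= N & boxed N f /\ forall b, boxed N (sel b f1 f2).
Proof.
move=> T; have [_ [cK _]] := T; have [N N0 HN] := compact_box cK.
exists N; first exact: ltW.
split => [z fz|b z fz]; apply: HN; first exact: subset_closure.
exact: (C1test_outside T fz).
Qed.

(** The derivatives vanish on [K] because, in the Leibniz rule, the cut-off is
    differentiated on the support of the test function. *)
Definition has_cutoffs (D : set (R * R)) := forall K, compact K -> K `<=` D ->
  exists f f1 f2, C1test D f f1 f2 /\
    forall z, K z -> [/\ f z = 1, f1 z = 0 & f2 z = 0].

(** Integrability is asked against test functions only: this is the form of
    local integrability that survives multiplication by continuous functions. *)
Record weak_partial (D : set (R * R)) (b : bool) w w' : Prop := {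
  wp_cont : continuous w;
  wp_int : forall f f1 f2, C1test D f f1 f2 ->
    (@mu2 R).-integrable setT (EFin \o (fun z => w' z * f z));
  wp_eq : forall f f1 f2, C1test D f f1 f2 ->
    plane (fun z => w z * sel b f1 f2 z) = - plane (fun z => w' z * f z) }.

Lemma integrable_bounded_mul F G M : (@mu2 R).-integrable setT (EFin \o F) ->
  continuous G -> (forall z, `|G z| <= M) ->
  (@mu2 R).-integrable setT (EFin \o (fun z => F z * G z)).
Proof.
move=> iF cG bG; apply: (integrableMl measurableT iF (cont_measurable cG)).
by exists M; split; [rewrite num_real|move=> x Mx z _; apply: le_trans (bG _) (ltW Mx)].
Qed.

Lemma plane_close F G H M e : (@mu2 R).-integrable setT (EFin \o F) ->
  continuous G -> continuous H -> (forall z, `|G z| <= M) -> 0 <= e ->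
  (forall z, `|H z - G z| <= e) ->
  `|plane (fun z => F z * H z) - plane (fun z => F z * G z)| <=
    e * plane (fun z => `|F z|).
Proof.
move=> iF cG cH bG e0 HG.
have bH z : `|H z| <= M + e.
  have := ler_normD (H z - G z) (G z); rewrite subrK.
  have := bG z; have := HG z; lra.
have iFH := integrable_bounded_mul iF cH bH.
have iFG := integrable_bounded_mul iF cG bG.
rewrite /plane -RintegralB//.
have iD : (@mu2 R).-integrable setT (EFin \o (fun z => F z * H z - F z * G z)).
  have := integrableB measurableT iFH iFG.
  by apply: eq_integrable => // z _ /=.
apply: (le_trans (le_normr_Rintegral measurableT iD)).
have iFn : (@mu2 R).-integrable setT (EFin \o (fun z => `|F z|)) by exact: integrable_norm.
rewrite -RintegralZl//; apply: le_Rintegral => //.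
- exact: integrable_norm.
- exact: (integrableZl measurableT e iFn).
- by move=> z _; rewrite -mulrBr normrM mulrC ler_wpM2r.
Qed.

Lemma stek_C1 k F : continuous F ->
  C1fun (stek k F) (quot1 k (stek2 k F)) (stek1 k (quot2 k F)).
Proof.
move=> cF; split.
- exact/cont_stek1/cont_stek2.
- exact/cont_quot1/cont_stek2.
- exact/cont_stek1/cont_quot2.
- by move=> x y; exact: stek_derive1.
- by move=> x y; exact: stek_derive2.
Qed.

Lemma stek_adjoint N b k F G : 0 <= N -> continuous F -> continuous G ->
  boxed N F -> boxed N G ->
  plane (fun z => G z * sel b (quot1 k (stek2 k F)) (stek1 k (quot2 k F)) z) =
  - plane (fun z => sel b (quot1 (- k) (stek2 (- k) G)) (stek1 (- k) (quot2 (- k) G)) z * F z).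
Proof.
by move=> *; case: b => /=; [exact: (@stek_adjoint1 _ N)|exact: (@stek_adjoint2 _ N)].
Qed.

Lemma selM b f f1 f2 g g1 g2 z :
  sel b (fun z => f1 z * g z + f z * g1 z) (fun z => f2 z * g z + f z * g2 z) z =
  sel b f1 f2 z * g z + f z * sel b g1 g2 z.
Proof. by case: b. Qed.

Lemma sel_cont b f f1 f2 : C1fun f f1 f2 -> continuous (sel b f1 f2).
Proof. by case=> ? ? ? ? ?; case: b. Qed.

Let lin1 (x1 x2 x3 x4 y1 y2 : R) :
  y1 = - y2 -> x1 + y1 = - x4 -> x3 + y2 = - x2 -> x1 + x2 + x3 + x4 = 0.
Proof. by lra. Qed.

Let lin2 (a1 a2 a3 a4 b1 b2 b3 b4 c1 c2 c3 c4 e : R) :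
  b1 + b2 + b3 + b4 = 0 ->
  `|b1 - a1| <= e * c1 -> `|b2 - a2| <= e * c2 ->
  `|b3 - a3| <= e * c3 -> `|b4 - a4| <= e * c4 ->
  `|a1 + a2 + a3 + a4| <= e * (c1 + c2 + c3 + c4).
Proof.
rewrite !mulrDr !ler_norml.
by move=> H /andP[? ?] /andP[? ?] /andP[? ?] /andP[? ?]; apply/andP; split; lra.
Qed.

Let lin3 (x y z : R) : x + y + 0 + z = 0 -> x = - (y + z).
Proof. by lra. Qed.

(** Neither factor is smooth enough to enter a test function for the other, so
    averages do. Let [p] be the test function, [g] a cut-off equal to 1 on its
    support, [W = w1 * g] and [V = w2 * p]. Test [w2] against [p] times the
    average of [W] of width [k], and [w1] against [g] times the average of [V] of
    width [- k]. The two terms in which an average is differentiated cancel by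
    [stek_adjoint]; in the others the averages converge uniformly to [W] and
    [V] as [k] tends to 0. *)
Theorem weak_Leibniz D b w1 w1' w2 w2' : has_cutoffs D ->
  weak_partial D b w1 w1' -> weak_partial D b w2 w2' ->
  weak_partial D b (fun z => w1 z * w2 z) (fun z => w1' z * w2 z + w1 z * w2' z).
Proof.
move=> cut wp1 wp2; have [cw1 iw1 ew1] := wp1; have [cw2 iw2 ew2] := wp2.
have INT f f1 f2 : C1test D f f1 f2 ->
   (@mu2 R).-integrable setT (EFin \o (fun z => w1' z * f z * w2 z)) /\
   (@mu2 R).-integrable setT (EFin \o (fun z => w2' z * f z * w1 z)).
  move=> T; have [N N0 [bf _]] := C1test_boxed T.
  have [g [g1 [g2 [T' gK]]]] := cut _ (T.(C1t_supp).1) (T.(C1t_supp).2).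
  have [N' N'0 [bg _]] := C1test_boxed T'.
  have cg := C1_cont T'.
  have gf z : f z * g z = f z.
    case: (eqVneq (f z) 0) => [->|fz]; first by rewrite mul0r.
    by have [|-> _ _] := gK z; [exact: subset_closure|rewrite mulr1].
  have red u v : continuous v -> (@mu2 R).-integrable setT (EFin \o (fun z => u z * f z)) ->
      (@mu2 R).-integrable setT (EFin \o (fun z => u z * f z * v z)).
    move=> cv iu.
    have [M _ HM] := @boxed_bounded _ N' (fun z => g z * v z) (cont_mul cg cv) (@boxedM _ N' g v bg).
    have := integrable_bounded_mul iu (cont_mul cg cv) HM.
    by apply: eq_integrable => // z _ /=; rewrite -[in RHS]gf; congr EFin; ring.
  by split; apply: red => //; [exact: iw1 T|exact: iw2 T].
have EXP f z : (w1' z * w2 z + w1 z * w2' z) * f z =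
    w1' z * f z * w2 z + w2' z * f z * w1 z by ring.
split.
- exact: cont_mul.
- move=> f f1 f2 T; have [i1 i2] := INT _ _ _ T.
  have := integrableD measurableT i1 i2.
  by apply: eq_integrable => // z _; rewrite /= EXP.
move=> p p1 p2 T.
have [g [g1 [g2 [T' gK]]]] := cut _ (T.(C1t_supp).1) (T.(C1t_supp).2).
have [N1 N10 [bp bpb]] := C1test_boxed T.
have [N2 N20 [bg bgb]] := C1test_boxed T'.
pose N := Num.max N1 N2.
have N1N : N1 <= N by rewrite le_max lexx.
have N2N : N2 <= N by rewrite le_max lexx orbT.
have N0 : 0 <= N by exact: le_trans N1N.
have {}bp := boxed_le N1N bp; have {}bpb b := boxed_le N1N (bpb b).
have {}bg := boxed_le N2N bg; have {}bgb b := boxed_le N2N (bgb b).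
have cp := C1_cont T; have cg := C1_cont T'.
have cpb := @sel_cont b _ _ _ T; have cgb := @sel_cont b _ _ _ T'.
pose W z := w1 z * g z; pose V z := w2 z * p z.
have cW : continuous W by exact: cont_mul.
have cV : continuous V by exact: cont_mul.
have bW : boxed N W by exact: boxedMr.
have bV : boxed N V by exact: boxedMr.
have [MW MW0 HMW] := boxed_bounded cW bW.
have [MV MV0 HMV] := boxed_bounded cV bV.
pose r1 z := w2 z * sel b p1 p2 z.
pose r2 z := w1' z * g z.
pose r3 z := w1 z * sel b g1 g2 z.
pose r4 z := w2' z * p z.
have cr1 : continuous r1 by exact: cont_mul.
have cr3 : continuous r3 by exact: cont_mul.
have br1 : boxed N r1 by exact: boxedMr.
have br3 : boxed N r3 by exact: boxedMr.
have i1 : (@mu2 R).-integrable setT (EFin \o r1) by exact: (boxed_integrable cr1 br1).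
have i2 : (@mu2 R).-integrable setT (EFin \o r2) by exact: iw1 T'.
have i3 : (@mu2 R).-integrable setT (EFin \o r3) by exact: (boxed_integrable cr3 br3).
have i4 : (@mu2 R).-integrable setT (EFin \o r4) by exact: iw2 T.
pose E H G := plane (fun z => r1 z * H z) + plane (fun z => r2 z * G z) +
  plane (fun z => r3 z * G z) + plane (fun z => r4 z * H z).
(* for the Steklov averages the identity holds exactly *)
have Ek k : k != 0 -> E (stek k W) (stek (- k) V) = 0.
  move=> k0; have CW := stek_C1 k cW; have CV := stek_C1 (- k) cV.
  have := ew2 _ _ _ (C1testM T CW); have := ew1 _ _ _ (C1testM T' CV).
  have := @stek_adjoint N b k W V N0 cW cV bW bV.
  have cWb := @sel_cont b _ _ _ CW; have cVb := @sel_cont b _ _ _ CV.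
  move: cWb cVb; set Wb := sel b _ _; set Vb := sel b _ _ => cWb cVb A1 A2 A3.
  have cSW := C1_cont CW; have cSV := C1_cont CV.
  have B1 : plane (fun z => r1 z * stek k W z) + plane (fun z => V z * Wb z) =
     - plane (fun z => r4 z * stek k W z).
    rewrite -(@planeD _ N _ _ (cont_mul cr1 cSW) (cont_mul cV cWb)
      (@boxedM _ N r1 _ br1) (@boxedM _ N V _ bV)).
    move: A3; rewrite /r4.
    have -> : (fun z => w2' z * (p z * stek k W z)) = (fun z => w2' z * p z * stek k W z).
      by apply/funext => z; ring.
    move=> <-; congr plane; apply/funext => z.
    by rewrite selM -/Wb /r1 /V; ring.
  have B2 : plane (fun z => r3 z * stek (- k) V z) + plane (fun z => Vb z * W z) =
     - plane (fun z => r2 z * stek (- k) V z).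
    rewrite -(@planeD _ N _ _ (cont_mul cr3 cSV) (cont_mul cVb cW)
      (@boxedM _ N r3 _ br3) (@boxedMr _ N W _ bW)).
    move: A2; rewrite /r2.
    have -> : (fun z => w1' z * (g z * stek (- k) V z)) = (fun z => w1' z * g z * stek (- k) V z).
      by apply/funext => z; ring.
    move=> <-; congr plane; apply/funext => z.
    by rewrite selM -/Vb /r3 /W; ring.
  exact: lin1 A1 B1 B2.
have E0 : E W V = 0.
  pose C := plane (fun z => `|r1 z|) + plane (fun z => `|r2 z|) +
    plane (fun z => `|r3 z|) + plane (fun z => `|r4 z|).
  have nn F : 0 <= plane (fun z => `|F z|) by exact: Rintegral_ge0.
  have C0 : 0 <= C by rewrite !addr_ge0.
  have key e : 0 < e -> `|E W V| <= e * C.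
    move=> e0.
    have [s1 s10 Hs1] := stek_close cW bW e0; have [s2 s20 Hs2] := stek_close cV bV e0.
    pose k := Num.min s1 s2.
    have k0 : 0 < k by rewrite lt_min s10.
    have ks1 : `|k| <= s1 by rewrite gtr0_norm// ge_min lexx.
    have ks2 : `|- k| <= s2 by rewrite normrN gtr0_norm// ge_min lexx orbT.
    have kn0 : k != 0 by rewrite gt_eqF.
    have nkn0 : - k != 0 by rewrite oppr_eq0.
    have cSW := C1_cont (stek_C1 k cW); have cSV := C1_cont (stek_C1 (- k) cV).
    have e0' := ltW e0.
    rewrite /E /C; exact: (lin2 (Ek k kn0)
      (plane_close i1 cW cSW HMW e0' (Hs1 k kn0 ks1))
      (plane_close i2 cV cSV HMV e0' (Hs2 _ nkn0 ks2))
      (plane_close i3 cV cSV HMV e0' (Hs2 _ nkn0 ks2))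
      (plane_close i4 cW cSW HMW e0' (Hs1 k kn0 ks1))).
  apply/eqP; rewrite -normr_le0; apply/ler_addgt0Pl => e e0; rewrite addr0.
  have := key (e / (C + 1)) _.
  rewrite divr_gt0 ?ltr_wpDl// => /(_ isT) /le_trans; apply.
  by rewrite mulrAC ler_pdivrMr ?ltr_wpDl// ler_pM2l//; lra.
have G1 z : p z != 0 -> g z = 1 /\ sel b g1 g2 z = 0.
  move=> pz; have [|-> h1 h2] := gK z; first exact: subset_closure.
  by split => //; case: (b).
have G2 z : sel b p1 p2 z != 0 -> g z = 1.
  by move=> pz; have [|-> h1 h2] := gK z; first exact: (C1test_outside T pz).
have [j1 j2] := INT _ _ _ T.
have Z1 : plane (fun z => r1 z * W z) = plane (fun z => w1 z * w2 z * sel b p1 p2 z).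
  congr plane; apply/funext => z; rewrite /r1 /W.
  case: (eqVneq (sel b p1 p2 z) 0) => [->|/G2 ->]; ring.
have Z2 : plane (fun z => r2 z * V z) = plane (fun z => w1' z * p z * w2 z).
  congr plane; apply/funext => z; rewrite /r2 /V.
  case: (eqVneq (p z) 0) => [->|/G1[-> _]]; ring.
have Z3 : plane (fun z => r3 z * V z) = 0.
  have -> : (fun z => r3 z * V z) = (fun=> 0).
    apply/funext => z; rewrite /r3 /V.
    case: (eqVneq (p z) 0) => [->|/G1[_ ->]]; ring.
  by rewrite /plane /Rintegral integral0.
have Z4 : plane (fun z => r4 z * W z) = plane (fun z => w2' z * p z * w1 z).
  congr plane; apply/funext => z; rewrite /r4 /W.
  case: (eqVneq (p z) 0) => [->|/G1[-> _]]; ring.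
have -> : plane (fun z => (w1' z * w2 z + w1 z * w2' z) * p z) =
   plane (fun z => w1' z * p z * w2 z) + plane (fun z => w2' z * p z * w1 z).
  rewrite /plane -RintegralD//; congr Rintegral; apply/funext => z; exact: EXP.
move: E0; rewrite /E Z1 Z2 Z3 Z4; exact: lin3.
Qed.

Lemma weak_partialD D b w1 w1' w2 w2' :
  weak_partial D b w1 w1' -> weak_partial D b w2 w2' ->
  weak_partial D b (fun z => w1 z + w2 z) (fun z => w1' z + w2' z).
Proof.
move=> [c1 i1 e1] [c2 i2 e2]; split; first exact: cont_add.
- move=> f f1 f2 T; have := integrableD measurableT (i1 _ _ _ T) (i2 _ _ _ T).
  by apply: eq_integrable => // z _ /=; rewrite mulrDl.
- move=> f f1 f2 T.
  have -> : (fun z => (w1' z + w2' z) * f z) = (fun z => w1' z * f z + w2' z * f z).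
    by apply/funext => z; rewrite mulrDl.
  have -> : (fun z => (w1 z + w2 z) * sel b f1 f2 z) =
     (fun z => w1 z * sel b f1 f2 z + w2 z * sel b f1 f2 z).
    by apply/funext => z; rewrite mulrDl.
  have [N N0 [bf bfb]] := C1test_boxed T.
  have cfb := @sel_cont b _ _ _ T.
  rewrite (@planeD _ N); [|exact: cont_mul|exact: cont_mul|exact: boxedMr|exact: boxedMr].
  rewrite (e1 _ _ _ T) (e2 _ _ _ T) -opprD; congr (- _).
  by rewrite /plane -RintegralD//; [exact: i1 T|exact: i2 T].
Qed.

Lemma plane_partial0 D b f f1 f2 : C1test D f f1 f2 -> plane (sel b f1 f2) = 0.
Proof.
move=> T; have [N N0 [bf bfb]] := C1test_boxed T.
have cfb := @sel_cont b _ _ _ T; have [[cf c1 c2 d1 d2] _] := T.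
have [NN NN'] : `|N| >= N /\ `|- N| >= N by rewrite normrN ler_norm.
have z1 y (q : R) : `|q| >= N -> f (q, y) = 0.
  by move=> h; apply/eqP; apply: contraT => /bf[/=]; rewrite ltNge h.
have z2 x (q : R) : `|q| >= N -> f (x, q) = 0.
  by move=> h; apply/eqP; apply: contraT => /bf[_ /=]; rewrite ltNge h.
rewrite /plane (@plane_fubini _ N)//; case: b cfb bfb => /= cfb bfb.
- rewrite (@oint_swap _ f1)//.
  have -> : (fun t => oint (- N) N (fun x => f1 (x, t))) = (fun=> 0).
    apply/funext => t; rewrite (@oint_FTC2 _ _ _ (fun s => f (s, t))).
    + by rewrite !z1// subrr.
    + exact: cont_slice1.
    + by move=> s; exact: d1.
  by rewrite oint_cst mul0r.
- have -> : (fun x => oint (- N) N (fun t => f2 (x, t))) = (fun=> 0).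
    apply/funext => x; rewrite (@oint_FTC2 _ _ _ (fun s => f (x, s))).
    + by rewrite !z2// subrr.
    + exact: cont_slice2.
    + by move=> s; exact: d2.
  by rewrite oint_cst mul0r.
Qed.

Lemma C1_weak_partial D b g g1 g2 : C1fun g g1 g2 -> weak_partial D b g (sel b g1 g2).
Proof.
move=> C; have cg := C1_cont C; have cgb := @sel_cont b _ _ _ C; split => //.
- move=> f f1 f2 T; have [N N0 [bf bfb]] := C1test_boxed T.
  apply: (@boxed_integrable _ N); last exact: boxedMr.
  by apply: cont_mul => //; exact: C1_cont T.
- move=> f f1 f2 T; have [N N0 [bf bfb]] := C1test_boxed T.
  have := plane_partial0 b (C1testM T C).
  have -> : sel b (fun z => f1 z * g z + f z * g1 z) (fun z => f2 z * g z + f z * g2 z) =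
    (fun z => g z * sel b f1 f2 z + sel b g1 g2 z * f z).
    by apply/funext => z; rewrite selM; ring.
  have cf := C1_cont T; have cfb := @sel_cont b _ _ _ T.
  rewrite (@planeD _ N); [lra|exact: cont_mul|exact: cont_mul|exact: boxedMr|exact: boxedMr].
Qed.

End WeakDerivatives.

(** * Smooth steps and primitives in the weak sense *)

Section Step.
Variable R : realType.
Implicit Types (f g h : R -> R) (a b c x y k e t : R).

(** A parabolic arch over [1, 2]; normalized and integrated, it gives the step
    function from which all the cut-offs are made. *)
Definition hat t : R := Num.max 0 ((t - 1) * (2 - t)).
Definition hat_mass : R := oint 1 2 hat.
Definition step' t : R := hat t / hat_mass.
Definition step t : R := oint 1 t step'.

Lemma cont_max0 f : continuous f -> continuous (fun t => Num.max 0 (f t)).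
Proof.
move=> cf t.
by apply: (@continuous_max _ _ (fun=> 0) f); [exact: cst_continuous|exact: cf].
Qed.

Lemma cont_hat : continuous hat.
Proof.
apply: cont_max0; apply: cont_mul; apply: cont_sub; try exact: cont_cst; exact: cont_id.
Qed.

Lemma hat_ge0 t : 0 <= hat t. Proof. by rewrite le_max lexx. Qed.

Lemma hat_eq0 t : ~~ (1 < t < 2) -> hat t = 0.
Proof.
move=> nt; apply/max_idPl; move: nt; rewrite negb_and -!leNgt => /orP[?|?]; nra.
Qed.

Lemma hat_mass_gt0 : 0 < hat_mass.
Proof.
apply: (@oint_gt0 _ 1 2 hat (3/2)); [lra|exact: cont_hat|by move=> *; exact: hat_ge0|lra|].
by rewrite /hat lt_max; apply/orP; right; nra.
Qed.

Lemma cont_step' : continuous step'.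
Proof. by apply: cont_mul; [exact: cont_hat|exact: cont_cst]. Qed.

Lemma step'_ge0 t : 0 <= step' t.
Proof. by rewrite divr_ge0 ?hat_ge0 ?ltW ?hat_mass_gt0. Qed.

Lemma step'_eq0 t : ~~ (1 < t < 2) -> step' t = 0.
Proof. by move=> h; rewrite /step' hat_eq0// mul0r. Qed.

Lemma is_derive_step t : is_derive t 1 step (step' t).
Proof. by apply: is_derive_oint; exact: cont_step'. Qed.

Lemma cont_step : continuous step.
Proof. exact: (@is_derive_continuous _ step step' is_derive_step). Qed.

Lemma step_eq0 t : t <= 1 -> step t = 0.
Proof.
move=> t1; apply: oint_eq0; first exact: cont_step'.
move=> x; rewrite (min_r t1) (max_l t1) => /andP[_ x1].
by apply: step'_eq0; rewrite negb_and -!leNgt x1.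
Qed.

Lemma step_eq1 t : 2 <= t -> step t = 1.
Proof.
move=> t2; rewrite /step (oint_chasles 2) (@oint_eq0 _ 2 t); [|exact: cont_step'|].
  rewrite addr0 /step' (_ : (fun t => _) = (fun t => hat_mass^-1 * hat t)).
    rewrite ointZ; last exact: cont_hat.
    by rewrite mulVf// gt_eqF// hat_mass_gt0.
  by apply/funext => s; rewrite mulrC.
move=> x; rewrite (min_l t2) (max_r t2) => /andP[x2 _].
by apply: step'_eq0; rewrite negb_and -!leNgt x2 orbT.
Qed.

Lemma step_ge0 t : 0 <= step t.
Proof.
case: (leP t 1) => [/step_eq0 ->//|t1]; apply: oint_ge0; first exact: ltW.
  exact: cont_step'.
by move=> *; exact: step'_ge0.
Qed.

Lemma step_le1 t : step t <= 1.
Proof.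
case: (leP 2 t) => [/step_eq1 ->//|t2]; rewrite -(step_eq1 (lexx 2)) -subr_ge0.
have -> : step 2 - step t = oint t 2 step'.
  by rewrite /step (oint_chasles t 1 2); ring.
apply: oint_ge0; [exact: ltW|exact: cont_step'|by move=> *; exact: step'_ge0].
Qed.

Lemma weighted_mean a b h (w : R -> R) k e : a <= b -> continuous h -> continuous w ->
  (forall y, a <= y <= b -> 0 <= w y) -> oint a b w = 1 ->
  (forall y, a <= y <= b -> w y != 0 -> `|h y - k| <= e) ->
  `|oint a b (fun y => h y * w y) - k| <= e.
Proof.
move=> ab ch cw w0 w1 hk.
have chw : continuous (fun y => h y * w y) by exact: cont_mul.
have ckw q : continuous (fun y => q * w y) by apply: cont_mul => //; exact: cont_cst.
have E q : oint a b (fun y => q * w y) = q by rewrite ointZ// w1 mulr1.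
have H y : a <= y <= b -> `|h y * w y - k * w y| <= e * w y.
  move=> yab; rewrite -mulrBl normrM (ger0_norm (w0 _ yab)).
  case: (eqVneq (w y) 0) => [->|wy]; first by rewrite !mulr0.
  by rewrite ler_wpM2r ?w0// hk.
have E1 : oint a b (fun y => h y * w y) - k = oint a b (fun y => h y * w y - k * w y).
  by rewrite ointB// E.
have cd : continuous (fun y => h y * w y - k * w y) by exact: cont_sub.
rewrite E1 ler_norml -[X in - X <= _](E e) -[X in _ && (_ <= X)](E e) -ointN//.
apply/andP; split; apply: le_oint => //.
- by apply: cont_opp.
- by move=> y /H; rewrite ler_norml => /andP[].
- by move=> y /H; rewrite ler_norml => /andP[].
Qed.

Lemma cont_affine a b : continuous (fun y : R => a * y + b).
Proof.
apply: cont_add; last exact: cont_cst.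
by apply: cont_mul; [exact: cont_cst|exact: cont_id].
Qed.

Lemma is_derive_affine a b y : is_derive y 1 (fun y : R => a * y + b) a.
Proof.
apply: (der1_eq (a := (0 * y + a * 1) + 0)); last by ring.
exact: (der1_add (der1_mul (der1_cst y a) (der1_id y)) (der1_cst y b)).
Qed.

Lemma step_affine_derive a b y :
  is_derive y 1 (fun y => step (a * y + b)) (step' (a * y + b) * a).
Proof. exact: (der1_comp (is_derive_step _) (is_derive_affine a b y)). Qed.

Lemma cont_step'_affine a b : continuous (fun y => step' (a * y + b) * a).
Proof.
apply: cont_mul; last exact: cont_cst.
by apply: cont_comp; [exact: cont_step'|exact: cont_affine].
Qed.

Lemma oint_step_up a b c t : 0 < t -> a <= c + t -> c + 2 * t <= b ->
  oint a b (fun y => step' (t^-1 * y + - c / t) * t^-1) = 1.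
Proof.
move=> t0 ac cb; rewrite (@oint_FTC2 _ _ _ (fun y => step (t^-1 * y + - c / t))).
- have tn : t != 0 by rewrite gt_eqF.
  have -> : t^-1 * b + - c / t = (b - c) / t by field.
  have -> : t^-1 * a + - c / t = (a - c) / t by field.
  rewrite step_eq1 ?step_eq0 ?subr0//; first by rewrite ler_pdivrMr// mul1r; lra.
  by rewrite ler_pdivlMr//; lra.
- exact: cont_step'_affine.
- by move=> y; exact: step_affine_derive.
Qed.

Lemma oint_step_down a b c t : 0 < t -> c - t <= b -> a <= c - 2 * t ->
  oint a b (fun y => step' (- t^-1 * y + c / t) * t^-1) = 1.
Proof.
move=> t0 ac cb; rewrite (@oint_FTC2 _ _ _ (fun y => - step (- t^-1 * y + c / t))).
- have tn : t != 0 by rewrite gt_eqF.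
  have -> : - t^-1 * b + c / t = (c - b) / t by field.
  have -> : - t^-1 * a + c / t = (c - a) / t by field.
  rewrite (step_eq1 (t := (c - a) / t)) ?step_eq0 ?oppr0 ?sub0r ?opprK//.
    by rewrite ler_pdivrMr// mul1r; lra.
  by rewrite ler_pdivlMr//; lra.
- have := @cont_opp _ _ _ (@cont_step'_affine (- t^-1) (c / t)).
  by under eq_fun do rewrite mulrN opprK.
- move=> y; apply: (der1_eq (a := 0 - step' (- t^-1 * y + c / t) * (- t^-1))); last by ring.
  have := der1_sub (der1_cst y 0) (step_affine_derive (- t^-1) (c / t) y).
  by under eq_fun do rewrite sub0r.
Qed.

(** The test function rises from 0 to 1 just after [x1] and falls back to 0 just
    after [x2]; its slopes are unit masses [w1] and [- w2]. After integration by
    parts of the term in [L], the hypothesis says that [J] minus the primitive of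
    [L] has the same mean against [w1] and [w2]. *)
Lemma du_Bois_Reymond (J L : R -> R) a b : continuous J -> continuous L ->
  (forall p q f f', a < p -> q < b -> p <= q -> deriv_of f f' -> continuous f' ->
     (forall x, f x != 0 -> p < x < q) ->
     oint p q (fun x => f' x * J x + f x * L x) = 0) ->
  forall x1 x2, a < x1 -> x1 <= x2 -> x2 < b -> J x2 - J x1 = oint x1 x2 L.
Proof.
move=> cJ cL H x1 x2 ax1 x12 x2b.
pose K x := J x - oint x1 x L.
have cP : continuous (fun x => oint x1 x L).
  by apply: cont_sub; [exact: continuous_prim|exact: cont_cst].
have cK : continuous K by exact: cont_sub.
suff : K x1 = K x2 by rewrite /K oint_xx; lra.
apply/eqP; rewrite -subr_eq0 -normr_le0; apply/ler_addgt0Pl => e e0; rewrite addr0.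
have e2 : 0 < e / 2 by lra.
have nr x : exists2 s, 0 < s & forall y, `|y - x| < s -> `|K y - K x| <= e / 2.
  have /cvgrPdist_le/(_ _ e2)/nbhs_ballP[s /= s0 Hs] := cK x.
  by exists s => // y; rewrite distrC => /Hs /=; rewrite distrC.
have [s1 s10 Hs1] := nr x1; have [s2 s20 Hs2] := nr x2.
pose t := Num.min (Num.min s1 s2) (b - x2) / 4.
have m0 : 0 < Num.min (Num.min s1 s2) (b - x2) by rewrite !lt_min s10 s20 subr_gt0.
have m1 : Num.min (Num.min s1 s2) (b - x2) <= s1 by rewrite !ge_min lexx.
have m2 : Num.min (Num.min s1 s2) (b - x2) <= s2 by rewrite !ge_min lexx orbT.
have m3 : Num.min (Num.min s1 s2) (b - x2) <= b - x2 by rewrite !ge_min lexx orbT.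
have t0 : 0 < t by rewrite /t; lra.
have tn : t != 0 by rewrite gt_eqF.
have ts1 : 4 * t <= s1 by rewrite /t; lra.
have ts2 : 4 * t <= s2 by rewrite /t; lra.
have tb : x2 + 4 * t <= b by rewrite /t; lra.
clearbody t; clear m0 m1 m2 m3.
pose w1 y := step' (t^-1 * y + - x1 / t) * t^-1.
pose w2 y := step' (t^-1 * y + - x2 / t) * t^-1.
pose f y := step (t^-1 * y + - x1 / t) - step (t^-1 * y + - x2 / t).
pose p := x1; pose q := x2 + 3 * t.
have df : deriv_of f (fun y => w1 y - w2 y).
  by move=> y; exact: (der1_sub (step_affine_derive _ _ y) (step_affine_derive _ _ y)).
have cw1 : continuous w1 by exact: cont_step'_affine.
have cw2 : continuous w2 by exact: cont_step'_affine.
have cw : continuous (fun y => w1 y - w2 y) by exact: cont_sub.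
have arg c y : t^-1 * y + - c / t = (y - c) / t by field.
have sf x : f x != 0 -> p < x < q.
  rewrite /f !arg => fx; apply/andP; split; rewrite ltNge; apply: contra fx => h.
    have ? : (x - x1) / t <= 1 by rewrite ler_pdivrMr// mul1r; rewrite /p in h; lra.
    have ? : (x - x2) / t <= 1 by rewrite ler_pdivrMr// mul1r; rewrite /p in h; lra.
    by rewrite !step_eq0// subrr.
  have ? : 2 <= (x - x1) / t by rewrite ler_pdivlMr//; rewrite /q in h; lra.
  have ? : 2 <= (x - x2) / t by rewrite ler_pdivlMr//; rewrite /q in h; lra.
  by rewrite !step_eq1// subrr.
have pq : p <= q by rewrite /p /q; lra.
have := H p q f _ ax1 _ pq df cw sf.
have -> : q < b by rewrite /q; lra.
move=> /(_ isT) I0.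
have cf : continuous f := is_derive_continuous df.
have sp c y : step' (t^-1 * y + - c / t) * t^-1 != 0 -> c < y < c + 2 * t.
  rewrite arg mulf_eq0 negb_or => /andP[h _]; move: h; apply: contraNT => h.
  apply/eqP/step'_eq0; apply: contra h => /andP[].
  rewrite ltr_pdivlMr// ltr_pdivrMr// mul1r => ? ?; apply/andP; split; lra.
have parts : oint p q (fun x => f x * L x) = - oint p q (fun x => (w1 x - w2 x) * oint x1 x L).
  have dP : deriv_of (fun x => oint x1 x L) L by move=> x; exact: is_derive_oint.
  have fz r : ~~ (p < r < q) -> f r = 0.
    by move=> h; apply/eqP; move: h; apply: contraNT; exact: sf.
  rewrite (oint_parts p q cw cL df dP) (fz p) ?ltxx// (fz q) ?ltxx ?andbF//.
  by ring.
have E : oint p q (fun x => K x * w1 x) = oint p q (fun x => K x * w2 x).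
  have cKw1 : continuous (fun x => K x * w1 x) by exact: cont_mul.
  have cKw2 : continuous (fun x => K x * w2 x) by exact: cont_mul.
  apply/eqP; rewrite -subr_eq0 -ointB//.
  have -> : (fun x => K x * w1 x - K x * w2 x) =
    (fun x => (w1 x - w2 x) * J x - (w1 x - w2 x) * oint x1 x L).
    by apply/funext => x; rewrite /K; ring.
  have c1 : continuous (fun x => (w1 x - w2 x) * J x) by exact: cont_mul.
  have c2 : continuous (fun x => (w1 x - w2 x) * oint x1 x L) by exact: cont_mul.
  have c3 : continuous (fun x => f x * L x) by exact: cont_mul.
  by rewrite ointB// -parts -ointD// I0.
have w0 c y : 0 <= step' (t^-1 * y + - c / t) * t^-1.
  by rewrite mulr_ge0 ?step'_ge0// invr_ge0 ltW.
have B1 : `|oint p q (fun x => K x * w1 x) - K x1| <= e / 2.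
  apply: weighted_mean => //.
  - by move=> y _; exact: w0.
  - by apply: oint_step_up => //; rewrite /p /q; lra.
  - move=> y _ /sp /andP[h1 h2]; apply: Hs1; rewrite ltr_norml; apply/andP; split; lra.
have B2 : `|oint p q (fun x => K x * w2 x) - K x2| <= e / 2.
  apply: weighted_mean => //.
  - by move=> y _; exact: w0.
  - by apply: oint_step_up => //; rewrite /p /q; lra.
  - move=> y _ /sp /andP[h1 h2]; apply: Hs2; rewrite ltr_norml; apply/andP; split; lra.
rewrite E in B1; rewrite [leRHS]splitr.
apply: (le_trans (ler_distD (oint p q (fun x => K x * w2 x)) _ _)).
by apply: lerD B2; rewrite distrC.
Qed.

End Step.

(** * Cut-offs near the edges of a column *)

Section Column.
Variable R : realType.
Implicit Types (f g h : R -> R) (F G A C E m : R * R -> R) (x y k e t p q N M : R).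

Lemma small_eq0 (X K : R) : 0 <= K -> (forall e, 0 < e -> `|X| <= e * K) -> X = 0.
Proof.
move=> K0 H; apply/eqP; rewrite -normr_le0; apply/ler_addgt0Pl => e e0; rewrite addr0.
have := H (e / (K + 1)); rewrite divr_gt0 ?ltr_wpDl// => /(_ isT) /le_trans; apply.
by rewrite mulrAC ler_pdivrMr ?ltr_wpDl// ler_pM2l//; lra.
Qed.

Lemma closed_nonneg (T : topologicalType) (f : T -> R) : continuous f ->
  closed [set z | 0 <= f z].
Proof.
by move=> cf; apply: (@closed_comp _ _ f [set y | 0 <= y]) => [z _|]; [exact: cf|exact: closed_ge].
Qed.

Lemma bounded_rect F p q r s : continuous F -> exists2 M, 0 <= M &
  forall x y, p <= x <= q -> r <= y <= s -> `|F (x, y)| <= M.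
Proof.
move=> cF.
have K : compact (`[p, q]%classic `*` `[r, s]%classic : set (R * R)).
  by apply: compact_setX; exact: segment_compact.
have /compact_bounded[M [_ HM]] : compact (F @` (`[p, q]%classic `*` `[r, s]%classic)).
  by apply: continuous_compact => //; exact: continuous_subspaceT.
exists (`|M| + 1) => [|x y xp yr]; first by rewrite addr_ge0.
apply: HM; first by rewrite ltr_pwDr// ler_norm.
by exists (x, y) => //; split; rewrite /= in_itv.
Qed.

Lemma bounded_seg f p q : continuous f -> exists2 M, 0 <= M &
  forall x, p <= x <= q -> `|f x| <= M.
Proof.
move=> cf; have [|M M0 HM] := @bounded_rect (fun z => f z.1) p q 0 0.
  by apply: cont_comp => //; exact: cont_fst.
by exists M => // x xpq; apply: (HM x 0 xpq); rewrite lexx.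
Qed.

Lemma positive_on_compact (T : topologicalType) (K : set T) (f : T -> R) :
  compact K -> continuous f -> (forall z, K z -> 0 < f z) ->
  exists2 r : R, 0 < r & forall z, K z -> r <= f z.
Proof.
move=> cK cf f0.
have cfK : compact (f @` K) by apply: continuous_compact => //; exact: continuous_subspaceT.
have cl : closed (f @` K) by apply: compact_closed => //; exact: Rhausdorff.
have : nbhs (0 : R) (~` (f @` K)).
  apply: open_nbhs_nbhs; split; first exact: closed_openC.
  by move=> [z /f0 + E]; rewrite E ltxx.
move=> /nbhs_ballP[r /= r0 Hr]; exists r => // z Kz.
rewrite leNgt; apply/negP => fr; apply: (Hr (f z)); last by exists z.
by rewrite /ball/= sub0r normrN gtr0_norm ?f0.
Qed.

Lemma positive_on_seg f p q : continuous f -> (forall x, p <= x <= q -> 0 < f x) ->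
  exists2 r : R, 0 < r & forall x, p <= x <= q -> r <= f x.
Proof.
move=> cf f0.
have [|r r0 Hr] := @positive_on_compact R `[p, q]%classic f (@segment_compact _ _ _) cf.
  by move=> x /=; rewrite in_itv/=; exact: f0.
by exists r => // x xpq; apply: Hr; rewrite /= in_itv.
Qed.

(** [top_cut] vanishes where [y] is within [t] of the upper edge [zeta x] and is 1
    from a distance [2 * t] on; [bot_cut] does the same at the lower edge [- d].
    The arguments of [step] are kept as affine functions of [y], the form that
    [step_affine_derive] differentiates. *)
Definition top_cut t (zeta : R -> R) (z : R * R) := step (- t^-1 * z.2 + zeta z.1 / t).
Definition top_cut1 t (zeta zeta' : R -> R) (z : R * R) :=
  step' (- t^-1 * z.2 + zeta z.1 / t) * (zeta' z.1 / t).
Definition top_cut2 t (zeta : R -> R) (z : R * R) :=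
  step' (- t^-1 * z.2 + zeta z.1 / t) * (- t^-1).
Definition bot_cut t (d : R) (z : R * R) := step (t^-1 * z.2 + - - d / t).
Definition bot_cut2 t (d : R) (z : R * R) := step' (t^-1 * z.2 + - - d / t) * t^-1.

Lemma top_cut_C1 t zeta zeta' : deriv_of zeta zeta' -> continuous zeta' ->
  C1fun (top_cut t zeta) (top_cut1 t zeta zeta') (top_cut2 t zeta).
Proof.
move=> dz cz'; have cz := is_derive_continuous dz.
have ca : continuous (fun z : R * R => - t^-1 * z.2 + zeta z.1 / t).
  apply: cont_add; apply: cont_mul.
  - exact: cont_cst.
  - exact: cont_snd.
  - by apply: cont_comp => //; exact: cont_fst.
  - exact: cont_cst.
have cs : continuous (fun z : R * R => step' (- t^-1 * z.2 + zeta z.1 / t)).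
  by apply: cont_comp => //; exact: cont_step'.
split.
- by apply: cont_comp => //; exact: cont_step.
- apply: cont_mul => //; apply: cont_mul; last exact: cont_cst.
  by apply: cont_comp => //; exact: cont_fst.
- by apply: cont_mul => //; exact: cont_cst.
- move=> x y.
  apply: (@der1_comp _ (@step R) (fun s => - t^-1 * y + zeta s / t) x _ _ (is_derive_step _)).
  apply: (der1_eq (a := 0 + (zeta' x * t^-1 + zeta x * 0))); last by ring.
  exact: (der1_add (der1_cst x (- t^-1 * y)) (der1_mul (dz x) (der1_cst x t^-1))).
- by move=> x y; exact: (step_affine_derive (- t^-1) (zeta x / t) y).
Qed.

Lemma bot_cut_C1 t d : C1fun (bot_cut t d) (fun=> 0) (bot_cut2 t d).
Proof.
have ca : continuous (fun z : R * R => t^-1 * z.2 + - - d / t).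
  apply: cont_add; last exact: cont_cst.
  by apply: cont_mul; [exact: cont_cst|exact: cont_snd].
split.
- by apply: cont_comp => //; exact: cont_step.
- exact: cont_cst.
- apply: cont_mul; last exact: cont_cst.
  by apply: cont_comp => //; exact: cont_step'.
- by move=> x y; rewrite /bot_cut /=; exact: der1_cst.
- by move=> x y; exact: (step_affine_derive t^-1 (- - d / t) y).
Qed.

Lemma fst_C1 f f' : deriv_of f f' -> continuous f' ->
  C1fun (fun z => f z.1) (fun z => f' z.1) (fun=> 0).
Proof.
move=> df cf'; have cf := is_derive_continuous df; split.
- by apply: cont_comp => //; exact: cont_fst.
- by apply: cont_comp => //; exact: cont_fst.
- exact: cont_cst.
- by move=> x y; exact: df.
- by move=> x y /=; exact: der1_cst.
Qed.

Lemma top_arg t zeta y : t != 0 -> - t^-1 * y + zeta / t = (zeta - y) / t :> R.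
Proof. by move=> t0; field. Qed.

Lemma bot_arg t d y : t != 0 -> t^-1 * y + - - d / t = (y + d) / t :> R.
Proof. by move=> t0; field. Qed.

Lemma top_cut_eq0 t zeta z : 0 < t -> zeta z.1 - z.2 <= t ->
  top_cut t zeta z = 0 /\ step' (- t^-1 * z.2 + zeta z.1 / t) = 0.
Proof.
move=> t0 h; have tn : t != 0 by rewrite gt_eqF.
have a1 : (zeta z.1 - z.2) / t <= 1 by rewrite ler_pdivrMr// mul1r.
rewrite /top_cut top_arg//; split; first exact: step_eq0.
by apply: step'_eq0; rewrite negb_and -!leNgt a1.
Qed.

Lemma bot_cut_eq0 t d z : 0 < t -> z.2 + d <= t ->
  bot_cut t d z = 0 /\ step' (t^-1 * z.2 + - - d / t) = 0.
Proof.
move=> t0 h; have tn : t != 0 by rewrite gt_eqF.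
have a1 : (z.2 + d) / t <= 1 by rewrite ler_pdivrMr// mul1r.
rewrite /bot_cut bot_arg//; split; first exact: step_eq0.
by apply: step'_eq0; rewrite negb_and -!leNgt a1.
Qed.

Lemma top_cut_eq1 t zeta z : 0 < t -> 2 * t <= zeta z.1 - z.2 ->
  top_cut t zeta z = 1 /\ step' (- t^-1 * z.2 + zeta z.1 / t) = 0.
Proof.
move=> t0 h; have tn : t != 0 by rewrite gt_eqF.
have a1 : 2 <= (zeta z.1 - z.2) / t by rewrite ler_pdivlMr.
rewrite /top_cut top_arg//; split; first exact: step_eq1.
by apply: step'_eq0; rewrite negb_and -!leNgt a1 orbT.
Qed.

Lemma bot_cut_eq1 t d z : 0 < t -> 2 * t <= z.2 + d ->
  bot_cut t d z = 1 /\ step' (t^-1 * z.2 + - - d / t) = 0.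
Proof.
move=> t0 h; have tn : t != 0 by rewrite gt_eqF.
have a1 : 2 <= (z.2 + d) / t by rewrite ler_pdivlMr.
rewrite /bot_cut bot_arg//; split; first exact: step_eq1.
by apply: step'_eq0; rewrite negb_and -!leNgt a1 orbT.
Qed.

Definition core t (d : R) (zeta : R -> R) p q : set (R * R) :=
  [set z | [/\ p <= z.1 <= q, t <= zeta z.1 - z.2 & t <= z.2 + d]].

Lemma core_compact t d zeta p q : 0 < t -> continuous zeta -> compact (core t d zeta p q).
Proof.
move=> t0 cz; have [M M0 HM] := @bounded_seg zeta p q cz.
apply: (@subclosed_compact _ _ (`[p, q]%classic `*` `[- d, M]%classic)).
- have -> : core t d zeta p q = [set z | 0 <= z.1 - p] `&` [set z | 0 <= q - z.1] `&`
     [set z | 0 <= zeta z.1 - z.2 - t] `&` [set z | 0 <= z.2 + d - t].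
    apply/seteqP; split => z /=.
      by move=> [/andP[? ?] ? ?]; do !split; lra.
    by move=> [[[? ?] ?] ?]; split; [apply/andP; split; lra|lra|lra].
  have cc := @cont_cst R (R * R)%type.
  have c1 := @cont_fst R; have c2 := @cont_snd R.
  do !apply: closedI; apply: closed_nonneg.
  + by apply: cont_sub.
  + by apply: cont_sub.
  + by apply: cont_sub => //; apply: cont_sub => //; apply: cont_comp.
  + by apply: cont_sub => //; apply: cont_add.
- by apply: compact_setX; exact: segment_compact.
- move=> z [h1 h2 h3]; split => /=; rewrite in_itv//=.
  have := HM _ h1; rewrite ler_norml => /andP[_ ?]; apply/andP; split; lra.
Qed.

Lemma closure_core t d zeta p q F : 0 < t -> continuous zeta ->
  (forall z, F z != 0 -> core t d zeta p q z) ->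
  compact (closure [set z | F z != 0]) /\ closure [set z | F z != 0] `<=` core t d zeta p q.
Proof.
move=> t0 cz H; have cK := @core_compact t d zeta p q t0 cz.
have S : closure [set z | F z != 0] `<=` core t d zeta p q.
  have := closure_subset (H : [set z | F z != 0] `<=` _).
  by move=> /subset_trans; apply; have /closure_id <- := compact_closed (@norm_hausdorff _ _) cK.
split => //; apply: (subclosed_compact _ cK) => //; exact: closed_closure.
Qed.

End Column.

(* Unification must not unfold the integrals that define the step function. *)
Local Opaque step step'.

(** * Conservation laws integrated over columns *)

Section ColumnIdentity.
Variable R : realType.
Implicit Types (f g h zeta eta : R -> R) (F G A C E m : R * R -> R)
  (x y k e t p q N M d : R).

Definition partials_on (S : set (R * R)) m m1 m2 := forall x y, S (x, y) ->
  is_derive x 1 (fun s => m (s, y)) (m1 (x, y)) /\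
  is_derive y 1 (fun t => m (x, t)) (m2 (x, y)).

(** The weight [m] need be differentiable only on the closed support of [F],
    since elsewhere the product vanishes locally. *)
Lemma C1M_local F F1 F2 m m1 m2 : C1fun F F1 F2 ->
  continuous m -> continuous m1 -> continuous m2 ->
  partials_on (closure [set z | F z != 0]) m m1 m2 ->
  C1fun (fun z => F z * m z) (fun z => F1 z * m z + F z * m1 z)
    (fun z => F2 z * m z + F z * m2 z).
Proof.
move=> [cF cF1 cF2 dF1 dF2] cm cm1 cm2 dm.
have out x y : ~ closure [set z | F z != 0] (x, y) ->
    [/\ F (x, y) = 0, F1 (x, y) = 0 & F2 (x, y) = 0].
  move=> nc; split; apply/eqP; apply: contraT => h; case: nc.
  - exact: subset_closure.
  - exact: (derive_outside dF1 h).
  - exact: (derive_outside2 dF2 h).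
split.
- exact: cont_mul.
- by apply: cont_add; apply: cont_mul.
- by apply: cont_add; apply: cont_mul.
- move=> x y; have [c|nc] := pselect (closure [set z | F z != 0] (x, y)).
    by have [d1 _] := dm _ _ c; exact: (der1_mul (dF1 x y) d1).
  have [F0 F10 F20] := out _ _ nc; have [near0 _] := off_support nc.
  apply: (der1_eq (a := 0)); last by rewrite F10 F0; ring.
  by apply: (@der1_near _ (fun=> 0)) => //; apply: filterS near0 => s ->; rewrite mul0r.
- move=> x y; have [c|nc] := pselect (closure [set z | F z != 0] (x, y)).
    by have [_ d1] := dm _ _ c; exact: (der1_mul (dF2 x y) d1).
  have [F0 F10 F20] := out _ _ nc; have [_ near0] := off_support nc.
  apply: (der1_eq (a := 0)); last by rewrite F20 F0; ring.
  by apply: (@der1_near _ (fun=> 0)) => //; apply: filterS near0 => s ->; rewrite mul0r.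
Qed.

(** The weak form of [A_x + C_y = E]. The fluxes are continuous on the whole
    plane, which gives them values on the boundary of [D]. *)
Record conserved (D : set (R * R)) A C E : Prop := {
  cons_A : continuous A;
  cons_C : continuous C;
  cons_E : continuous E;
  cons_eq : forall f f1 f2 : R * R -> R, C1test D f f1 f2 ->
    plane (fun z => A z * f1 z + C z * f2 z + E z * f z) = 0 }.

Lemma oint_support (f : R -> R) a b c e : continuous f ->
  a <= b -> c <= e -> b <= c -> (forall x, f x != 0 -> b <= x <= c) ->
  oint a e f = oint b c f.
Proof.
move=> cf ab ce bc H.
have f0 x : ~~ (b < x < c) -> f x = 0.
  move=> nx; apply/eqP; apply: contraT => fx.
  (* at the end points, [f] vanishes by continuity *)
  have [x0 x1] := andP (H _ fx).
  have : \forall y \near x, f y != 0.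
    by apply: filterS (cvgr_neq0 _ (cf x) _).
  move=> /nbhs_ballP[r /= r0 Hr].
  have [y [yr ybc]] : exists y, `|x - y| < r /\ ~~ (b <= y <= c).
    move: nx; rewrite negb_and -!leNgt => /orP[xb|cx].
      exists (x - r / 2); split; first by rewrite ltr_norml; apply/andP; split; lra.
      by apply/negP => /andP[? ?]; lra.
    exists (x + r / 2); split; first by rewrite ltr_norml; apply/andP; split; lra.
    by apply/negP => /andP[? ?]; lra.
  by move: ybc; rewrite H// Hr.
rewrite (oint_chasles b) (oint_chasles c b e) (@oint_eq0 _ a b)// ?(@oint_eq0 _ c e)//.
- by rewrite add0r addr0.
- move=> x; rewrite (min_l ce) (max_r ce) => /andP[cx _]; apply: f0.
  by rewrite negb_and -!leNgt cx orbT.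
- move=> x; rewrite (min_l ab) (max_r ab) => /andP[_ xb]; apply: f0.
  by rewrite negb_and -!leNgt xb.
Qed.

Section FixedCutoff.
Variables (d : R) (eta zeta zeta' : R -> R) (A C E m m1 m2 : R * R -> R) (a b t : R).
Hypotheses (cons : conserved (fluid d eta) A C E).
Hypotheses (dz : deriv_of zeta zeta') (cz' : continuous zeta').
Hypothesis zeta_d : forall x, - d < zeta x.
Hypothesis zeta_eta : forall x, a < x < b -> zeta x <= eta x.
Hypotheses (cm : continuous m) (cm1 : continuous m1) (cm2 : continuous m2).
Hypothesis dm : partials_on (fluid d eta) m m1 m2.
Hypothesis t0 : 0 < t.

Let chi z := top_cut t zeta z * bot_cut t d z.
Let chi1 z := top_cut1 t zeta zeta' z * bot_cut t d z.
Let chi2 z := top_cut2 t zeta z * bot_cut t d z + top_cut t zeta z * bot_cut2 t d z.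
Definition cut_density z := A z * (m z * chi z).
Definition cut_flux z := (A z * m1 z + C z * m2 z + E z * m z) * chi z +
  m z * (A z * chi1 z + C z * chi2 z).
Definition cut_J x := oint (- d) (zeta x) (fun y => cut_density (x, y)).
Definition cut_L x := oint (- d) (zeta x) (fun y => cut_flux (x, y)).

Let cz := is_derive_continuous dz.

Let chi_C1 : C1fun chi chi1 chi2.
Proof.
have E1 : chi1 = (fun z => top_cut1 t zeta zeta' z * bot_cut t d z + top_cut t zeta z * 0).
  by apply/funext => z; rewrite mulr0 addr0.
by rewrite E1; exact: (C1M (top_cut_C1 t dz cz') (bot_cut_C1 t d)).
Qed.

Let chi_core z : [\/ chi z != 0, chi1 z != 0 | chi2 z != 0] ->
  t <= zeta z.1 - z.2 /\ t <= z.2 + d.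
Proof.
move=> H; split.
- rewrite leNgt; apply/negP => /ltW h; have [e1 e2] := top_cut_eq0 t0 h.
  by move: H; rewrite /chi /chi1 /chi2 /top_cut1 /top_cut2 e1 e2 !mul0r addr0 eqxx; case.
- rewrite leNgt; apply/negP => /ltW h; have [e1 e2] := bot_cut_eq0 t0 h.
  by move: H; rewrite /chi /chi1 /chi2 /bot_cut2 e1 e2 !(mul0r, mulr0) addr0 eqxx; case.
Qed.

Let cchi : continuous chi := C1_cont chi_C1.
Let cchi1 : continuous chi1 := C1_cont1 chi_C1.
Let cchi2 : continuous chi2 := C1_cont2 chi_C1.

Lemma cont_cut_density : continuous cut_density.
Proof. have cA := cons_A cons; by apply: cont_mul => //; apply: cont_mul. Qed.

Lemma cont_cut_flux : continuous cut_flux.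
Proof.
have [cA cC cE] := And3 (cons_A cons) (cons_C cons) (cons_E cons).
apply: cont_add; apply: cont_mul => //.
  by apply: cont_add; [apply: cont_add|]; apply: cont_mul.
by apply: cont_add; apply: cont_mul.
Qed.

Lemma cont_cut_J : continuous cut_J.
Proof.
by apply: (continuous_oint2 cont_cut_density) => //; [exact: cont_id|exact: cont_cst].
Qed.

Lemma cont_cut_L : continuous cut_L.
Proof.
by apply: (continuous_oint2 cont_cut_flux) => //; [exact: cont_id|exact: cont_cst].
Qed.

(** The law is tested against [f x * m * chi], where [chi] cuts off near both
    edges. By Fubini's theorem this is a one-dimensional identity for every [f],
    to which [du_Bois_Reymond] applies. *)
Lemma cut_identity x1 x2 : a < x1 -> x1 <= x2 -> x2 < b ->
  cut_J x2 - cut_J x1 = oint x1 x2 cut_L.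
Proof.
apply: (du_Bois_Reymond cont_cut_J cont_cut_L) => p q f f' ap qb pq df cf' sf.
have cf := is_derive_continuous df.
have f'0 x : f' x != 0 -> p <= x <= q.
  move=> f'x; apply: contraT => npq; move/negP: f'x; case.
  have [_ <-] := df x.
  have : \forall s \near x, f s = 0.
    have nz s : ~~ (p < s < q) -> f s = 0.
      by move=> h; apply/eqP; move: h; apply: contraNT; exact: sf.
    move: npq; rewrite negb_and -!ltNge => /orP[xp|qx].
      by apply: filterS (lt_nbhsl xp) => s sp; apply: nz; rewrite negb_and -!leNgt (ltW sp).
    by apply: filterS (lt_nbhsr qx) => s sp; apply: nz; rewrite negb_and -!leNgt (ltW sp) orbT.
  move=> near0.
  have h : is_derive x 1 (fun=> 0 : R) 0 by exact: der1_cst.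
  have [_ ->] : is_derive x 1 f 0; last by [].
  by apply: (@der1_near _ (fun=> 0)) => //; apply: filterS near0 => s ->.
pose F z := f z.1 * chi z.
have FC1 := C1M (fst_C1 df cf') chi_C1.
have Fcore z : F z != 0 -> core t d zeta p q z.
  rewrite mulf_eq0 negb_or => /andP[/sf/andP[? ?] h].
  by have [|? ?] := chi_core (z := z); [exact: Or31|split; [apply/andP; split; exact: ltW|..]].
have [cpt sub] := closure_core t0 cz Fcore.
have core_fluid : core t d zeta p q `<=` fluid d eta.
  move=> [x y] [/= /andP[pz zq] h1 h2]; rewrite /fluid /=.
  have t0' := t0; split; first by lra.
  have : zeta x <= eta x by apply: zeta_eta; apply/andP; split; lra.
  lra.
have dmF : partials_on (closure [set z | F z != 0]) m m1 m2.
  by move=> x y xy; apply: dm; exact/core_fluid/sub.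
have CF := C1M_local FC1 cm cm1 cm2 dmF.
have SF : supported_in (fluid d eta) (fun z => F z * m z).
  apply: (@supported_sub _ _ F).
    by split => //; exact: subset_trans core_fluid.
  by move=> z; rewrite mulf_eq0 negb_or => /andP[].
have := cons_eq cons (Build_C1test CF SF).
set G := (fun z => _) => G0.
have GE z : G z = f' z.1 * cut_density z + f z.1 * cut_flux z.
  by rewrite /G /cut_density /cut_flux /F; ring.
have cG : continuous G.
  have -> : G = (fun z => f' z.1 * cut_density z + f z.1 * cut_flux z) by exact/funext.
  apply: cont_add; apply: cont_mul.
  - by apply: cont_comp => //; exact: cont_fst.
  - exact: cont_cut_density.
  - by apply: cont_comp => //; exact: cont_fst.
  - exact: cont_cut_flux.
have Gcore z : G z != 0 -> core t d zeta p q z.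
  rewrite GE => Gz.
  have pq1 : p <= z.1 <= q.
    apply: contraT => npq; move: Gz.
    have -> : f' z.1 = 0 by apply/eqP; apply: contraT => /f'0; rewrite (negbTE npq).
    have -> : f z.1 = 0.
      apply/eqP; apply: contraT => /sf/andP[? ?]; move: npq.
      by rewrite !ltW.
    by rewrite !mul0r addr0 eqxx.
  suff [? ?] : t <= zeta z.1 - z.2 /\ t <= z.2 + d by split.
  apply: chi_core.
  case: (eqVneq (chi z) 0) => [c0|]; last by move=> ?; exact: Or31.
  case: (eqVneq (chi1 z) 0) => [c10|]; last by move=> ?; exact: Or32.
  case: (eqVneq (chi2 z) 0) => [c20|]; last by move=> ?; exact: Or33.
  by move: Gz; rewrite /cut_density /cut_flux c0 c10 c20 !(mulr0, addr0, add0r) eqxx.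
have [N N0 HN] := compact_box (core_compact (d := d) (p := p) (q := q) t0 cz).
have bG : boxed N G by move=> z /Gcore/HN.
pose M := N + `|p| + `|q| + `|d| + `|- d|.
have [Mz Mz0 HMz] := @bounded_seg _ zeta p q cz.
pose K := M + Mz.
have NK : N <= K by rewrite /K /M -!addrA lerDl !addr_ge0.
have K0 : 0 <= K by rewrite (le_trans (ltW N0)).
move: G0; rewrite /plane (plane_fubini K0 cG (boxed_le NK bG)).
have np := ler_norm p; have np' := ler_norm (- p); rewrite normrN in np'.
have nq := ler_norm q; have nd := ler_norm d; have nd' := ler_norm (- d).
have [n0 n1 n2] : [/\ 0 <= `|p|, 0 <= `|q| & 0 <= `|d|] by split.
have n3 : 0 <= `|- d| by [].
have cGx : continuous (fun x => oint (- K) K (fun y => G (x, y))).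
  by apply: (continuous_oint2 cG); [exact: cont_id|exact: cont_cst|exact: cont_cst].
have supp x : oint (- K) K (fun y => G (x, y)) != 0 -> p <= x <= q.
  move=> h; apply: contraT => nx; move: h.
  have -> : (fun y => G (x, y)) = (fun=> 0).
    apply/funext => y; apply/eqP; apply: contraT => /Gcore[/= pxq _ _].
    by rewrite pxq in nx.
  by rewrite oint_cst mul0r eqxx.
have Kp : - K <= p by rewrite /K /M; lra.
have Kq : q <= K by rewrite /K /M; lra.
rewrite (oint_support cGx Kp Kq pq supp) => <-.
apply: eq_oint.
- apply: cont_add; apply: cont_mul => //; [exact: cont_cut_J|exact: cont_cut_L].
- exact: cGx.
rewrite (min_l pq) (max_r pq) => x xpq.
have cs : continuous (fun y => G (x, y)) by exact: cont_slice2.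
have KZ : zeta x <= K.
  have := HMz _ xpq; rewrite ler_norml => /andP[_ h]; rewrite /K /M; lra.
have Kd : - K <= - d by rewrite /K /M; lra.
have sy y : G (x, y) != 0 -> - d <= y <= zeta x.
  by have t0' := t0; move=> /Gcore[/= _ h1 h2]; apply/andP; split; lra.
rewrite (oint_support cs Kd KZ (ltW (zeta_d x)) sy).
have cD : continuous (fun y => cut_density (x, y)) by exact/cont_slice2/cont_cut_density.
have cF : continuous (fun y => cut_flux (x, y)) by exact/cont_slice2/cont_cut_flux.
rewrite /cut_J /cut_L -!ointZ// -ointD//; last 2 first.
- by apply: cont_mul => //; exact: cont_cst.
- by apply: cont_mul => //; exact: cont_cst.
by congr (oint _ _ _); apply/funext => y; rewrite GE.
Qed.

End FixedCutoff.

(** A compact part of the fluid stays away from the bed and from the surface. *)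
Lemma fluid_has_cutoffs d eta eta' : deriv_of eta eta' -> continuous eta' ->
  has_cutoffs (fluid d eta).
Proof.
move=> de ce' K cK KD; have ce := is_derive_continuous de.
have [N N0 HN] := compact_box cK.
have cc := @cont_cst R (R * R)%type.
have c1 := @cont_fst R; have c2 := @cont_snd R.
have cE : continuous (fun z : R * R => eta z.1 - z.2) by apply: cont_sub => //; exact: cont_comp.
have cB : continuous (fun z : R * R => z.2 + d) by exact: cont_add.
have [z /KD[_ h]|r1 r10 Hr1] := positive_on_compact cK cE; first by rewrite subr_gt0.
have [z /KD[h _]|r2 r20 Hr2] := positive_on_compact cK cB; first by lra.
pose t := Num.min r1 r2 / 4.
have m0 : 0 < Num.min r1 r2 by rewrite lt_min r10.
have m1 : Num.min r1 r2 <= r1 by rewrite ge_min lexx.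
have m2 : Num.min r1 r2 <= r2 by rewrite ge_min lexx orbT.
have t0 : 0 < t by rewrite /t; lra.
have [tr1 tr2] : 2 * t <= r1 /\ 2 * t <= r2 by rewrite /t; split; lra.
pose f x := step (1 * x + (N + 2)) * step (-1 * x + (N + 2)).
pose f' x := step' (1 * x + (N + 2)) * 1 * step (-1 * x + (N + 2)) +
  step (1 * x + (N + 2)) * (step' (-1 * x + (N + 2)) * -1).
have df : deriv_of f f'.
  by move=> x; exact: (der1_mul (step_affine_derive _ _ x) (step_affine_derive _ _ x)).
have ca a b : continuous (fun x : R => step (a * x + b)).
  by apply: cont_comp; [exact: cont_step|exact: cont_affine].
have ca' a b : continuous (fun x : R => step' (a * x + b) * a) by exact: cont_step'_affine.
have cf' : continuous f'.
  by apply: cont_add; apply: cont_mul.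
have f1 x : `|x| < N -> f x = 1 /\ f' x = 0.
  move=> xN.
  have xx := ler_norm x; have xx' := ler_norm (- x); rewrite normrN in xx'.
  have h1 : 2 <= 1 * x + (N + 2) by lra.
  have h2 : 2 <= -1 * x + (N + 2) by lra.
  rewrite /f /f' !step_eq1// !step'_eq0 ?negb_and -?leNgt ?h1 ?h2 ?orbT//.
  by split; ring.
have f0 x : f x != 0 -> - (N + 2) <= x <= N + 2.
  rewrite /f; case: (leP (1 * x + (N + 2)) 1) => [/step_eq0 ->|h1]; first by rewrite mul0r eqxx.
  case: (leP (-1 * x + (N + 2)) 1) => [/step_eq0 ->|h2 _]; first by rewrite mulr0 eqxx.
  by apply/andP; split; lra.
have C := C1M (fst_C1 df cf') (C1M (top_cut_C1 t de ce') (bot_cut_C1 t d)).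
do 3 eexists; split.
  split; first exact: C.
  have H z : f z.1 * (top_cut t eta z * bot_cut t d z) != 0 ->
      core t d eta (- (N + 2)) (N + 2) z.
    rewrite mulf_eq0 negb_or => /andP[/f0 h1].
    rewrite mulf_eq0 negb_or => /andP[h2 h3]; split => //.
      rewrite leNgt; apply: contra h2 => /ltW h; apply/eqP.
      by have [] := top_cut_eq0 t0 h.
    rewrite leNgt; apply: contra h3 => /ltW h; apply/eqP.
    by have [] := bot_cut_eq0 t0 h.
  have [cpt sub] := closure_core t0 ce H.
  by split => //; apply: subset_trans sub _ => z [_ h1 h2]; rewrite /fluid /=; split; lra.
move=> z Kz; have [/f1[e1 e2] _] := HN _ Kz.
have h1 : 2 * t <= eta z.1 - z.2 by apply: le_trans (Hr1 _ Kz).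
have h2 : 2 * t <= z.2 + d by apply: le_trans (Hr2 _ Kz).
have [e3 e4] := top_cut_eq1 t0 h1; have [e5 e6] := bot_cut_eq1 t0 h2.
by rewrite /top_cut1 /top_cut2 /bot_cut2 e1 e2 e3 e4 e5 e6; split; ring.
Qed.

End ColumnIdentity.

Section ColumnLimit.
Variable R : realType.
Implicit Types (f g h zeta eta : R -> R) (F G A C E m : R * R -> R)
  (x y k e t p q N M d : R).

(** The integrands differ only on two end strips of width [2 * t]. *)
Lemma cut_close (h chi : R -> R) a b t M : 0 < t -> 4 * t <= b - a ->
  continuous h -> continuous chi -> 0 <= M ->
  (forall y, a <= y <= b -> `|h y| <= M) ->
  (forall y, 0 <= chi y <= 1) ->
  (forall y, a + 2 * t <= y <= b - 2 * t -> chi y = 1) ->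
  `|oint a b (fun y => h y * chi y) - oint a b h| <= 4 * t * M.
Proof.
move=> t0 tab ch cc M0 hM c01 c1.
have chc : continuous (fun y => h y * chi y) by exact: cont_mul.
have cD : continuous (fun y => h y * chi y - h y) by exact: cont_sub.
rewrite -ointB//.
rewrite (oint_chasles (a + 2 * t)) (oint_chasles (b - 2 * t) (a + 2 * t)).
rewrite (@oint_eq0 _ (a + 2 * t) (b - 2 * t))//; last first.
  have ab : a + 2 * t <= b - 2 * t by lra.
  by rewrite (min_l ab) (max_r ab) => y /c1 ->; rewrite mulr1 subrr.
have D y : a <= y <= b -> `|h y * chi y - h y| <= M.
  move=> /hM yM; have -> : h y * chi y - h y = h y * (chi y - 1) by ring.
  rewrite normrM -[leRHS]mulr1; apply: ler_pM => //.
  by have /andP[? ?] := c01 y; rewrite ler_norml; apply/andP; split; lra.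
have H1 : `|oint a (a + 2 * t) (fun y => h y * chi y - h y)| <= M * (2 * t).
  have := @oint_norm_le _ a (a + 2 * t) _ M cD.
  have le : a <= a + 2 * t by lra.
  rewrite (min_l le) (max_r le) (_ : a + 2 * t - a = 2 * t); last by ring.
  rewrite (ger0_norm (_ : 0 <= 2 * t)); last by lra.
  by apply => y /andP[? ?]; apply: D; apply/andP; split; lra.
have H2 : `|oint (b - 2 * t) b (fun y => h y * chi y - h y)| <= M * (2 * t).
  have := @oint_norm_le _ (b - 2 * t) b _ M cD.
  have le : b - 2 * t <= b by lra.
  rewrite (min_l le) (max_r le) (_ : b - (b - 2 * t) = 2 * t); last by ring.
  rewrite (ger0_norm (_ : 0 <= 2 * t)); last by lra.
  by apply => y /andP[? ?]; apply: D; apply/andP; split; lra.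
rewrite add0r; apply: (le_trans (ler_normD _ _)); lra.
Qed.

Lemma step_top_support (t z y : R) : 0 < t ->
  step' (- t^-1 * y + z / t) * t^-1 != 0 -> z - 2 * t < y < z - t.
Proof.
move=> t0; have tn : t != 0 by rewrite gt_eqF.
rewrite mulf_eq0 negb_or top_arg// => /andP[h _].
move: h; apply: contraNT => h; apply/eqP/step'_eq0; apply: contra h => /andP[].
rewrite ltr_pdivlMr// ltr_pdivrMr// mul1r => ? ?; apply/andP; split; lra.
Qed.

Lemma step_bot_support (t d y : R) : 0 < t ->
  step' (t^-1 * y + - - d / t) * t^-1 != 0 -> - d + t < y < - d + 2 * t.
Proof.
move=> t0; have tn : t != 0 by rewrite gt_eqF.
rewrite mulf_eq0 negb_or bot_arg// => /andP[h _].
move: h; apply: contraNT => h; apply/eqP/step'_eq0; apply: contra h => /andP[].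
rewrite ltr_pdivlMr// ltr_pdivrMr// mul1r => ? ?; apply/andP; split; lra.
Qed.

Lemma limit_arith (a1 a2 b1 b2 I1 I2 T e q : R) :
  `|a1 - b1| <= T -> `|a2 - b2| <= T -> `|I1 - I2| <= (T + 2 * e) * q ->
  T <= e -> 0 <= q -> a2 - a1 = I1 -> `|b2 - b1 - I2| <= e * (8 + 6 * q).
Proof.
move=> h1 h2 h3 Te q0 E1; rewrite -E1 in h3; have T0 := le_trans (normr_ge0 _) h1.
have {}h3 : `|a2 - a1 - I2| <= 3 * (e * q).
  apply: (le_trans h3); have := ler_wpM2r q0 Te; lra.
have -> : e * (8 + 6 * q) = 8 * e + 6 * (e * q) by ring.
have : 0 <= e * q by rewrite mulr_ge0// (le_trans T0).
move: h1 h2 h3; move: (e * q) => Q; rewrite !ler_norml.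
move=> /andP[? ?] /andP[? ?] /andP[? ?] ?; apply/andP; split; lra.
Qed.

Section Limit.
Variables (d : R) (eta zeta zeta' : R -> R) (A C E m m1 m2 : R * R -> R) (a b : R).
Hypotheses (cons : conserved (fluid d eta) A C E).
Hypotheses (dz : deriv_of zeta zeta') (cz' : continuous zeta').
Hypothesis zeta_d : forall x, - d < zeta x.
Hypothesis zeta_eta : forall x, a < x < b -> zeta x <= eta x.
Hypotheses (cm : continuous m) (cm1 : continuous m1) (cm2 : continuous m2).
Hypothesis dm : partials_on (fluid d eta) m m1 m2.

Let cz := is_derive_continuous dz.
Let dens z := A z * m z.
Let bulk z := A z * m1 z + C z * m2 z + E z * m z.
Let top z := m z * (A z * zeta' z.1 - C z).
Let bot z := m z * C z.
Let J x := oint (- d) (zeta x) (fun y => dens (x, y)).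
Let L x := oint (- d) (zeta x) (fun y => bulk (x, y)) + top (x, zeta x) + bot (x, - d).

Let cA : continuous A := cons_A cons.
Let cC : continuous C := cons_C cons.
Let cE : continuous E := cons_E cons.
Let cdens : continuous dens. Proof. exact: cont_mul. Qed.
Let cbulk : continuous bulk.
Proof. by apply: cont_add; [apply: cont_add|]; apply: cont_mul. Qed.
Let ctop : continuous top.
Proof.
apply: cont_mul => //; apply: cont_sub => //; apply: cont_mul => //.
by apply: cont_comp => //; exact: cont_fst.
Qed.
Let cbot : continuous bot. Proof. exact: cont_mul. Qed.
Let cL : continuous L.
Proof.
apply: cont_add; first apply: cont_add.
- by apply: (continuous_oint2 cbulk) => //; [exact: cont_id|exact: cont_cst].
- by apply: (continuous2 ctop) => //; exact: cont_id.
- by apply: (continuous2 cbot) => //; [exact: cont_id|exact: cont_cst].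
Qed.

Section AtColumn.
Variables (x t e M : R).
Hypotheses (t0 : 0 < t) (tz : 4 * t <= zeta x + d) (M0 : 0 <= M).
Hypothesis densM : forall y, - d <= y <= zeta x -> `|dens (x, y)| <= M.
Hypothesis bulkM : forall y, - d <= y <= zeta x -> `|bulk (x, y)| <= M.
Hypothesis top_e : forall y, zeta x - 2 * t <= y <= zeta x ->
  `|top (x, y) - top (x, zeta x)| <= e.
Hypothesis bot_e : forall y, - d <= y <= - d + 2 * t ->
  `|bot (x, y) - bot (x, - d)| <= e.

Let chi y := top_cut t zeta (x, y) * bot_cut t d (x, y).

Let cchi : continuous chi.
Proof.
have := cont_mul (C1_cont (top_cut_C1 t dz cz')) (C1_cont (bot_cut_C1 t d)).
by move=> /(@cont_slice2 _ _ x).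
Qed.

Let chi01 y : 0 <= chi y <= 1.
Proof.
by rewrite /chi /top_cut /bot_cut mulr_ge0 ?step_ge0// mulr_ile1 ?step_ge0 ?step_le1.
Qed.

Let chi1 y : - d + 2 * t <= y <= zeta x - 2 * t -> chi y = 1.
Proof.
move=> /andP[h1 h2]; have t0' := t0.
have [e1 _] := @top_cut_eq1 _ t zeta (x, y) t0 ltac:(rewrite /=; lra).
have [e2 _] := @bot_cut_eq1 _ t d (x, y) t0 ltac:(rewrite /=; lra).
by rewrite /chi e1 e2 mulr1.
Qed.

Lemma cut_J_close : `|cut_J d zeta A m t x - J x| <= 4 * t * M.
Proof.
have tz' := tz.
have := @cut_close (fun y => dens (x, y)) chi (- d) (zeta x) t M t0 _
  (@cont_slice2 _ _ x cdens) cchi M0 densM chi01 chi1.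
have -> : 4 * t <= zeta x - - d by rewrite opprK.
move=> /(_ isT); congr (`|oint _ _ _ - _| <= _).
by apply/funext => y; rewrite /cut_density /dens /chi; ring.
Qed.

(** In the flux, the derivatives of the cut-off are unit masses near the two
    edges; they produce the boundary terms of [L]. *)
Lemma cut_L_close : `|cut_L d zeta zeta' A C E m m1 m2 t x - L x| <= 4 * t * M + 2 * e.
Proof.
have tz' := tz; have t0' := t0.
have tn : t != 0 by rewrite gt_eqF.
have H1 := @cut_close (fun y => bulk (x, y)) chi (- d) (zeta x) t M t0 _
  (@cont_slice2 _ _ x cbulk) cchi M0 bulkM chi01 chi1.
have {}H1 := H1 ltac:(rewrite opprK; lra).
pose w1 y := step' (- t^-1 * y + zeta x / t) * t^-1.
pose w2 y := step' (t^-1 * y + - - d / t) * t^-1.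
have cw1 : continuous w1.
  apply: cont_mul; last exact: cont_cst.
  by apply: cont_comp; [exact: cont_step'|exact: cont_affine].
have cw2 : continuous w2 by exact: cont_step'_affine.
have dzx : - d <= zeta x by exact/ltW/zeta_d.
have wp s y : 0 <= step' s / t :> R by rewrite divr_ge0 ?step'_ge0// ltW.
have ct : continuous (fun y => top (x, y)) by exact: cont_slice2.
have cb : continuous (fun y => bot (x, y)) by exact: cont_slice2.
have H2 : `|oint (- d) (zeta x) (fun y => top (x, y) * w1 y) - top (x, zeta x)| <= e.
  apply: weighted_mean => //.
  - by move=> y _; exact: wp.
  - by apply: oint_step_down => //; lra.
  - move=> y yd /(step_top_support t0)/andP[h1 h2]; apply: top_e.
    by apply/andP; split; lra.
have H3 : `|oint (- d) (zeta x) (fun y => bot (x, y) * w2 y) - bot (x, - d)| <= e.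
  apply: weighted_mean => //.
  - by move=> y _; exact: wp.
  - by apply: oint_step_up => //; lra.
  - move=> y yd /(step_bot_support t0)/andP[h1 h2]; apply: bot_e.
    by apply/andP; split; lra.
have E1 : cut_L d zeta zeta' A C E m m1 m2 t x =
    oint (- d) (zeta x) (fun y => bulk (x, y) * chi y) +
    oint (- d) (zeta x) (fun y => top (x, y) * w1 y) +
    oint (- d) (zeta x) (fun y => bot (x, y) * w2 y).
  have c1 : continuous (fun y => bulk (x, y) * chi y).
    by apply: cont_mul => //; exact: cont_slice2.
  have c2 : continuous (fun y => top (x, y) * w1 y) by exact: cont_mul.
  have c3 : continuous (fun y => bot (x, y) * w2 y) by exact: cont_mul.
  have c12 : continuous (fun y => bulk (x, y) * chi y + top (x, y) * w1 y) by exact: cont_add.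
  rewrite -ointD// -ointD//; congr (oint _ _ _); apply/funext => y.
  rewrite /cut_flux -/(chi y) -/(bulk (x, y)) -!addrA; congr (_ + _).
  rewrite /top_cut1 /top_cut2 /bot_cut2 /top /bot /w1 /w2 /=.
  set s1 := step' (- t^-1 * y + zeta x / t); set s2 := step' (t^-1 * y + - - d / t).
  have K1 : s1 * bot_cut t d (x, y) = s1.
    case: (eqVneq s1 0) => [->|s10]; first by rewrite mul0r.
    have : s1 * t^-1 != 0 by rewrite mulf_neq0// invr_eq0.
    move=> /(step_top_support t0)/andP[h1 h2].
    have [-> _] := @bot_cut_eq1 _ t d (x, y) t0 ltac:(rewrite /=; lra).
    by rewrite mulr1.
  have K2 : top_cut t zeta (x, y) * s2 = s2.
    case: (eqVneq s2 0) => [->|s20]; first by rewrite mulr0.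
    have : s2 * t^-1 != 0 by rewrite mulf_neq0// invr_eq0.
    move=> /(step_bot_support t0)/andP[h1 h2].
    have [-> _] := @top_cut_eq1 _ t zeta (x, y) t0 ltac:(rewrite /=; lra).
    by rewrite mul1r.
  transitivity (m (x, y) * (A (x, y) * (zeta' x / t) * (s1 * bot_cut t d (x, y)) +
    C (x, y) * (- t^-1 * (s1 * bot_cut t d (x, y)) + (top_cut t zeta (x, y) * s2) * t^-1))).
    by ring.
  by rewrite K1 K2; ring.
rewrite E1 /L; move: H1 H2 H3; rewrite !ler_norml.
move=> /andP[? ?] /andP[? ?] /andP[? ?]; apply/andP; split; lra.
Qed.

End AtColumn.

(** A weak conservation law, multiplied by a weight [m] and integrated in [y]
    from the bed to a curve [zeta] below or on the surface. The boundary terms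
    need no more than continuous fluxes: they appear as the thickness [t] of the
    cut-offs tends to 0, uniformly for [x] in [x1, x2]. *)
Theorem column_identity x1 x2 : a < x1 -> x1 <= x2 -> x2 < b ->
  J x2 - J x1 = oint x1 x2 L.
Proof.
move=> ax1 x12 x2b.
apply/eqP; rewrite -subr_eq0; apply/eqP.
apply: (@small_eq0 _ _ (8 + 6 * `|x2 - x1|)); first by rewrite addr_ge0 ?mulr_ge0.
move=> e e0.
have [Mz Mz0 HMz] := @bounded_seg _ zeta x1 x2 cz.
have [M1 M10 HM1] := @bounded_rect _ dens x1 x2 (- d) Mz cdens.
have [M2 M20 HM2] := @bounded_rect _ bulk x1 x2 (- d) Mz cbulk.
pose M := M1 + M2.
have M0 : 0 <= M by rewrite addr_ge0.
have zM x : x1 <= x <= x2 -> zeta x <= Mz.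
  by move=> /HMz; rewrite ler_norml => /andP[].
have HD x y : x1 <= x <= x2 -> - d <= y <= zeta x -> `|dens (x, y)| <= M.
  move=> hx /andP[h1 h2]; have := zM _ hx => h3.
  have := HM1 x y hx; rewrite h1 (le_trans h2 h3) => /(_ isT); rewrite /M; lra.
have HB x y : x1 <= x <= x2 -> - d <= y <= zeta x -> `|bulk (x, y)| <= M.
  move=> hx /andP[h1 h2]; have := zM _ hx => h3.
  have := HM2 x y hx; rewrite h1 (le_trans h2 h3) => /(_ isT); rewrite /M; lra.
have czd : continuous (fun x => zeta x + d) by apply: cont_add => //; exact: cont_cst.
have [|r1 r10 Hr1] := @positive_on_seg _ _ x1 x2 czd.
  by move=> x _; have := zeta_d x; lra.
have cT : continuous (fun z : R * R => top (z.2, zeta z.2 + z.1)).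
  apply: (continuous2 ctop); first exact: cont_snd.
  apply: cont_add; last exact: cont_fst.
  by apply: cont_comp => //; exact: cont_snd.
have cB : continuous (fun z : R * R => bot (z.2, - d + z.1)).
  apply: (continuous2 cbot); first exact: cont_snd.
  by apply: cont_add; [exact: cont_cst|exact: cont_fst].
have /nbhs_ballP[r2 /= r20 Hr2] := @tube _ _ _ x1 x2 0 e cT e0.
have /nbhs_ballP[r3 /= r30 Hr3] := @tube _ _ _ x1 x2 0 e cB e0.
pose t := Num.min (Num.min r1 (e / (M + 1))) (Num.min r2 r3) / 4.
have eM : 0 < e / (M + 1) by rewrite divr_gt0// ltr_wpDl.
have m0 : 0 < Num.min (Num.min r1 (e / (M + 1))) (Num.min r2 r3).
  by rewrite !lt_min r10 eM r20 r30.
have k1 : Num.min (Num.min r1 (e / (M + 1))) (Num.min r2 r3) <= r1 by rewrite !ge_min lexx.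
have k2 : Num.min (Num.min r1 (e / (M + 1))) (Num.min r2 r3) <= e / (M + 1).
  by rewrite !ge_min lexx orbT.
have k3 : Num.min (Num.min r1 (e / (M + 1))) (Num.min r2 r3) <= r2.
  by rewrite !ge_min lexx !orbT.
have k4 : Num.min (Num.min r1 (e / (M + 1))) (Num.min r2 r3) <= r3.
  by rewrite !ge_min lexx !orbT.
have t0 : 0 < t by rewrite /t; lra.
have [t1 t2 t3 t4] : [/\ 4 * t <= r1, 4 * t <= e / (M + 1), 4 * t <= r2 & 4 * t <= r3].
  by rewrite /t; split; lra.
clearbody t; clear m0 k1 k2 k3 k4.
have tM : 4 * t * M <= e.
  have : 4 * t * (M + 1) <= e by rewrite -ler_pdivlMr// ltr_wpDl.
  by move: t0 M0; nra.
have HT x : x1 <= x <= x2 -> forall y, zeta x - 2 * t <= y <= zeta x ->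
    `|top (x, y) - top (x, zeta x)| <= e.
  move=> hx y /andP[h1 h2].
  have := Hr2 (y - zeta x) _ x hx; rewrite /= addr0 => H.
  have -> : y = zeta x + (y - zeta x) by ring.
  by apply/ltW/H; rewrite /ball/= sub0r normrN ltr_norml; apply/andP; split; lra.
have HBt x : x1 <= x <= x2 -> forall y, - d <= y <= - d + 2 * t ->
    `|bot (x, y) - bot (x, - d)| <= e.
  move=> hx y /andP[h1 h2].
  have := Hr3 (y + d) _ x hx; rewrite /= addr0 => H.
  have -> : y = - d + (y + d) by ring.
  by apply/ltW/H; rewrite /ball/= sub0r normrN ltr_norml; apply/andP; split; lra.
have tz x : x1 <= x <= x2 -> 4 * t <= zeta x + d.
  by move=> /Hr1; lra.
have CJ x (hx : x1 <= x <= x2) : `|cut_J d zeta A m t x - J x| <= 4 * t * M.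
  by apply: (cut_J_close t0 (tz x hx) M0) => y hy; exact: HD.
have CL x (hx : x1 <= x <= x2) :
    `|cut_L d zeta zeta' A C E m m1 m2 t x - L x| <= 4 * t * M + 2 * e.
  apply: (cut_L_close t0 (tz x hx) M0) => //.
  - by move=> y hy; exact: HB.
  - exact: HT.
  - exact: HBt.
have I := cut_identity cons dz cz' zeta_d zeta_eta cm cm1 cm2 dm t0 ax1 x12 x2b.
have ccL : continuous (cut_L d zeta zeta' A C E m m1 m2 t).
  exact: (cont_cut_L cons dz cz' cm cm1 cm2).
have B : `|oint x1 x2 (cut_L d zeta zeta' A C E m m1 m2 t) - oint x1 x2 L| <=
    (4 * t * M + 2 * e) * `|x2 - x1|.
  rewrite -ointB//; apply: oint_norm_le; first exact: cont_sub.
  by rewrite (min_l x12) (max_r x12) => x /CL.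
have X1 : x1 <= x1 <= x2 by rewrite lexx x12.
have X2 : x1 <= x2 <= x2 by rewrite lexx x12.
exact: (limit_arith (CJ x1 X1) (CJ x2 X2) B tM (normr_ge0 _) I).
Qed.

End Limit.
End ColumnLimit.

(** * From Sobolev fields to conservation laws *)

Section WeakFields.
Variable R : realType.
Implicit Types (f g h zeta eta : R -> R) (w A C E F : R * R -> R)
  (x y k e t p q N M d : R).

(** Composition with this retraction onto the closed fluid domain makes a
    function that is continuous there continuous on the plane. *)
Definition clamp d eta (z : R * R) : R * R := (z.1, Num.max (- d) (Num.min z.2 (eta z.1))).

Lemma continuous_pair (T S U : topologicalType) (f : T -> S) (g : T -> U) :
  continuous f -> continuous g -> continuous (fun t : T => (f t, g t)).
Proof. by move=> cf cg t; apply: cvg_pair; [exact: cf|exact: cg]. Qed.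

Lemma cont_clamp d eta : continuous eta -> continuous (clamp d eta).
Proof.
move=> ce.
have ce1 : continuous (fun z : R * R => eta z.1) by apply: cont_comp => //; exact: cont_fst.
have c : continuous (fun z : R * R => Num.max (- d) (Num.min z.2 (eta z.1))).
  move=> z; apply: (@continuous_max _ _ (fun=> - d) (fun z => Num.min z.2 (eta z.1))).
    exact: cst_continuous.
  by apply: (@continuous_min _ _ (fun z => z.2) (fun z => eta z.1)); [exact: cont_snd|exact: ce1].
exact: (continuous_pair (@cont_fst R) c).
Qed.

Lemma clamp_id d eta x y : - d <= y <= eta x -> clamp d eta (x, y) = (x, y).
Proof. by move=> /andP[h1 h2]; rewrite /clamp /= (min_l h2) (max_r h1). Qed.

(** The clamped point may lie on the bed or on the surface; it is approached
    vertically from inside the fluid. *)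
Lemma clamp_closure d eta z : - d < eta z.1 -> closure (fluid d eta) (clamp d eta z).
Proof.
case: z => x y /= dx; rewrite /clamp /=; set Y := Num.max _ _.
have Y1 : - d <= Y by rewrite /Y le_max lexx.
have Y2 : Y <= eta x by rewrite /Y ge_max (ltW dx) ge_min lexx orbT.
move=> B /nbhs_ballP[e /= e0 He].
pose s := Num.min (e / 2) ((eta x + d) / 4).
have s0 : 0 < s by rewrite /s lt_min; apply/andP; split; lra.
have s1 : s <= e / 2 by rewrite /s ge_min lexx.
have s2 : s <= (eta x + d) / 4 by rewrite /s ge_min lexx orbT.
case: (leP Y ((eta x - d) / 2)) => h.
  exists (x, Y + s); split; first by rewrite /fluid /=; split; lra.
  apply: He; split => /=; first exact: ballxx.
  by rewrite /ball/= ltr_norml; apply/andP; split; lra.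
exists (x, Y - s); split; first by rewrite /fluid /=; split; lra.
apply: He; split => /=; first exact: ballxx.
by rewrite /ball/= ltr_norml; apply/andP; split; lra.
Qed.

Lemma continuous_within_comp (S T : topologicalType) (D : set T) (w : T -> R) (g : S -> T) :
  {within D, continuous w} -> continuous g -> (forall z, D (g z)) ->
  continuous (fun z => w (g z)).
Proof.
move=> /subspace_continuousP cw cg Dg z.
apply: cvg_trans (cw _ (Dg z)) => B /= wB.
have h : nbhs (g z) (fun y : T => D y -> B (w y)) by exact: wB.
have h2 : nbhs z (fun s => D (g s) -> B (w (g s))) := cg z _ h.
change (nbhs z (fun s => B (w (g s)))).
by apply: filterS h2 => s; apply; exact: Dg.
Qed.

Lemma fluid_closure_compact d eta N : continuous eta -> (forall x, - d < eta x) ->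
  compact (closure (fluid d eta `&` [set z | `|z.1| < N])).
Proof.
move=> ce de; have [M M0 HM] := @bounded_seg _ eta (- N) N ce.
have K : compact (`[- N, N]%classic `*` `[- d, M]%classic : set (R * R)).
  by apply: compact_setX; exact: segment_compact.
apply: (subclosed_compact _ K); first exact: closed_closure.
have cK : closed (`[- N, N]%classic `*` `[- d, M]%classic : set (R * R)).
  by apply: compact_closed => //; exact: norm_hausdorff.
rewrite [X in _ `<=` X](proj1 (closure_id _) cK); apply: closure_subset.
move=> [x y] [[/= h1 h2]] /ltW; rewrite ler_norml => h3.
split; rewrite /= in_itv//=; have := HM _ h3; rewrite ler_norml => /andP[_ ?].
by apply/andP; split; lra.
Qed.

Lemma open_fluid d eta : continuous eta -> open (fluid d eta).
Proof.
move=> ce.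
have -> : fluid d eta = [set z | 0 < z.2 + d] `&` [set z | 0 < eta z.1 - z.2].
  by apply/seteqP; split => z; rewrite /fluid /= => -[? ?]; split; lra.
have c1 := @cont_fst R; have c2 := @cont_snd R.
apply: openI.
  apply: (@open_comp _ _ (fun z : R * R => z.2 + d) [set y | 0 < y]).
    by move=> z _; apply: cont_add => //; exact: cont_cst.
  exact: open_gt.
apply: (@open_comp _ _ (fun z : R * R => eta z.1 - z.2) [set y | 0 < y]).
  by move=> z _; apply: cont_sub => //; exact: cont_comp.
exact: open_gt.
Qed.

(** On a set of finite measure, [|w| <= 1 + |w|^r]. *)
Lemma Lfun_integrable_plane r (D : set (R * R)) w : 1 <= r -> measurable (D : set (measurableTypeR R * measurableTypeR R)) ->
  (@mu2 R D < +oo)%E -> in_Lr2 r D w ->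
  (@mu2 R).-integrable setT (EFin \o (w \_ D)).
Proof.
move=> r1 mD Dfin Lw.
have mw : measurable_fun setT ((w \_ D) : measurableTypeR R * measurableTypeR R -> R).
  by have := sub_Lfun_mfun Lw; rewrite inE.
have I := Lfun_integrable r1 Lw.
have I1 : (@mu2 R).-integrable setT (EFin \o (\1_D : measurableTypeR R * measurableTypeR R -> R)).
  have : (@mu2 R).-integrable D (EFin \o (fun=> 1 : R)).
    by apply: measurable_bounded_integrable => //; exact: bounded_cst.
  rewrite integrable_mkcond//; apply: eq_integrable => // z _.
  by rewrite /patch /= indicE; case: ifP => _.
have := integrableD measurableT I I1; apply: le_integrable => //.
  exact/measurable_realfun.measurable_EFinP.
move=> z _ /=; rewrite lee_fin (@ger0_norm _ (_ + _)); last first.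
  by rewrite addr_ge0 ?powR_ge0// indicE.
rewrite /patch indicE; case: ifPn => [_|_]; last by rewrite normr0 addr_ge0// powR_ge0.
case: (leP `|w z| 1) => h; first by rewrite (le_trans h)// lerDr powR_ge0.
by rewrite -[leLHS]powRr1// (le_trans (ler_powR (ltW h) r1))// lerDl.
Qed.

(** The support of a test function lies in a bounded part of the fluid; its
    closure is compact, so the local Sobolev hypothesis applies there. *)
Lemma W1r_weak_partial r d eta w wb w1 w2 b : 1 <= r -> continuous eta -> (forall x, - d < eta x) ->
  W1r_loc_closure r (fluid d eta) w w1 w2 ->
  continuous wb -> (forall z, fluid d eta z -> wb z = w z) ->
  weak_partial (fluid d eta) b wb (sel b w1 w2).
Proof.
move=> r1 ce de W cwb wbw.
have key (f f1 f2 : R * R -> R) : C1test (fluid d eta) f f1 f2 -> exists D : set (R * R),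
    [/\ open D, test2 D f, forall z, f z != 0 -> D z,
      forall b1 z, sel b1 f1 f2 z != 0 -> D z &
      (D `<=` fluid d eta) /\ (@mu2 R D < +oo)%E /\ W1r r D w w1 w2].
  move=> T; have [cK KD] := C1t_supp T; have [N N0 HN] := compact_box cK.
  pose D := fluid d eta `&` [set z | `|z.1| < N].
  have oD : open D.
    apply: openI; first exact: open_fluid.
    have -> : [set z : R * R | `|z.1| < N] = (fun z : R * R => N - `|z.1|) @^-1` [set y | 0 < y].
      by apply/seteqP; split => z /=; rewrite subr_gt0.
    apply: (@open_comp _ _ (fun z : R * R => N - `|z.1|) [set y | 0 < y]).
      move=> z _; apply: cont_sub; first exact: cont_cst.
      by apply: cont_comp; [exact: norm_continuous|exact: cont_fst].
    exact: open_gt.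
  have Dsub : closure [set z | f z != 0] `<=` D.
    by move=> z Kz; split; [exact: KD|have [] := HN _ Kz].
  have cD : compact (closure D) by exact: fluid_closure_compact.
  exists D; split => //.
  - by have [t1 t2 t3 _] := C1test_test2 T; split.
  - by move=> z fz; apply: Dsub; exact: subset_closure.
  - by move=> b1 z fz; apply: Dsub; exact: (C1test_outside T fz).
  split; first by move=> z [].
  split; last by apply: W => //; apply: closure_subset => z [].
  have [M M0 HM] := compact_box cD.
  apply: (@bounded_set_fin _ M); first exact: open2_measurable.
  by move=> z Dz; apply: HM; exact: subset_closure.
have INT (f f1 f2 w' : R * R -> R) : C1test (fluid d eta) f f1 f2 ->
    (forall D, W1r r D w w1 w2 -> in_Lr2 r D w') ->
    (@mu2 R).-integrable setT (EFin \o (fun z => w' z * f z)).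
  move=> T Lw'; have [D [oD tD fD sD [DF [Dfin WD]]]] := key _ _ _ T.
  have mD := @open2_measurable R D oD.
  have I := Lfun_integrable_plane r1 mD Dfin (Lw' _ WD).
  have [N N0 [bf bfb]] := C1test_boxed T.
  have cf := C1_cont T.
  have [M M0 HM] := boxed_bounded cf bf.
  have := integrable_bounded_mul I cf HM; apply: eq_integrable => // z _ /=.
  rewrite /patch; case: ifPn => // /negP nD.
  by case: (eqVneq (f z) 0) => [->|/fD Dz]; [rewrite !mulr0|case: nD; rewrite inE].
have RES (D : set (R * R)) (u v : R * R -> R) : (forall z, v z != 0 -> D z) -> (forall z, D z -> u z = v z) ->
    \int[@mu2 R]_(z in D) u z = plane v.
  move=> vD uv; rewrite Rintegral_mkcond /plane; congr (Rintegral _ _ _).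
  apply/funext => z; rewrite /patch; case: ifPn => [|/negP nD]; first by rewrite inE => /uv.
  by apply/esym/eqP; apply: contraT => /vD Dz; case: nD; rewrite inE.
split => // [f f1 f2 T|f f1 f2 T].
  by apply: (INT _ _ _ _ T) => D []; case: (b).
have [D [oD tD fD sD [DF [Dfin WD]]]] := key _ _ _ T.
have h : \int[@mu2 R]_(z in D) (w z * sel b ('D_(e1 R) f) ('D_(e2 R) f) z) =
    - \int[@mu2 R]_(z in D) (sel b w1 w2 z * f z).
  by have [_ _ _ h1 h2] := WD; case: (b); [exact: h1|exact: h2].
rewrite (C1_D1 T) (C1_D2 T) in h.
rewrite (RES D _ (fun z => wb z * sel b f1 f2 z)) in h; last 2 first.
- by move=> z; rewrite mulf_eq0 negb_or => /andP[_ /(sD b)].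
- by move=> z /DF/wbw ->.
rewrite (RES D _ (fun z => sel b w1 w2 z * f z)) in h => // z.
by rewrite mulf_eq0 negb_or => /andP[_ /fD].
Qed.

Lemma weak_conserved D A A' C C' E :
  weak_partial D true A A' -> weak_partial D false C C' -> continuous E ->
  {ae @mu2 R, forall z, D z -> A' z + C' z = E z} ->
  conserved D A C E.
Proof.
move=> [cA iA eA] [cC iC eC] cE ae; split => // f f1 f2 T.
have [N N0 [bf bfb]] := C1test_boxed T.
have cf := C1_cont T; have c1 := C1_cont1 T; have c2 := C1_cont2 T.
have b1 : boxed N f1 := bfb true; have b2 : boxed N f2 := bfb false.
have iE : (@mu2 R).-integrable setT (EFin \o (fun z => E z * f z)).
  by apply: (@boxed_integrable _ N); [exact: cont_mul|exact: boxedMr].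
have I1 := iA _ _ _ T; have I2 := iC _ _ _ T.
rewrite (@planeD _ N (fun z => A z * f1 z + C z * f2 z) (fun z => E z * f z)); last 4 first.
- by apply: cont_add; apply: cont_mul.
- exact: cont_mul.
- by apply: boxedD; exact: boxedMr.
- exact: boxedMr.
rewrite (@planeD _ N (fun z => A z * f1 z) (fun z => C z * f2 z)); last 4 first.
- exact: cont_mul.
- exact: cont_mul.
- exact: boxedMr.
- exact: boxedMr.
rewrite (eA _ _ _ T) (eC _ _ _ T).
have I12 := integrableD measurableT I1 I2.
have : plane (fun z => E z * f z) = plane (fun z => A' z * f z + C' z * f z).
  rewrite /plane /Rintegral; congr fine; apply: ae_eq_integral => //.
  - exact: measurable_int iE.
  - exact: measurable_int I12.
  have [Z [mZ Z0 subZ]] := ae; exists Z; split => // z /= nz.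
  apply: subZ => /= Dz; apply: nz => _ /=; congr EFin.
  case: (eqVneq (f z) 0) => [->|fz]; first by rewrite !mulr0 addr0.
  rewrite -Dz ?mulrDl//.
  by apply: (C1t_supp T).2; exact: subset_closure.
by rewrite /plane RintegralD// => ->; ring.
Qed.

End WeakFields.

(** * Steady flows with a continuous velocity *)

Section SteadyFlow.
Variable R : realType.

Definition bernoulli (g : R) (q v P : R * R -> R) (z : R * R) :=
  P z + (q z ^+ 2 + v z ^+ 2) / 2 + g * z.2.

(** The flow in the frame of the wave: [q] is the horizontal velocity relative to
    the wave, [W] the limit of [- q] at infinity. All the fields are extended
    continuously to the plane, and the Euler equations appear as the
    conservation of mass, momentum and energy. *)
Record steady_flow (g d delta : R) (eta eta' : R -> R) (q v P : R * R -> R) (W : R -> R) : Prop := {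
  sf_g : 0 < g;
  sf_d : 0 < d;
  sf_delta : 0 < delta;
  sf_eta : deriv_of eta eta';
  sf_eta' : continuous eta';
  sf_eta_ge0 : forall x, 0 <= eta x;
  sf_eta_lim : forall e, 0 < e -> exists X, forall x, X <= `|x| -> `|eta x| <= e;
  sf_q_le : forall z, q z <= - delta;
  sf_W_ge : forall y, delta <= W y;
  sf_W : continuous W;
  sf_mass : conserved (fluid d eta) q v (fun=> 0);
  sf_momx : conserved (fluid d eta) (fun z => P z + q z ^+ 2) (fun z => q z * v z) (fun=> 0);
  sf_momy : conserved (fluid d eta) (fun z => q z * v z) (fun z => v z ^+ 2 + P z) (fun=> - g);
  sf_bern : conserved (fluid d eta) (fun z => bernoulli g q v P z * q z)
     (fun z => bernoulli g q v P z * v z) (fun=> 0);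
  sf_P : continuous P;
  sf_bottom : forall x, v (x, - d) = 0;
  sf_kinematic : forall x, v (x, eta x) = q (x, eta x) * eta' x;
  sf_dynamic : forall x, P (x, eta x) = 0;
  sf_v_lim : forall e, 0 < e -> exists X, forall x y, X <= `|x| -> - d <= y <= eta x ->
     `|v (x, y)| <= e;
  sf_q_lim : forall e, 0 < e -> exists X, forall x y, X <= `|x| -> - d <= y <= eta x ->
     `|q (x, y) + W y| <= e }.

Section Limits.
Variables (g d delta : R) (eta eta' : R -> R) (q v P : R * R -> R) (W : R -> R).
Hypothesis S : steady_flow g d delta eta eta' q v P W.
Implicit Types (x y e X k l M : R) (f h : R * R -> R) (a b phi J : R -> R).

Let ceta : continuous eta := is_derive_continuous (sf_eta S).
Lemma flow_cont_q : continuous q. Proof. exact: cons_A (sf_mass S). Qed.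
Lemma flow_cont_v : continuous v. Proof. exact: cons_C (sf_mass S). Qed.

Lemma flow_depth x : - d < eta x.
Proof. by have := sf_eta_ge0 S x; have := sf_d S; lra. Qed.

Definition lim_infty phi l := forall e, 0 < e -> exists X, forall x, X <= `|x| -> `|phi x - l| <= e.

Definition ulim_infty f a := forall e, 0 < e -> exists X, forall x y,
  X <= `|x| -> - d <= y <= eta x -> `|f (x, y) - a y| <= e.

Lemma eta_le1 : exists X, forall x, X <= `|x| -> eta x <= 1.
Proof.
have [X HX] := sf_eta_lim S ltr01; exists X => x /HX.
by rewrite ler_norml => /andP[].
Qed.

Lemma ulim_v : ulim_infty v (fun=> 0).
Proof.
move=> e /(sf_v_lim S)[X HX]; exists X => x y h1 h2; rewrite subr0; exact: HX.
Qed.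

Lemma ulim_q : ulim_infty q (fun y => - W y).
Proof.
move=> e /(sf_q_lim S)[X HX]; exists X => x y h1 h2; rewrite opprK; exact: HX.
Qed.

Lemma ulimD f h a b : ulim_infty f a -> ulim_infty h b ->
  ulim_infty (fun z => f z + h z) (fun y => a y + b y).
Proof.
move=> Hf Hh e e0; have e2 : 0 < e / 2 by lra.
have [X1 H1] := Hf _ e2; have [X2 H2] := Hh _ e2.
exists (Num.max X1 X2) => x y; rewrite ge_max => /andP[h1 h2] hy.
have := H1 x y h1 hy; have := H2 x y h2 hy; rewrite !ler_norml.
by move=> /andP[? ?] /andP[? ?]; apply/andP; split; lra.
Qed.

Lemma ulimM f h a b : continuous a -> continuous b ->
  ulim_infty f a -> ulim_infty h b ->
  ulim_infty (fun z => f z * h z) (fun y => a y * b y).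
Proof.
move=> ca cb Hf Hh e e0.
have [Ma Ma0 HMa] := @bounded_seg _ a (- d) 1 ca.
have [Mb Mb0 HMb] := @bounded_seg _ b (- d) 1 cb.
pose r := Num.min 1 (e / (Ma + Mb + 1)).
have K0 : 0 < Ma + Mb + 1 by lra.
have r0 : 0 < r by rewrite lt_min ltr01 divr_gt0.
have r1 : r <= 1 by rewrite ge_min lexx.
have rK : r * (Ma + Mb + 1) <= e by rewrite -ler_pdivlMr// ge_min lexx orbT.
have [X0 H0] := eta_le1; have [X1 H1] := Hf _ r0; have [X2 H2] := Hh _ r0.
exists (Num.max X0 (Num.max X1 X2)) => x y; rewrite !ge_max => /and3P[h0 h1 h2] hy.
have y1 : - d <= y <= 1.
  by move: hy => /andP[-> hh] /=; exact: le_trans hh (H0 _ h0).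
have A1 := H1 x y h1 hy; have A2 := H2 x y h2 hy.
have B1 := HMa y y1; have B2 := HMb y y1.
have -> : f (x, y) * h (x, y) - a y * b y =
   (f (x, y) - a y) * (h (x, y) - b y) + (f (x, y) - a y) * b y + a y * (h (x, y) - b y) by ring.
have C1 : `|(f (x, y) - a y) * (h (x, y) - b y)| <= r * 1.
  by rewrite normrM; apply: ler_pM => //; exact: le_trans A2 r1.
have C2 : `|(f (x, y) - a y) * b y| <= r * Mb by rewrite normrM; exact: ler_pM.
have C3 : `|a y * (h (x, y) - b y)| <= Ma * r by rewrite normrM; exact: ler_pM.
apply: (le_trans (ler_normD _ _)); apply: (le_trans (lerD (ler_normD _ _) (lexx _))).
move: C1 C2 C3 rK; lra.
Qed.

Lemma ulim_comp f a (k : R -> R) : continuous a -> continuous k ->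
  ulim_infty f a -> ulim_infty (fun z => k (f z)) (fun y => k (a y)).
Proof.
move=> ca ck Hf e e0.
have [M M0 HM] := @bounded_seg _ a (- d) 1 ca.
have cF : continuous (fun z : R * R => k (z.2 + z.1)).
  by apply: cont_comp => //; apply: cont_add; [exact: cont_snd|exact: cont_fst].
have /nbhs_ballP[r /= r0 Hr] := @tube _ _ _ (- M) M 0 e cF e0.
have r2 : 0 < r / 2 by lra.
have [X0 H0] := eta_le1; have [X1 H1] := Hf _ r2.
exists (Num.max X0 X1) => x y; rewrite !ge_max => /andP[h0 h1] hy.
have y1 : - d <= y <= 1.
  by move: hy => /andP[-> h] /=; exact: le_trans h (H0 _ h0).
have := Hr (f (x, y) - a y) _ (a y).
have -> : a y + (f (x, y) - a y) = f (x, y) by ring.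
rewrite addr0 => H; apply/ltW/H; last by rewrite -ler_norml; exact: HM.
rewrite /ball/= sub0r normrN; apply: (le_lt_trans (H1 x y h1 hy)); lra.
Qed.

Lemma lim_column f a : continuous f -> continuous a -> ulim_infty f a ->
  lim_infty (fun x => oint (- d) (eta x) (fun y => f (x, y))) (oint (- d) 0 a).
Proof.
move=> cf ca Hf e e0; have d0 := sf_d S.
have [M M0 HM] := @bounded_seg _ a (- d) 1 ca.
pose r := e / (2 * (d + 1)).
pose s := Num.min 1 (e / (2 * (M + 1))).
have r0 : 0 < r by rewrite divr_gt0//; lra.
have s0 : 0 < s by rewrite lt_min ltr01 divr_gt0//; lra.
have s1 : s <= 1 by rewrite ge_min lexx.
have [X0 H0] := sf_eta_lim S s0; have [X1 H1] := Hf _ r0.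
exists (Num.max X0 X1) => x; rewrite !ge_max => /andP[h0 h1].
have eta0 := sf_eta_ge0 S x.
have es : eta x <= s by have := H0 x h0; rewrite ler_norml => /andP[].
have cs : continuous (fun y => f (x, y)) by exact: cont_slice2.
have -> : oint (- d) (eta x) (fun y => f (x, y)) - oint (- d) 0 a =
   oint (- d) (eta x) (fun y => f (x, y) - a y) + oint 0 (eta x) a.
  by rewrite ointB// (oint_chasles 0 (- d) (eta x) a); ring.
have de : - d <= eta x by lra.
have A1 : `|oint (- d) (eta x) (fun y => f (x, y) - a y)| <= r * `|eta x - - d|.
  apply: oint_norm_le; first exact: cont_sub.
  by rewrite (min_l de) (max_r de) => y hy; exact: H1.
have A2 : `|oint 0 (eta x) a| <= M * `|eta x - 0|.
  apply: oint_norm_le => //.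
  rewrite (min_l eta0) (max_r eta0) => y /andP[? ?]; apply: HM.
  by apply/andP; split; lra.
apply: (le_trans (ler_normD _ _)); apply: (le_trans (lerD A1 A2)).
rewrite opprK subr0 (ger0_norm (_ : 0 <= eta x + d)) ?(ger0_norm eta0)//; last by lra.
have B1 : r * (eta x + d) <= e / 2.
  have : r * (eta x + d) <= r * (d + 1) by rewrite ler_pM2l//; lra.
  move=> /le_trans; apply; rewrite /r.
  by rewrite le_eqVlt; apply/orP; left; apply/eqP; field; lra.
have B2 : M * eta x <= e / 2.
  have se : s <= e / (2 * (M + 1)) by rewrite ge_min lexx orbT.
  have : M * eta x <= M * (e / (2 * (M + 1))) by rewrite ler_wpM2l// (le_trans es).
  move=> /le_trans; apply.
  rewrite mulrA ler_pdivrMr; last by lra.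
  have -> : e / 2 * (2 * (M + 1)) = M * e + e by field.
  by rewrite lerDl ltW.
lra.
Qed.

Lemma lim_unique phi l l' : lim_infty phi l -> lim_infty phi l' -> l = l'.
Proof.
move=> H H'; apply/eqP; rewrite -subr_eq0; apply/eqP/(@small_eq0 _ _ 2) => // e e0.
have [X HX] := H _ e0; have [X' HX'] := H' _ e0.
pose x := Num.max X X'.
have := HX `|x| _; have := HX' `|x| _; rewrite normr_id.
have h : X <= `|x| /\ X' <= `|x|.
  by split; rewrite (le_trans _ (ler_norm _))// le_max lexx ?orbT.
move=> /(_ h.2) A /(_ h.1); move: A; rewrite !ler_norml.
by move=> /andP[? ?] /andP[? ?]; apply/andP; split; lra.
Qed.

(** Averaging over [X, X + 1] removes the part of a constant column integral
    that is only known to be the derivative of a quantity tending to 0. *)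
Lemma const_by_average (K l : R) (N Q J : R -> R) : continuous N -> continuous Q ->
  (forall x, K = N x + Q x) ->
  (forall x1 x2, x1 <= x2 -> J x2 - J x1 = oint x1 x2 N) ->
  lim_infty J 0 -> lim_infty Q l -> K = l.
Proof.
move=> cN cQ KE JN J0 Ql.
apply/eqP; rewrite -subr_eq0; apply/eqP/(@small_eq0 _ _ 3) => // e e0.
have [X1 H1] := J0 _ e0; have [X2 H2] := Ql _ e0.
pose X := Num.max 0 (Num.max X1 X2).
have [h0 h1 h2] : [/\ 0 <= X, X1 <= X & X2 <= X].
  by split; rewrite !le_max lexx ?orbT.
have XX : X <= X + 1 by lra.
have E : K = oint X (X + 1) N + oint X (X + 1) Q.
  rewrite -ointD//.
  have -> : (fun x => N x + Q x) = (fun=> K) by apply/funext => x.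
  by rewrite oint_cst addrAC subrr add0r mulr1.
have B : `|oint X (X + 1) (fun x => Q x - l)| <= e * `|X + 1 - X|.
  apply: oint_norm_le; first by apply: cont_sub => //; exact: cont_cst.
  rewrite (min_l XX) (max_r XX) => x /andP[Xx _]; apply: H2.
  by rewrite ger0_norm; lra.
rewrite ointB in B; [|by []|exact: cont_cst].
have X11 : X + 1 - X = 1 by ring.
rewrite oint_cst X11 normr1 !mulr1 in B.
have A1 := H1 X; have A2 := H1 (X + 1).
rewrite ger0_norm// subr0 in A1; rewrite ger0_norm ?subr0 in A2; last by lra.
have {}A1 := A1 h1; have {}A2 : `|J (X + 1)| <= e by apply: A2; lra.
rewrite -(JN _ _ XX) in E.
move: A1 A2 B E; move: (oint X (X + 1) Q) (J X) (J (X + 1)) => I j1 j2.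
rewrite !ler_norml => /andP[? ?] /andP[? ?] /andP[? ?] ?.
by apply/andP; split; lra.
Qed.

(** ** The stream function *)

Definition stream (z : R * R) := oint (- d) z.2 (fun t => - q (z.1, t)).
Definition far_stream y := oint (- d) y W.

Lemma cont_stream : continuous stream.
Proof.
apply: (@continuous_oint2 _ _ _ (fun z => - q z)).
- exact/cont_opp/flow_cont_q.
- exact: cont_fst.
- exact: cont_cst.
- exact: cont_snd.
Qed.

Lemma stream_bottom x : stream (x, - d) = 0.
Proof. by rewrite /stream oint_xx. Qed.

Lemma stream_derive2 x y : is_derive y 1 (fun t => stream (x, t)) (- q (x, y)).
Proof.
apply: (@is_derive_oint _ (- d) y (fun t => - q (x, t))).
exact/cont_opp/cont_slice2/flow_cont_q.
Qed.

Lemma far_stream_derive : deriv_of far_stream W.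
Proof. by move=> y; apply: is_derive_oint; exact: sf_W S. Qed.

Lemma cont_far_stream : continuous far_stream.
Proof. exact: is_derive_continuous far_stream_derive. Qed.

(** The mass balance below the height [y]. It makes [v] the horizontal derivative
    of the stream function although [q] is merely continuous. *)
Lemma stream_rectangle x1 x2 y : x1 <= x2 -> - d < y ->
  (forall x, x1 <= x <= x2 -> y < eta x) ->
  stream (x2, y) - stream (x1, y) = oint x1 x2 (fun x => v (x, y)).
Proof.
move=> x12 dy ye.
have cd : continuous (fun x => eta x - y) by apply: cont_sub => //; exact: cont_cst.
have near x0 : x1 <= x0 <= x2 -> exists2 r, 0 < r & forall x, `|x - x0| < r -> y < eta x.
  move=> /ye h; have : \forall x \near x0, 0 < eta x - y.
    by apply: (cvgr_gt _ (cd x0)); rewrite subr_gt0.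
  move=> /nbhs_ballP[r /= r0 Hr]; exists r => // x hx.
  by have := Hr x; rewrite /ball/= distrC subr_gt0; exact.
have [r1 r10 H1] := near x1 ltac:(by rewrite lexx x12).
have [r2 r20 H2] := near x2 ltac:(by rewrite lexx x12).
have ze x : x1 - r1 < x < x2 + r2 -> y <= eta x.
  move=> /andP[h1 h2]; apply: ltW; case: (leP x1 x) => [h3|h3]; last first.
    by apply: H1; rewrite ltr_norml; apply/andP; split; lra.
  case: (leP x x2) => [h4|h4]; first by apply: ye; rewrite h3.
  by apply: H2; rewrite ltr_norml; apply/andP; split; lra.
have c1 : continuous (fun _ : R * R => 1 : R) by exact: cont_cst.
have c0 : continuous (fun _ : R * R => 0 : R) by exact: cont_cst.
have c0' : continuous (fun _ : R => 0 : R) by exact: cont_cst.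
have dc : deriv_of (fun _ : R => y) (fun=> 0) by move=> x; exact: der1_cst.
have p1 : partials_on (fluid d eta) (fun=> 1) (fun=> 0) (fun=> 0).
  by move=> x t _; split; exact: der1_cst.
have := column_identity (sf_mass S) dc c0' (fun=> dy) ze c1 c0 c0 p1 _ x12 _ => /=.
have -> : x1 - r1 < x1 by lra.
have -> : x2 < x2 + r2 by lra.
move=> /(_ isT isT).
have cq x : continuous (fun t => q (x, t)) by exact/cont_slice2/flow_cont_q.
have E x : oint (- d) y (fun t => q (x, t) * 1) = - stream (x, y).
  rewrite /stream /= ointN// opprK; congr (oint _ _ _).
  by apply/funext => t; rewrite mulr1.
rewrite !E.
have -> : (fun x => oint (- d) y (fun t => q (x, t) * 0 + v (x, t) * 0 + 0 * 1) +
    1 * (q (x, y) * 0 - v (x, y)) + 1 * v (x, - d)) = (fun x => - v (x, y)).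
  apply/funext => x; rewrite (sf_bottom S).
  rewrite (_ : (fun t => _) = (fun=> 0)); last by apply/funext => t; ring.
  by rewrite oint_cst; ring.
rewrite ointN; last exact/cont_slice1/flow_cont_v.
by move=> H; apply: oppr_inj; rewrite -H; ring.
Qed.

Lemma stream_derive1 x y : fluid d eta (x, y) ->
  is_derive x 1 (fun s => stream (s, y)) (v (x, y)).
Proof.
move=> [/= dy ye].
have cd : continuous (fun x => eta x - y) by apply: cont_sub => //; exact: cont_cst.
have : \forall s \near x, 0 < eta s - y.
  by apply: (cvgr_gt _ (cd x)); rewrite subr_gt0.
move=> /nbhs_ballP[r /= r0 Hr].
have He s : `|s - x| < r -> y < eta s.
  by move=> h; have := Hr s; rewrite /ball/= distrC subr_gt0; exact.
have cv : continuous (fun s => v (s, y)) by exact/cont_slice1/flow_cont_v.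
apply: (@der1_near _ (fun s => stream (x, y) + oint x s (fun s => v (s, y)))); last first.
  apply: (der1_eq (a := 0 + v (x, y))); last by ring.
  exact: (der1_add (der1_cst x (stream (x, y))) (@is_derive_oint _ x x _ cv)).
exists r => //= s; rewrite /ball/= distrC => hs.
case: (leP x s) => xs.
  rewrite -(@stream_rectangle x s y)//; first by ring.
  move=> t /andP[? ?]; apply: He; move: hs; rewrite !ltr_norml => /andP[? ?].
  by apply/andP; split; lra.
rewrite oint_sym -(@stream_rectangle s x y)//; [by ring|exact: ltW|].
move=> t /andP[? ?]; apply: He; move: hs; rewrite !ltr_norml => /andP[? ?].
by apply/andP; split; lra.
Qed.

End Limits.
End SteadyFlow.

(** * Integrals over fluid columns *)

Section Columns.
Variable R : realType.
Variables (g d delta : R) (eta eta' : R -> R) (q v P : R * R -> R) (W : R -> R).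
Hypothesis S : steady_flow g d delta eta eta' q v P W.
Implicit Types (x y e X l M : R) (f h : R * R -> R) (a b phi J k K : R -> R).

Let ceta : continuous eta := is_derive_continuous (sf_eta S).
Let cq : continuous q := flow_cont_q S.
Let cv : continuous v := flow_cont_v S.
Let cP : continuous P := sf_P S.
Let cW : continuous W := sf_W S.
Notation psi := (stream d q).
Notation far := (far_stream d W).
Let cpsi : continuous psi := cont_stream S.
Let cfar : continuous far := cont_far_stream S.
Let cy : continuous (fun z : R * R => z.2) := @cont_snd R.
Let ccst (k0 : R) : continuous (fun _ : R * R => k0 : R) := @cont_cst R _ k0.

Definition column f x := oint (- d) (eta x) (fun y => f (x, y)).

Lemma cont_column f : continuous f -> continuous (column f).
Proof.
by move=> cf; apply: (continuous_oint2 cf) => //; [exact: cont_id|exact: cont_cst].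
Qed.

Lemma columnD f h x : continuous f -> continuous h ->
  column (fun z => f z + h z) x = column f x + column h x.
Proof. by move=> cf ch; rewrite /column ointD//; exact: cont_slice2. Qed.

Lemma columnZ (c : R) f x : continuous f ->
  column (fun z => c * f z) x = c * column f x.
Proof. by move=> cf; rewrite /column ointZ//; exact: cont_slice2. Qed.

(** [column_identity] up to the free surface, for weights with no boundary flux. *)
Lemma flow_column A C E m m1 m2 : conserved (fluid d eta) A C E ->
  continuous m -> continuous m1 -> continuous m2 ->
  partials_on (fluid d eta) m m1 m2 ->
  (forall x, m (x, eta x) * (A (x, eta x) * eta' x - C (x, eta x)) = 0) ->
  (forall x, m (x, - d) * C (x, - d) = 0) ->
  forall x1 x2, x1 <= x2 ->
  column (fun z => A z * m z) x2 - column (fun z => A z * m z) x1 =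
  oint x1 x2 (column (fun z => A z * m1 z + C z * m2 z + E z * m z)).
Proof.
move=> cons cm cm1 cm2 dm top bot x1 x2 x12.
have -> : column (fun z => A z * m1 z + C z * m2 z + E z * m z) =
  (fun x => oint (- d) (eta x) (fun y => A (x, y) * m1 (x, y) + C (x, y) * m2 (x, y) + E (x, y) * m (x, y)) +
     m (x, eta x) * (A (x, eta x) * eta' x - C (x, eta x)) + m (x, - d) * C (x, - d)).
  by apply/funext => x; rewrite top bot !addr0.
apply: (column_identity cons (sf_eta S) (sf_eta' S) (flow_depth S) _ cm cm1 cm2 dm
  (a := x1 - 1) (b := x2 + 1)) => //.
- by rewrite ltrBlDr ltrDl.
- by rewrite ltrDl.
Qed.

Lemma kinematic x : q (x, eta x) * eta' x - v (x, eta x) = 0.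
Proof. by rewrite (sf_kinematic S) subrr. Qed.

Lemma stream_weight k k' : deriv_of k k' -> partials_on (fluid d eta)
  (fun z => k (psi z)) (fun z => k' (psi z) * v z) (fun z => k' (psi z) * - q z).
Proof.
move=> dk x y xy; split.
- exact: (@der1_comp _ k (fun s => psi (s, y)) x _ _ (dk _) (stream_derive1 S xy)).
- exact: (@der1_comp _ k (fun t => psi (x, t)) y _ _ (dk _) (stream_derive2 S x y)).
Qed.

Lemma stream_surface_const x1 x2 : x1 <= x2 -> psi (x1, eta x1) = psi (x2, eta x2).
Proof.
move=> x12.
have c1 : continuous (fun _ : R * R => 1 : R) by exact: ccst.
have c0 : continuous (fun _ : R * R => 0 : R) by exact: ccst.
have p1 : partials_on (fluid d eta) (fun=> 1 : R) (fun=> 0) (fun=> 0).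
  by move=> x t _; split; exact: der1_cst.
have := flow_column (sf_mass S) c1 c0 c0 p1 _ _ x12.
have E x : column (fun z => q z * 1) x = - psi (x, eta x).
  rewrite /column /stream /= ointN; last exact: cont_slice2.
  by rewrite opprK; congr (oint _ _ _); apply/funext => t; rewrite mulr1.
rewrite !E.
have -> : column (fun z => q z * 0 + v z * 0 + 0 * 1) = (fun=> 0).
  apply/funext => x; rewrite /column (_ : (fun t => _) = (fun=> 0)).
    by rewrite oint_cst mul0r.
  by apply/funext => t; ring.
rewrite oint_cst mul0r => /(_ _ _) H.
apply/eqP; rewrite -subr_eq0 -H.
- by apply/eqP; ring.
- by move=> x; rewrite kinematic mulr0.
- by move=> x; rewrite (sf_bottom S) mulr0.
Qed.

Lemma ulim_stream : ulim_infty d eta psi far.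
Proof.
move=> e e0; have d0 := sf_d S.
have r0 : 0 < e / (d + 1) by rewrite divr_gt0//; lra.
have [X0 H0] := eta_le1 S; have [X1 H1] := sf_q_lim S r0.
exists (Num.max X0 X1) => x y; rewrite ge_max => /andP[h0 h1] /andP[y0 y1].
have ye := H0 x h0.
have cqs : continuous (fun t => - q (x, t)) by exact/cont_opp/cont_slice2.
rewrite /stream /far_stream /= -ointB//.
apply: (@le_trans _ _ (e / (d + 1) * `|y - - d|)).
  apply: oint_norm_le; first exact: cont_sub.
  rewrite (min_l y0) (max_r y0) => t /andP[t0 t1].
  rewrite -opprD normrN; apply: H1 => //.
  by rewrite t0 (le_trans t1 y1).
rewrite ger0_norm; last by lra.
rewrite mulrAC ler_pdivrMr; last by lra.
by rewrite ler_pM2l//; lra.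
Qed.

Lemma surface_stream_lim : lim_infty (fun x => psi (x, eta x)) (far 0).
Proof.
have := lim_column S (f := fun z => - q z) (a := W).
apply => //; first exact: cont_opp.
move=> e /(sf_q_lim S)[X HX]; exists X => x y h1 h2.
by rewrite -opprD normrN; exact: HX.
Qed.

(** The surface is a streamline because no mass crosses it; its label is read off
    at infinity. *)
Lemma stream_surface x : psi (x, eta x) = far 0.
Proof.
apply: (lim_unique _ surface_stream_lim) => e e0; exists 0 => t _.
have -> : psi (t, eta t) = psi (x, eta x).
  by case: (leP x t) => [/stream_surface_const ->//|/ltW/stream_surface_const ->].
by rewrite subrr normr0 ltW.
Qed.

Lemma stream_lt x y1 y2 : y1 < y2 -> psi (x, y1) < psi (x, y2).
Proof.
move=> y12; rewrite -subr_gt0 /stream /=.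
have -> : oint (- d) y2 (fun t => - q (x, t)) - oint (- d) y1 (fun t => - q (x, t)) =
  oint y1 y2 (fun t => - q (x, t)).
  by rewrite (oint_chasles y1 (- d) y2); ring.
have qn t : 0 < - q (x, t).
  by have := sf_q_le S (x, t); have := sf_delta S; lra.
apply: (@oint_gt0 _ y1 y2 _ y1) => //.
- exact/cont_opp/cont_slice2.
- by move=> t _; exact: ltW.
- by rewrite lexx ltW.
Qed.

(** A streamline is labelled by its height at infinity. *)
Lemma far_height : exists2 s : R -> R, continuous s & forall y, s (far y) = y.
Proof.
have dl := sf_delta S.
have slope y1 y2 : y1 <= y2 -> delta * (y2 - y1) <= far y2 - far y1.
  move=> y12.
  have -> : far y2 - far y1 = oint y1 y2 W.
    by rewrite /far_stream (oint_chasles y1 (- d) y2); ring.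
  rewrite -oint_cst; apply: le_oint => //; first exact: cont_cst.
  by move=> y _; exact: sf_W_ge S y.
have surj t : exists y, far y = t.
  pose r := `|t| / delta.
  have r0 : 0 <= r by rewrite divr_ge0// ltW.
  have dr : delta * r = `|t| by rewrite mulrC divfK// gt_eqF.
  have f0 : far (- d) = 0 by rewrite /far_stream oint_xx.
  have h1 := slope (- d - r) (- d) ltac:(lra).
  have h2 := slope (- d) (- d + r) ltac:(lra).
  have e1 : - d - (- d - r) = r by ring.
  have e2 : - d + r - - d = r by ring.
  rewrite e1 dr f0 sub0r in h1; rewrite e2 dr f0 subr0 in h2.
  have ab : - d - r <= - d + r by lra.
  have t1 := ler_norm t; have t2 := ler_norm (- t); rewrite normrN in t2.
  have [|y _ <-] := @IVT _ far _ _ t ab (continuous_subspaceT cfar); last by exists y.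
  by rewrite ge_min le_max; apply/andP; split; apply/orP; [left|right]; lra.
have [s Hs] := choice surj.
exists s; last first.
  move=> y; have E := Hs (far y).
  case: (ltgtP (s (far y)) y) => // h.
    have := slope _ _ (ltW h); rewrite E subrr leNgt => /negP; case.
    by rewrite mulr_gt0// subr_gt0.
  have := slope _ _ (ltW h); rewrite E subrr leNgt => /negP; case.
  by rewrite mulr_gt0// subr_gt0.
have lip t t' : `|s t - s t'| <= `|t - t'| / delta.
  rewrite ler_pdivlMr// mulrC.
  case: (leP (s t) (s t')) => h.
    have := slope _ _ h; rewrite !Hs => h'.
    rewrite distrC ger0_norm ?subr_ge0// distrC.
    exact: le_trans h' (ler_norm _).
  have := slope _ _ (ltW h); rewrite !Hs => h'.
  rewrite ger0_norm; last by rewrite subr_ge0 ltW.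
  exact: le_trans h' (ler_norm _).
move=> t; apply/cvgrPdist_lt => e e0.
have /nbhs_ballP : \forall x \near t, ball t (e * delta) x.
  by apply: nbhsx_ballx; rewrite mulr_gt0.
case=> r /= r0 Hr; apply/nbhs_ballP; exists r => // t' /Hr.
rewrite /ball/= => h; apply: (le_lt_trans (lip _ _)).
by rewrite ltr_pdivrMr.
Qed.

(** ** Vertical momentum, weighted by [c (y + d) + K psi] *)

Definition weight (c : R) K (z : R * R) := c * (z.2 + d) + K (psi z).

Lemma cont_weight c K : continuous K -> continuous (weight c K).
Proof.
move=> cK; apply: cont_add; last exact: cont_comp.
by apply: cont_mul => //; exact: cont_add.
Qed.

(** The weight vanishes on the bed, and on the surface the flux of vertical
    momentum vanishes by the kinematic and dynamic conditions. *)
Lemma vertical_column c K k : deriv_of K k -> continuous k -> K 0 = 0 ->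
  forall x1 x2, x1 <= x2 ->
  column (fun z => q z * v z * weight c K z) x2 -
  column (fun z => q z * v z * weight c K z) x1 =
  oint x1 x2 (column (fun z => c * (v z ^+ 2 + P z) - P z * q z * k (psi z) - g * weight c K z)).
Proof.
move=> dK ck K0 x1 x2 x12; have cK := is_derive_continuous dK.
have ckp : continuous (fun z => k (psi z)) by exact: cont_comp.
have c1 : continuous (fun z => k (psi z) * v z) by exact: cont_mul.
have c2 : continuous (fun z => c + k (psi z) * - q z).
  by apply: cont_add => //; apply: cont_mul => //; exact: cont_opp.
have pw : partials_on (fluid d eta) (weight c K) (fun z => k (psi z) * v z)
    (fun z => c + k (psi z) * - q z).
  move=> x y xy; have [p1 p2] := stream_weight dK xy; split.
    apply: (der1_eq (a := 0 + k (psi (x, y)) * v (x, y))); last by ring.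
    exact: (der1_add (der1_cst x (c * (y + d))) p1).
  apply: (der1_eq (a := (0 * (y + d) + c * (1 + 0)) + k (psi (x, y)) * - q (x, y))); last by ring.
  exact: (der1_add (der1_mul (der1_cst y c) (der1_add (der1_id y) (der1_cst y d))) p2).
rewrite (flow_column (sf_momy S) (@cont_weight c K cK) c1 c2 pw _ _ x12).
- congr (oint _ _ _); apply/funext => x; rewrite /column; congr (oint _ _ _).
  by apply/funext => y; ring.
- move=> x; rewrite (sf_dynamic S) (sf_kinematic S); ring.
- by move=> x; rewrite /weight /= addNr mulr0 add0r stream_bottom K0 mul0r.
Qed.

Lemma vertical_flux_lim c K : continuous K ->
  lim_infty (column (fun z => q z * v z * weight c K z)) 0.
Proof.
move=> cK.
have cw : continuous (fun y => c * (y + d) + K (far y)).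
  apply: cont_add; last exact: cont_comp.
  by apply: cont_mul; [exact: cont_cst|apply: cont_add; [exact: cont_id|exact: cont_cst]].
have cz : continuous (fun _ : R => 0 : R) by exact: cont_cst.
have cnW : continuous (fun y => - W y) by exact: cont_opp.
have H : ulim_infty d eta (fun z => q z * v z * weight c K z)
    (fun y => - W y * 0 * (c * (y + d) + K (far y))).
  apply: (ulimM S) => //; first exact: cont_mul.
    by apply: (ulimM S) => //; [exact: ulim_q S|exact: ulim_v S].
  apply: (ulimD (f := fun z => c * (z.2 + d)) (h := fun z => K (psi z))
    (a := fun y => c * (y + d)) (b := fun y => K (far y))).
    by move=> e e0; exists 0 => x y _ _ /=; rewrite subrr normr0 ltW.
  by apply: (ulim_comp S) => //; exact: ulim_stream.
have E : (fun y => - W y * 0 * (c * (y + d) + K (far y))) = (fun=> 0).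
  by apply/funext => y; rewrite mulr0 mul0r.
rewrite E in H.
have := lim_column S _ cz H; rewrite oint_cst mul0r; apply.
by apply: cont_mul; [exact: cont_mul|exact: cont_weight].
Qed.

Lemma column_stream k x : continuous k ->
  column (fun z => k (psi z) * - q z) x = oint 0 (far 0) k.
Proof.
move=> ck; rewrite /column.
rewrite (@oint_comp _ (- d) (eta x) k (fun y => psi (x, y)) (fun y => - q (x, y)))//.
- by rewrite stream_bottom stream_surface.
- exact/cont_opp/cont_slice2.
- by move=> y; exact: stream_derive2 S x y.
Qed.

Lemma far_integral k : continuous k ->
  oint (- d) 0 (fun y => k (far y) * W y) = oint 0 (far 0) k.
Proof.
move=> ck; rewrite (@oint_comp _ (- d) 0 k far W)//; last exact: far_stream_derive S.
by rewrite {1}/far_stream oint_xx.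
Qed.

End Columns.

(** * Bernoulli's law and the flow force *)

Section BernoulliLaw.
Variable R : realType.
Variables (g d delta : R) (eta eta' : R -> R) (q v P : R * R -> R) (W : R -> R).
Hypothesis S : steady_flow g d delta eta eta' q v P W.
Implicit Types (x y e X l M : R) (f h : R * R -> R) (a b phi J k K : R -> R).

Let ceta : continuous eta := is_derive_continuous (sf_eta S).
Let cq : continuous q := flow_cont_q S.
Let cv : continuous v := flow_cont_v S.
Let cP : continuous P := sf_P S.
Let cW : continuous W := sf_W S.
Notation psi := (stream d q).
Notation far := (far_stream d W).
Let cpsi : continuous psi := cont_stream S.
Let cfar : continuous far := cont_far_stream S.
Let cy : continuous (fun z : R * R => z.2) := @cont_snd R.
Let ccst (k0 : R) : continuous (fun _ : R * R => k0 : R) := @cont_cst R _ k0.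
Let ccst1 (k0 : R) : continuous (fun _ : R => k0 : R) := @cont_cst R _ k0.
Notation B := (bernoulli g q v P).

Lemma cont_bernoulli : continuous B.
Proof.
apply: cont_add; first apply: cont_add => //.
  by apply: cont_mul => //; apply: cont_add; exact: cont_exp.
exact: cont_mul.
Qed.

(** Energy conservation with a weight that is constant along streamlines: the two
    bulk terms cancel because the stream function is itself transported. *)
Lemma bernoulli_column_const k k' : deriv_of k k' -> continuous k' ->
  forall x1 x2, x1 <= x2 ->
  column d eta (fun z => B z * q z * k (psi z)) x1 =
  column d eta (fun z => B z * q z * k (psi z)) x2.
Proof.
move=> dk ck' x1 x2 x12; have ck := is_derive_continuous dk.
have ck'p : continuous (fun z => k' (psi z)) by exact: cont_comp.
have ckp : continuous (fun z => k (psi z)) by exact: cont_comp.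
have c1 : continuous (fun z => k' (psi z) * v z) by exact: cont_mul.
have cnq : continuous (fun z => - q z) by exact: cont_opp.
have c2 : continuous (fun z => k' (psi z) * - q z) by exact: cont_mul.
have top x : k (psi (x, eta x)) * (B (x, eta x) * q (x, eta x) * eta' x - B (x, eta x) * v (x, eta x)) = 0.
  by rewrite (sf_kinematic S); ring.
have bot x : k (psi (x, - d)) * (B (x, - d) * v (x, - d)) = 0.
  by rewrite (sf_bottom S); ring.
have := flow_column S (sf_bern S) ckp c1 c2 (stream_weight S dk) top bot x12.
have -> : column d eta (fun z => B z * q z * (k' (psi z) * v z) +
    B z * v z * (k' (psi z) * - q z) + 0 * k (psi z)) = (fun=> 0).
  apply/funext => x; rewrite /column (_ : (fun t => _) = (fun=> 0)).
    by rewrite oint_cst mul0r.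
  by apply/funext => t; ring.
by rewrite oint_cst mul0r => /eqP; rewrite subr_eq0 => /eqP ->.
Qed.

Let column_eq f h : (forall z, f z = h z) -> column d eta f = column d eta h.
Proof. by move=> fh; congr column; exact/funext. Qed.

(** The constant of [bernoulli_column_const] cannot be computed by letting [x]
    tend to infinity, for lack of a limit of the pressure. By the vertical
    momentum law with weight [K psi], [K' = k], the pressure term [Nf] is the
    [x]-derivative of a quantity that tends to 0, up to sign; [const_by_average]
    discards it, and the remaining terms [Qf] converge. *)
Lemma bernoulli_moment k k' x : deriv_of k k' -> continuous k' ->
  column d eta (fun z => B z * q z * k (psi z)) x =
  - (2^-1 * oint (- d) 0 (fun y => W y ^+ 3 * k (far y))).
Proof.
move=> dk ck'; have ck := is_derive_continuous dk.
pose K t := oint 0 t k.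
have dK : deriv_of K k by move=> t; exact: is_derive_oint.
have K0 : K 0 = 0 by rewrite /K oint_xx.
have cK := is_derive_continuous dK.
have ckp : continuous (fun z => k (psi z)) by exact: cont_comp.
have cKp : continuous (fun z => K (psi z)) by exact: cont_comp.
have ckf : continuous (fun y => k (far y)) by exact: cont_comp.
have cKf : continuous (fun y => K (far y)) by exact: cont_comp.
pose Nf z := P z * q z * k (psi z) + g * K (psi z).
pose Qf z := 2^-1 * (q z * q z + v z * v z) * (q z * k (psi z)) +
   g * z.2 * (q z * k (psi z)) + - g * K (psi z).
pose Qa y := 2^-1 * (- W y * - W y + 0 * 0) * (- W y * k (far y)) +
   g * y * (- W y * k (far y)) + - g * K (far y).
have cN : continuous Nf by apply: cont_add; apply: cont_mul => //; exact: cont_mul.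
have cqk : continuous (fun z => q z * k (psi z)) by exact: cont_mul.
have cqv : continuous (fun z => q z * q z + v z * v z) by apply: cont_add; exact: cont_mul.
have cQ : continuous Qf.
  apply: cont_add; first apply: cont_add.
  - by apply: cont_mul => //; exact: cont_mul.
  - by apply: cont_mul => //; exact: cont_mul.
  - exact: cont_mul.
have cnW : continuous (fun y => - W y) by exact: cont_opp.
have cnWk : continuous (fun y => - W y * k (far y)) by exact: cont_mul.
have uk : ulim_infty d eta (fun z => k (psi z)) (fun y => k (far y)).
  by apply: (ulim_comp S) => //; exact: ulim_stream S.
have uK : ulim_infty d eta (fun z => K (psi z)) (fun y => K (far y)).
  by apply: (ulim_comp S) => //; exact: ulim_stream S.
have uq := ulim_q S; have uv := ulim_v S.
have uc (c0 : R) : ulim_infty d eta (fun=> c0) (fun=> c0).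
  by move=> e e0; exists 0 => *; rewrite subrr normr0 ltW.
have uy : ulim_infty d eta (fun z => g * z.2) (fun y => g * y).
  by move=> e e0; exists 0 => * /=; rewrite subrr normr0 ltW.
have uqk := ulimM S cnW ckf uq uk.
have uqq := ulimM S cnW cnW uq uq.
have uvv := ulimM S (@ccst1 0) (@ccst1 0) uv uv.
have u1 := ulimD uqq uvv.
have cWW : continuous (fun y => - W y * - W y + 0 * 0 : R).
  by apply: cont_add; [exact: cont_mul|exact: ccst1].
have u2 := ulimM S (@ccst1 2^-1) cWW (uc 2^-1) u1.
have c2WW : continuous (fun y => 2^-1 * (- W y * - W y + 0 * 0) : R) by exact: cont_mul.
have u3 := ulimM S c2WW cnWk u2 uqk.
have cgy : continuous (fun y : R => g * y) by apply: cont_mul => //; exact: cont_id.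
have u4 := ulimM S cgy cnWk uy uqk.
have u5 := ulimM S (@ccst1 (- g)) cKf (uc (- g)) uK.
have uQ : ulim_infty d eta Qf Qa := ulimD (ulimD u3 u4) u5.
have cQa : continuous Qa.
  apply: cont_add; first by apply: cont_add; apply: cont_mul.
  exact: cont_mul.
have LQ := lim_column S cQ cQa uQ.
have -> : - (2^-1 * oint (- d) 0 (fun y => W y ^+ 3 * k (far y))) = oint (- d) 0 Qa.
  have cW3 : continuous (fun y => W y ^+ 3 * k (far y)).
    by apply: cont_mul => //; exact: cont_exp.
  have cF : continuous (fun y => 1 * K (far y) + y * (k (far y) * W y)).
    by apply: cont_add; apply: cont_mul => //; [exact: cont_id|exact: cont_mul].
  have E0 : oint (- d) 0 (fun y => 1 * K (far y) + y * (k (far y) * W y)) = 0.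
    rewrite (@oint_FTC2 _ _ _ (fun y => y * K (far y)))//.
      by rewrite /far_stream oint_xx K0; ring.
    move=> y; apply: (der1_mul (der1_id y)).
    exact: (@der1_comp _ K far y _ _ (dK _) (far_stream_derive S y)).
  have -> : Qa = (fun y => - 2^-1 * (W y ^+ 3 * k (far y)) +
     - g * (1 * K (far y) + y * (k (far y) * W y))).
    by apply/funext => y; rewrite /Qa; field.
  rewrite ointD ?ointZ//; [|exact: cont_mul|exact: cont_mul].
  by rewrite E0 mulr0 addr0 mulNr.
apply: (const_by_average (N := column d eta Nf) (Q := column d eta Qf)
  (J := fun t => - column d eta (fun z => q z * v z * weight d q 0 K z) t)).
- exact: (cont_column S).
- exact: (cont_column S).
- move=> t.
  have -> : column d eta (fun z => B z * q z * k (psi z)) x =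
      column d eta (fun z => B z * q z * k (psi z)) t.
    by case: (leP x t) => [|/ltW] h; [|symmetry]; exact: (bernoulli_column_const dk ck' h).
  rewrite -columnD//; congr (column _ _ _ _); apply/funext => z.
  by rewrite /bernoulli /Nf /Qf; field.
- move=> x1 x2 x12.
  have := vertical_column S 0 dK ck K0 x12 => H.
  rewrite -opprD H -ointN; last first.
    apply: (cont_column S); apply: cont_sub; first apply: cont_sub.
    + by apply: cont_mul => //; apply: cont_add => //; exact: cont_exp.
    + by apply: cont_mul => //; exact: cont_mul.
    + by apply: cont_mul => //; exact: (cont_weight S).
  congr (oint _ _ _); apply/funext => t.
  rewrite -mulN1r -columnZ; last first.
    apply: cont_sub; first apply: cont_sub.
    + by apply: cont_mul => //; apply: cont_add => //; exact: cont_exp.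
    + by apply: cont_mul => //; exact: cont_mul.
    + by apply: cont_mul => //; exact: (cont_weight S).
  by congr (column _ _ _ _); apply/funext => z; rewrite /Nf /weight; ring.
- have H := vertical_flux_lim S 0 cK.
  move=> e /H[X HX]; exists X => t /HX.
  by rewrite !subr0 normrN.
- exact: LQ.
Qed.

Variables (s : R -> R).
Hypotheses (cs : continuous s) (sK : forall y, s (far y) = y).
(** The speed at infinity on the streamline of label [t]. *)
Definition far_speed t := W (s t).
Notation lam := far_speed.

Lemma cont_far_speed : continuous lam. Proof. exact: cont_comp. Qed.

Lemma far_speed_far y : lam (far y) = W y. Proof. by rewrite /lam sK. Qed.

Lemma bernoulli_defect k k' x : deriv_of k k' -> continuous k' ->
  oint (- d) (eta x) (fun y => (B (x, y) - lam (psi (x, y)) ^+ 2 / 2) * q (x, y) * k (psi (x, y))) = 0.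
Proof.
move=> dk ck'; have ck := is_derive_continuous dk; have cl := cont_far_speed.
have M := bernoulli_moment x dk ck'.
pose k2 t := lam t ^+ 2 * k t.
have ck2 : continuous k2 by apply: cont_mul => //; exact: cont_exp.
have E1 := column_stream S x ck2.
have E2 := far_integral S ck2.
have E3 : (fun y => k2 (far y) * W y) = (fun y => W y ^+ 3 * k (far y)).
  by apply/funext => y; rewrite /k2 far_speed_far; ring.
rewrite E3 in E2; rewrite E2 -E1 in M.
have ckp : continuous (fun z => k (psi z)) by exact: cont_comp.
have ck2p : continuous (fun z => k2 (psi z)) by exact: cont_comp.
have cnq : continuous (fun z => - q z) by exact: cont_opp.
have cBqk : continuous (fun z => B z * q z * k (psi z)).
  by apply: cont_mul => //; apply: cont_mul => //; exact: cont_bernoulli.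
have ck2q : continuous (fun z => k2 (psi z) * - q z) by exact: cont_mul.
transitivity (column d eta (fun z => B z * q z * k (psi z) + 2^-1 * (k2 (psi z) * - q z)) x).
  by congr (oint _ _ _); apply/funext => y; rewrite /k2; field.
rewrite columnD//; last exact: cont_mul.
by rewrite columnZ// M; ring.
Qed.

(** [bernoulli_defect] holds for every [k], and the stream function increases
    along a column. A [k] concentrated on the streamlines next to a point where
    the defect is nonzero would make the integral nonzero. *)
Theorem bernoulli_law x y : - d <= y <= eta x -> B (x, y) = lam (psi (x, y)) ^+ 2 / 2.
Proof.
move=> yd; pose D t := B (x, t) - lam (psi (x, t)) ^+ 2 / 2.
have cl := cont_far_speed.
have cp : continuous (fun t => psi (x, t)) by exact: cont_slice2.
have cD : continuous D.
  apply: cont_sub; first exact/cont_slice2/cont_bernoulli.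
  by apply: cont_mul; [apply: cont_exp; exact: cont_comp|exact: ccst1].
suff : D y = 0 by rewrite /D => /eqP; rewrite subr_eq0 => /eqP.
apply/eqP; apply: contraT => Dy0.
(* By continuity the point can be taken inside the column, with room around it. *)
have [y1 [y1d Dy1]] : exists y1, - d < y1 < eta x /\ D y1 != 0.
  have : \forall t \near y, D t != 0 by exact: (cvgr_neq0 _ (cD y) Dy0).
  move=> /nbhs_ballP[r /= r0 Hr].
  have de := flow_depth S x.
  pose m := Num.min (r / 2) ((eta x + d) / 4).
  have m0 : 0 < m by rewrite lt_min; apply/andP; split; lra.
  have m1 : m <= r / 2 by rewrite ge_min lexx.
  have m2 : m <= (eta x + d) / 4 by rewrite ge_min lexx orbT.
  move: yd => /andP[yd1 yd2].
  case: (leP y ((eta x - d) / 2)) => h.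
    exists (y + m); split; first by apply/andP; split; lra.
    by apply: Hr; rewrite /ball/= ltr_norml; apply/andP; split; lra.
  exists (y - m); split; first by apply/andP; split; lra.
  by apply: Hr; rewrite /ball/= ltr_norml; apply/andP; split; lra.
have DD : 0 < D y1 * D y1 by rewrite -expr2 exprn_even_gt0.
have cDD : continuous (fun t => D t * D y1) by apply: cont_mul => //; exact: ccst1.
have : \forall t \near y1, 0 < D t * D y1 by exact: (cvgr_gt _ (cDD y1)).
move=> /nbhs_ballP[r /= r0 Hr].
pose p1 := psi (x, y1 - r); pose p2 := psi (x, y1 + r); pose pm := psi (x, y1).
have p1m : p1 < pm by apply: (stream_lt S); lra.
have pm2 : pm < p2 by apply: (stream_lt S); lra.
pose t := Num.min (pm - p1) (p2 - pm) / 2.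
have m0 : 0 < Num.min (pm - p1) (p2 - pm) by rewrite lt_min !subr_gt0 p1m.
have m1 : Num.min (pm - p1) (p2 - pm) <= pm - p1 by rewrite ge_min lexx.
have m2 : Num.min (pm - p1) (p2 - pm) <= p2 - pm by rewrite ge_min lexx orbT.
have t0 : 0 < t by rewrite divr_gt0.
have t2 : 2 * t = Num.min (pm - p1) (p2 - pm) by rewrite /t mulrC divfK.
have tn : t != 0 by rewrite gt_eqF.
pose k u := step (t^-1 * u + - p1 / t) * step (- t^-1 * u + p2 / t).
pose k' u := step' (t^-1 * u + - p1 / t) * t^-1 * step (- t^-1 * u + p2 / t) +
  step (t^-1 * u + - p1 / t) * (step' (- t^-1 * u + p2 / t) * - t^-1).
have dk : deriv_of k k'.
  by move=> u; exact: (der1_mul (step_affine_derive _ _ u) (step_affine_derive _ _ u)).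
have ca (a b : R) : continuous (fun u : R => step (a * u + b)).
  by apply: cont_comp; [exact: cont_step|exact: cont_affine].
have ca' (a b : R) : continuous (fun u : R => step' (a * u + b) * a) by exact: cont_step'_affine.
have ck' : continuous k' by apply: cont_add; exact: cont_mul.
have a1 u : t^-1 * u + - p1 / t = (u - p1) / t by field.
have a2 u : - t^-1 * u + p2 / t = (p2 - u) / t by field.
have k0 u : 0 <= k u by rewrite mulr_ge0// step_ge0.
have km : k pm = 1.
  rewrite /k a1 a2 !step_eq1 ?mulr1// ler_pdivlMr// t2//.
have ksupp u : k u != 0 -> p1 < u < p2.
  rewrite /k a1 a2 mulf_eq0 negb_or => /andP[h1 h2]; apply/andP; split.
    rewrite ltNge; apply: contra h1 => h; apply/eqP/step_eq0.
    by rewrite ler_pdivrMr// mul1r (le_trans _ (ltW t0))// subr_le0.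
  rewrite ltNge; apply: contra h2 => h; apply/eqP/step_eq0.
  by rewrite ler_pdivrMr// mul1r (le_trans _ (ltW t0))// subr_le0.
have kr y2 : k (psi (x, y2)) != 0 -> 0 < D y2 * D y1.
  move=> /ksupp/andP[h1 h2]; apply: Hr; rewrite /ball/= ltr_norml; apply/andP; split.
    rewrite ltNge; apply/negP => h.
    have : y1 + r <= y2 by lra.
    rewrite le_eqVlt => /predU1P[E|/(stream_lt S x) h3].
      by move: h2; rewrite -E /p2 ltxx.
    by have := lt_trans h2 h3; rewrite ltxx.
  rewrite ltNge; apply/negP => h.
  have : y2 <= y1 - r by lra.
  rewrite le_eqVlt => /predU1P[E|/(stream_lt S x) h3].
    by move: h1; rewrite E /p1 ltxx.
  by have := lt_trans h1 h3; rewrite ltxx.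
have I0 := bernoulli_defect x dk ck'.
have nq y2 : 0 < - q (x, y2).
  by have := sf_q_le S (x, y2); have := sf_delta S; lra.
have cqs : continuous (fun u => q (x, u)) by exact: cont_slice2.
have ck := is_derive_continuous dk.
have ckp : continuous (fun u => k (psi (x, u))) by exact: cont_comp.
have cI : continuous (fun u => (- D y1) * (D u * q (x, u) * k (psi (x, u)))).
  by apply: cont_mul; [exact: ccst1|apply: cont_mul => //; exact: cont_mul].
have pos : 0 < oint (- d) (eta x) (fun u => (- D y1) * (D u * q (x, u) * k (psi (x, u)))).
  apply: (oint_gt0 (x0 := y1) (flow_depth S x) cI).
  - move=> u _; have -> : (- D y1) * (D u * q (x, u) * k (psi (x, u))) =
      (D u * D y1) * (- q (x, u)) * k (psi (x, u)) by ring.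
    case: (eqVneq (k (psi (x, u))) 0) => [->|/kr h]; first by rewrite mulr0.
    by rewrite mulr_ge0// mulr_ge0// ltW.
  - by move: y1d => /andP[/ltW -> /ltW ->].
  - have -> : (- D y1) * (D y1 * q (x, y1) * k (psi (x, y1))) =
      (D y1 * D y1) * (- q (x, y1)) * k pm by rewrite /pm; ring.
    by rewrite km mulr1 mulr_gt0.
move: pos; rewrite ointZ; last by apply: cont_mul => //; exact: cont_mul.
by rewrite I0 mulr0 ltxx.
Qed.

(** Bernoulli's law on the surface, where the speed is positive. *)
Lemma amplitude_bound x : g * eta x < W 0 ^+ 2 / 2.
Proof.
have de := flow_depth S x.
have := @bernoulli_law x (eta x).
rewrite lexx (ltW de) => /(_ isT).
rewrite /bernoulli (sf_dynamic S) (stream_surface S) far_speed_far add0r /= => <-.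
rewrite ltrDr; have := sf_q_le S (x, eta x); have := sf_delta S.
set q0 := q _; set v0 := v _ => h1 h2.
have : 0 < q0 ^+ 2 by rewrite exprn_even_gt0//= lt_eqF//; lra.
have : 0 <= v0 ^+ 2 by rewrite exprn_even_ge0.
by move=> ? ?; rewrite divr_gt0// ltr_wpDr.
Qed.

(** Horizontal momentum makes the flow force constant. Its value comes from the
    vertical momentum law with weight [y + d], which exchanges the pressure for
    terms that converge, as in [bernoulli_moment]. *)
Lemma flow_force x : column d eta (fun z => P z + q z ^+ 2) x =
  oint (- d) 0 (fun y => W y ^+ 2) + g * d ^+ 2 / 2.
Proof.
have c1 := @ccst 1; have c0 := @ccst 0.
have cK : continuous (fun _ : R => 0 : R) by exact: ccst1.
have dK : deriv_of (fun _ : R => 0 : R) (fun=> 0) by move=> t; exact: der1_cst.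
have p1 : partials_on (fluid d eta) (fun=> 1 : R) (fun=> 0) (fun=> 0).
  by move=> u t _; split; exact: der1_cst.
have cw : continuous (fun z : R * R => g * (z.2 + d)) by apply: cont_mul => //; exact: cont_add.
have cF : continuous (fun z => P z + q z ^+ 2) by apply: cont_add => //; exact: cont_exp.
have const x1 x2 : x1 <= x2 -> column d eta (fun z => P z + q z ^+ 2) x2 =
    column d eta (fun z => P z + q z ^+ 2) x1.
  move=> x12.
  have top u : 1 * ((P (u, eta u) + q (u, eta u) ^+ 2) * eta' u - q (u, eta u) * v (u, eta u)) = 0.
    by rewrite (sf_dynamic S) (sf_kinematic S); ring.
  have bot u : 1 * (q (u, - d) * v (u, - d)) = 0 by rewrite (sf_bottom S) mulr0 mulr0.
  have := flow_column S (sf_momx S) c1 c0 c0 p1 top bot x12.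
  have -> : column d eta (fun z => (P z + q z ^+ 2) * 0 + q z * v z * 0 + 0 * 1) = (fun=> 0).
    apply/funext => u; rewrite /column (_ : (fun t => _) = (fun=> 0)).
      by rewrite oint_cst mul0r.
    by apply/funext => t; ring.
  have -> : column d eta (fun z => (P z + q z ^+ 2) * 1) = column d eta (fun z => P z + q z ^+ 2).
    by apply: column_eq => z; rewrite mulr1.
  by rewrite oint_cst mul0r => /eqP; rewrite subr_eq0 => /eqP.
pose Nf z := v z ^+ 2 + P z - g * (z.2 + d).
pose Qf z := q z * q z + - 1 * (v z * v z) + g * (z.2 + d).
pose Qa y := - W y * - W y + -1 * (0 * 0) + g * (y + d).
have cN : continuous Nf by apply: cont_sub => //; apply: cont_add => //; exact: cont_exp.
have cQ : continuous Qf.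
  by apply: cont_add => //; apply: cont_add; apply: cont_mul => //; exact: cont_mul.
have cnW : continuous (fun y => - W y) by exact: cont_opp.
have uq := ulim_q S; have uv := ulim_v S.
have uc (l0 : R) : ulim_infty d eta (fun=> l0) (fun=> l0).
  by move=> e e0; exists 0 => *; rewrite subrr normr0 ltW.
have uy : ulim_infty d eta (fun z => g * (z.2 + d)) (fun y => g * (y + d)).
  by move=> e e0; exists 0 => * /=; rewrite subrr normr0 ltW.
have uqq := ulimM S cnW cnW uq uq.
have uvv := ulimM S (@ccst1 0) (@ccst1 0) uv uv.
have u1 := ulimM S (@ccst1 (-1)) (@ccst1 (0 * 0)) (uc (-1)) uvv.
have uQ : ulim_infty d eta Qf Qa := ulimD (ulimD uqq u1) uy.
have cgy : continuous (fun y : R => g * (y + d)).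
  by apply: cont_mul => //; apply: cont_add => //; exact: cont_id.
have cQa : continuous Qa.
  by apply: cont_add => //; apply: cont_add; [exact: cont_mul|exact: ccst1].
have -> : oint (- d) 0 (fun y => W y ^+ 2) + g * d ^+ 2 / 2 = oint (- d) 0 Qa.
  have -> : Qa = (fun y => W y ^+ 2 + g * (y + d)) by apply/funext => y; rewrite /Qa; ring.
  rewrite ointD//; last exact: cont_exp.
  congr (_ + _); rewrite (@oint_FTC2 _ _ _ (fun y => g * (y + d) ^+ 2 / 2))//; first by field.
  move=> y.
  have -> : (fun y => g * (y + d) ^+ 2 / 2) = (fun y => g / 2 * ((y + d) * (y + d))).
    by apply/funext => u; field.
  have h := der1_add (der1_id y) (der1_cst y d).
  apply: (der1_eq (a := 0 * ((y + d) * (y + d)) + g / 2 * ((1 + 0) * (y + d) + (y + d) * (1 + 0)))).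
    exact: (der1_mul (der1_cst y (g / 2)) (der1_mul h h)).
  by field.
apply: (const_by_average (N := column d eta Nf) (Q := column d eta Qf)
  (J := column d eta (fun z => q z * v z * weight d q 1 (fun=> 0) z))).
- exact: (cont_column S).
- exact: (cont_column S).
- move=> t.
  have -> : column d eta (fun z => P z + q z ^+ 2) x = column d eta (fun z => P z + q z ^+ 2) t.
    by case: (leP x t) => [|/ltW] h; [symmetry|]; exact: (const _ _ h).
  rewrite -columnD//; congr (column _ _ _ _); apply/funext => z.
  by rewrite /Nf /Qf; ring.
- move=> x1 x2 x12.
  rewrite (vertical_column S 1 dK cK erefl x12); congr (oint _ _ _).
  by apply: column_eq => z; rewrite /Nf /weight; ring.
- exact: (vertical_flux_lim S 1 cK).
- exact: (lim_column S cQ cQa uQ).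
Qed.

End BernoulliLaw.

(** * The integral identity and the bound on the Froude number *)

Lemma lim0_symmetric (R : realType) (J : R -> R) (X1 e : R) : lim_infty J 0 -> 0 < e -> 0 <= X1 ->
  exists2 X, X1 <= X & J X - J (- X) <= 2 * e.
Proof.
move=> lJ e0 X10; have [X2 HX2] := lJ e e0.
exists (Num.max X1 X2); first by rewrite le_max lexx.
set X := Num.max _ _.
have XX1 : X1 <= X by rewrite le_max lexx.
have XX2 : X2 <= X by rewrite le_max lexx orbT.
have X0 : 0 <= X by exact: le_trans XX1.
have J1 := HX2 X; have J2 := HX2 (- X); move: J1 J2.
rewrite normrN (ger0_norm X0) !subr0 => /(_ XX2) J1 /(_ XX2) J2.
move: J1 J2; rewrite !ler_norml; move: (J X) (J (- X)) => a b.
by move=> /andP[_ h1] /andP[h2 _]; lra.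
Qed.

Lemma flux_arith (R : realType) (a b i : R) : 0 <= b -> i <= a -> 0 < i ->
  b + a <= 2 * (i / 3) -> False.
Proof. by move=> ? ? ? ?; lra. Qed.

Section FroudeGap.
Variable R : realType.
Variables (g d delta : R) (eta eta' : R -> R) (q v P : R * R -> R) (W : R -> R).
Hypothesis S : steady_flow g d delta eta eta' q v P W.
Variable mu : R.
Hypotheses (mu0 : 0 < mu) (muW : forall y, mu <= W y).
Variable s : R -> R.
Hypotheses (cs : continuous s) (sK : forall y, s (far_stream d W y) = y).

Let ceta : continuous eta := is_derive_continuous (sf_eta S).
Let cq : continuous q := flow_cont_q S.
Let cv : continuous v := flow_cont_v S.
Let cP : continuous P := sf_P S.
Let cW : continuous W := sf_W S.
Notation psi := (stream d q).
Notation far := (far_stream d W).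
Notation lam := (far_speed W s).
Let cpsi : continuous psi := cont_stream S.
Let cfar : continuous far := cont_far_stream S.
Let cy : continuous (fun z : R * R => z.2) := @cont_snd R.
Let ccst (k0 : R) : continuous (fun _ : R * R => k0 : R) := @cont_cst R _ k0.
Let ccst1 (k0 : R) : continuous (fun _ : R => k0 : R) := @cont_cst R _ k0.
Let clam : continuous lam := cont_far_speed S cs.

(** The vertical momentum law is used with weight [y + d - phi_int psi]. With this
    [phi], the terms of [deficit] that do not involve [v] become [lam^2 - mu^2]
    times [1 - 3/2 a + 1/2 a^3], [a = - q / lam], a cubic with a double zero at
    [a = 1]: the speed on the streamline at infinity. *)
Definition phi (t : R) := (1 - mu ^+ 2 / lam t ^+ 2) / lam t.
Definition phi_int (t : R) := oint 0 t phi.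

Let lam_ge t : mu <= lam t. Proof. exact: muW. Qed.
Let lam_gt0 t : 0 < lam t. Proof. exact: lt_le_trans (lam_ge t). Qed.
Let lam_neq0 t : lam t != 0. Proof. by rewrite gt_eqF. Qed.

Lemma cont_phi : continuous phi.
Proof.
apply: cont_mul; last exact: cont_inv.
apply: cont_sub => //; apply: cont_mul => //.
by apply: cont_inv; [move=> t; rewrite expf_neq0|exact: cont_exp].
Qed.

Lemma phi_int_derive : deriv_of phi_int phi.
Proof. by move=> t; apply: is_derive_oint; exact: cont_phi. Qed.

Let cf : continuous phi_int := is_derive_continuous phi_int_derive.

Let froude_int := oint (- d) 0 (fun y => 1 / W y ^+ 2).

Let W_neq0 y : W y != 0.
Proof. by rewrite gt_eqF// (lt_le_trans mu0). Qed.

Let cW2 : continuous (fun y => 1 / W y ^+ 2).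
Proof.
apply: cont_mul => //; apply: cont_inv; last exact: cont_exp.
by move=> y; rewrite expf_neq0.
Qed.

Lemma phi_int_surface : phi_int (far 0) = d - mu ^+ 2 * froude_int.
Proof.
rewrite /phi_int -(far_integral S cont_phi) /froude_int.
have -> : (fun y => phi (far y) * W y) = (fun y => 1 - mu ^+ 2 * (1 / W y ^+ 2)).
  by apply/funext => y; rewrite /phi far_speed_far//; have := W_neq0 y => h; field.
rewrite ointB//; last exact: cont_mul.
by rewrite ointZ// oint_cst sub0r opprK mul1r.
Qed.

Lemma phi_lam_int : oint 0 (far 0) (fun t => phi t * lam t ^+ 2) =
  oint (- d) 0 (fun y => W y ^+ 2) - mu ^+ 2 * d.
Proof.
have cpl : continuous (fun t => phi t * lam t ^+ 2).
  by apply: cont_mul; [exact: cont_phi|exact: cont_exp].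
rewrite -(far_integral S cpl).
have -> : (fun y => phi (far y) * lam (far y) ^+ 2 * W y) = (fun y => W y ^+ 2 - mu ^+ 2).
  by apply/funext => y; rewrite /phi far_speed_far//; have := W_neq0 y => h; field.
rewrite ointB//; last exact: cont_exp.
by rewrite oint_cst sub0r opprK.
Qed.

Definition deficit (z : R * R) := (lam (psi z) ^+ 2 - mu ^+ 2) +
  3 / 2 * (phi (psi z) * lam (psi z) ^+ 2 * q z) -
  2^-1 * ((q z ^+ 2 + v z ^+ 2) * (phi (psi z) * q z)).

(** Since [1 - 3/2 a + 1/2 a^3 = 1/2 (a - 1)^2 (a + 2)] and [- q], [lam - mu] are
    nonnegative. *)
Lemma deficit_ge0 z : 0 <= deficit z.
Proof.
have l0 := lam_gt0 (psi z); have ln := lam_neq0 (psi z); have lm := lam_ge (psi z).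
have w0 : 0 < - q z by have := sf_q_le S z; have := sf_delta S; lra.
have -> : deficit z = (lam (psi z) ^+ 2 - mu ^+ 2) / lam (psi z) ^+ 3 *
   (2^-1 * ((- q z - lam (psi z)) ^+ 2 * (- q z + 2 * lam (psi z)) + v z ^+ 2 * - q z)).
  by rewrite /deficit /phi; field.
apply: mulr_ge0.
  rewrite divr_ge0 ?exprn_ge0 ?(ltW l0)// subr_ge0 ler_pXn2r//.
    by rewrite nnegrE ltW.
  by rewrite nnegrE ltW.
rewrite mulr_ge0 ?invr_ge0// addr_ge0// mulr_ge0 ?exprn_even_ge0//; last exact: ltW.
by rewrite addr_ge0 ?mulr_ge0// ltW.
Qed.

Definition vertical_flux z := 1 * (v z ^+ 2 + P z) - P z * q z * - phi (psi z) -
  g * weight d q 1 (fun t => - phi_int t) z.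

Let cphip : continuous (fun z => phi (psi z)).
Proof. by apply: cont_comp => //; exact: cont_phi. Qed.
Let clamp2 : continuous (fun z => lam (psi z) ^+ 2).
Proof. by apply: cont_exp; exact: cont_comp. Qed.

Lemma cont_deficit : continuous deficit.
Proof.
apply: cont_sub; first apply: cont_add.
- exact: cont_sub.
- by apply: cont_mul => //; apply: cont_mul => //; exact: cont_mul.
- apply: cont_mul => //; apply: cont_mul; last exact: cont_mul.
  by apply: cont_add; exact: cont_exp.
Qed.

Lemma cont_vertical_flux : continuous vertical_flux.
Proof.
apply: cont_sub; first apply: cont_sub.
- by apply: cont_mul => //; apply: cont_add => //; exact: cont_exp.
- by apply: cont_mul; [exact: cont_mul|exact: cont_opp].
- by apply: cont_mul => //; apply: (cont_weight S); exact: cont_opp.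
Qed.

(** By Bernoulli's law, [deficit] minus [vertical_flux] is the sum of [P + q^2], of
    [phi lam^2 q], of a polynomial in [y], and of [- g] times the [y]-derivative
    of [y * phi_int psi]. The flow force evaluates the first; the second is an
    integral in the stream function, hence a constant. *)
Lemma deficit_column x : column d eta deficit x = column d eta vertical_flux x +
  (3 / 2 * g * eta x ^+ 2 - mu ^+ 2 * (1 - g * froude_int) * eta x).
Proof.
have de := ltW (flow_depth S x).
pose A z := P z + q z ^+ 2.
pose C z := (phi (psi z) * lam (psi z) ^+ 2) * - q z.
pose h t := 3 * g * t + (g * d - mu ^+ 2).
pose G t := phi_int (psi (x, t)) + t * (phi (psi (x, t)) * - q (x, t)).
have cA : continuous A by apply: cont_add => //; exact: cont_exp.
have cC : continuous C by apply: cont_mul; [exact: cont_mul|exact: cont_opp].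
have ch : continuous h.
  by apply: cont_add => //; apply: cont_mul => //; exact: cont_id.
have cq1 : continuous (fun t => - q (x, t)) by exact/cont_opp/cont_slice2.
have cp1 : continuous (fun t => psi (x, t)) by exact: cont_slice2.
have cpp1 : continuous (fun t => phi (psi (x, t))).
  by apply: cont_comp => //; exact: cont_phi.
have cG : continuous G.
  apply: cont_add; first exact: cont_comp.
  by apply: cont_mul; [exact: cont_id|exact: cont_mul].
have cV1 : continuous (fun t => vertical_flux (x, t)) by exact/cont_slice2/cont_vertical_flux.
have cA1 : continuous (fun t => A (x, t)) by exact: cont_slice2.
have cC1 : continuous (fun t => C (x, t)) by exact: cont_slice2.
have IA : oint (- d) (eta x) (fun t => A (x, t)) =
    oint (- d) 0 (fun y => W y ^+ 2) + g * d ^+ 2 / 2 by exact: (flow_force S).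
have IC : oint (- d) (eta x) (fun t => C (x, t)) =
    oint (- d) 0 (fun y => W y ^+ 2) - mu ^+ 2 * d.
  rewrite -phi_lam_int; apply: (column_stream S x (k := fun t => phi t * lam t ^+ 2)).
  by apply: cont_mul; [exact: cont_phi|exact: cont_exp].
have Ih : oint (- d) (eta x) h = 3 / 2 * g * (eta x ^+ 2 - d ^+ 2) + (g * d - mu ^+ 2) * (eta x + d).
  rewrite (@oint_FTC2 _ _ _ (fun t => 3 / 2 * g * (t * t) + (g * d - mu ^+ 2) * t))//; first by field.
  move=> t; have i := der1_id t.
  apply: (der1_eq (a := (0 * (t * t) + 3 / 2 * g * (1 * t + t * 1)) +
     (0 * t + (g * d - mu ^+ 2) * 1))).
    exact: (der1_add (der1_mul (der1_cst t (3 / 2 * g)) (der1_mul i i))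
      (der1_mul (der1_cst t (g * d - mu ^+ 2)) i)).
  by rewrite /h; field.
have IG : oint (- d) (eta x) G = eta x * (d - mu ^+ 2 * froude_int).
  rewrite -phi_int_surface -(stream_surface S x).
  rewrite (@oint_FTC2 _ _ _ (fun t => t * phi_int (psi (x, t))))//.
    by rewrite stream_bottom /phi_int oint_xx mulr0 subr0.
  move=> t; apply: (der1_eq (a := 1 * phi_int (psi (x, t)) + t * (phi (psi (x, t)) * - q (x, t)))).
    apply: (der1_mul (der1_id t)).
    exact: (@der1_comp _ phi_int (fun t => psi (x, t)) t _ _ (phi_int_derive _) (stream_derive2 S x t)).
  by rewrite /G mul1r.
have cgG : continuous (fun t => g * G t) by exact: cont_mul.
have cAC : continuous (fun t => A (x, t) - C (x, t)) by exact: cont_sub.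
have chG : continuous (fun t => h t - g * G t) by exact: cont_sub.
have -> : column d eta deficit x = oint (- d) (eta x)
   (fun t => vertical_flux (x, t) + (A (x, t) - C (x, t) + (h t - g * G t))).
  apply: eq_oint.
  - by apply: cont_slice2; exact: cont_deficit.
  - by do 2!apply: cont_add => //.
  move=> t; rewrite (min_l de) (max_r de) => td.
  have := bernoulli_law S cs sK td; rewrite /bernoulli /= => B.
  have {}B : lam (psi (x, t)) ^+ 2 = 2 * P (x, t) + q (x, t) ^+ 2 + v (x, t) ^+ 2 + 2 * g * t.
    by rewrite -[LHS](@divfK _ 2)// -B; field.
  by rewrite /deficit /vertical_flux /A /C /h /G /weight /= B; field.
rewrite ointD//; last exact: cont_add.
rewrite (@ointD _ _ _ _ _ cAC chG) (@ointB _ _ _ _ _ cA1 cC1) (@ointB _ _ _ _ _ ch cgG) (@ointZ _ _ _ _ _ cG).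
by rewrite IA IC Ih IG; rewrite /column; field.
Qed.

(** If the inequality failed, [G] would be nonnegative by [amplitude_bound], and
    positive where the surface is raised. But by [deficit_column] the integral of
    [G] over [- X, X] is at most the difference of two flux terms that tend to 0. *)
Theorem froude_gap : (exists x, eta x != 0) ->
  mu ^+ 2 * (1 - g * froude_int) < 3 / 4 * W 0 ^+ 2.
Proof.
move=> [x0 ex0]; rewrite ltNge; apply/negP => le_kap.
set kap := mu ^+ 2 * (1 - g * froude_int) in le_kap.
pose G x := eta x * (kap - 3 / 2 * g * eta x).
have e0 := sf_eta_ge0 S.
have kg x : 0 < kap - 3 / 2 * g * eta x.
  have := amplitude_bound S cs sK x; rewrite subr_gt0 => h; apply: lt_le_trans le_kap.
  have -> : 3 / 2 * g * eta x = 3 / 2 * (g * eta x) by ring.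
  have -> : 3 / 4 * W 0 ^+ 2 = 3 / 2 * (W 0 ^+ 2 / 2) by field.
  by rewrite ltr_pM2l.
have G0 x : 0 <= G x by rewrite mulr_ge0// ltW.
have cG : continuous G.
  by apply: cont_mul => //; apply: cont_sub => //; exact: cont_mul.
pose X1 := `|x0| + 1.
have X10 : 0 < X1 by rewrite ltr_wpDl.
pose I1 := oint (- X1) X1 G.
have I10 : 0 < I1.
  apply: (oint_gt0 (x0 := x0)) => //.
  - by rewrite gtrN.
  - by rewrite -ler_norml lerDl.
  - by rewrite mulr_gt0// lt_neqAle eq_sym ex0 e0.
have dK : deriv_of (fun t => - phi_int t) (fun t => - phi t).
  by move=> t; apply: is_deriveN; exact: phi_int_derive.
have ck : continuous (fun t => - phi t) by apply: cont_opp; exact: cont_phi.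
have K0 : - phi_int 0 = 0 by rewrite /phi_int oint_xx oppr0.
have cK := is_derive_continuous dK.
have e3 : 0 < I1 / 3 by rewrite divr_gt0.
have [X XX1] := lim0_symmetric (vertical_flux_lim S 1 cK) e3 (ltW X10).
have X0 : 0 <= X by rewrite (le_trans _ XX1)// ltW.
have XX : - X <= X by rewrite ge0_cp.
rewrite (vertical_column S 1 dK ck K0 XX).
have -> : oint (- X) X (column d eta vertical_flux) =
  oint (- X) X (column d eta deficit) + oint (- X) X G.
  rewrite -ointD//; last by apply: (cont_column S); exact: cont_deficit.
  by congr (oint _ _ _); apply/funext => x; rewrite deficit_column /G -/kap; field.
have D0 : 0 <= oint (- X) X (column d eta deficit).
  apply: oint_ge0 => //; first by apply: (cont_column S); exact: cont_deficit.
  move=> x _; apply: oint_ge0; [exact/ltW/(flow_depth S)| |move=> y _; exact: deficit_ge0].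
  by apply: cont_slice2; exact: cont_deficit.
have I1X : I1 <= oint (- X) X G.
  rewrite (oint_chasles (- X1) (- X) X) (oint_chasles X1 (- X1) X).
  have A1 : 0 <= oint (- X) (- X1) G by apply: oint_ge0 => //; rewrite lerN2.
  have A2 : 0 <= oint X1 X G by apply: oint_ge0.
  by rewrite -/I1; lra.
move: D0 I1X I10.
exact: flux_arith.
Qed.

End FroudeGap.

(** * Solitary waves as steady flows *)

Section Solitary.
Variable R : realType.

Lemma near_infty_both (Q : R -> Prop) :
  (\forall x \near +oo, Q x) -> (\forall x \near -oo, Q x) ->
  exists X, forall x, X <= `|x| -> Q x.
Proof.
move=> [M1 [_ H1]] [M2 [_ H2]].
exists (Num.max `|M1| `|M2| + 1) => x hx.
have h1 : `|M1| < `|x|.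
  by apply: lt_le_trans hx; rewrite ltr_pwDr// le_max lexx.
have h2 : `|M2| < `|x|.
  by apply: lt_le_trans hx; rewrite ltr_pwDr// le_max lexx orbT.
case: (leP 0 x) => x0.
  by apply: H1; rewrite (le_lt_trans (ler_norm _))// (lt_le_trans h1)// ger0_norm.
apply: H2; rewrite (ltr0_norm x0) in h2; rewrite -ltrN2.
by rewrite (le_lt_trans (ler_norm _))// normrN.
Qed.

Lemma vanishes_norm d eta (f : R -> R -> R) : vanishes_at_infinity d eta f ->
  forall e, 0 < e -> exists X, forall x y, X <= `|x| -> - d <= y <= eta x -> `|f x y| <= e.
Proof.
move=> H e /H[h1 h2]; have [X HX] := near_infty_both h1 h2.
by exists X => x y /HX h /h /ltW.
Qed.

Lemma sup_below_gap (D : set (R * R)) (c : R) u : D !=set0 -> sup_below c D u ->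
  exists2 delta, 0 < delta & forall z, D z -> u z <= c - delta.
Proof.
move=> [z0 Dz0]; rewrite /sup_below.
have ub z : D z -> ((u z)%:E <= ereal_sup [set (u z)%:E | z in D])%E.
  by move=> Dz; apply: ereal_sup_ubound; exists z.
have := ub _ Dz0.
case: (ereal_sup _) ub => [s|//|//] ub _; rewrite lte_fin => sc.
exists (c - s) => [|z /ub]; first by rewrite subr_gt0.
by rewrite lee_fin => /le_trans; apply; rewrite opprB addrC subrK.
Qed.

Lemma closure_le (T : topologicalType) (D : set T) (w : T -> R) (k : R) :
  {within closure D, continuous w} -> (forall z, D z -> w z <= k) ->
  forall z, closure D z -> w z <= k.
Proof.
move=> /subspace_continuousP cw Dw z Dz; rewrite leNgt; apply/negP => h.
have nb : nbhs (w z) [set t | k < t] := open_nbhs_nbhs (conj (@open_gt R k) h).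
have H : nbhs z (fun s => closure D s -> k < w s) := cw z Dz _ nb.
have [s [Ds /= Hs]] := Dz _ H.
have := Hs (subset_closure Ds); rewrite ltNge => /negP; apply; exact: Dw.
Qed.

Lemma ae_sub (Q1 Q2 : R * R -> Prop) : (forall z, Q1 z -> Q2 z) ->
  {ae @mu2 R, forall z, Q1 z} -> {ae @mu2 R, forall z, Q2 z}.
Proof.
move=> Q12 [Z [mZ Z0 subZ]]; exists Z; split => // z /= nQ2.
by apply: subZ => /= /Q12.
Qed.

Lemma C1fun_cst (k : R) : C1fun (fun=> k) (fun=> 0) (fun=> 0).
Proof. by split; try exact: cont_cst; move=> x y; exact: der1_cst. Qed.

Lemma C1fun_height : C1fun (fun z : R * R => z.2) (fun=> 0) (fun=> 1).
Proof.
split; [exact: cont_snd|exact: cont_cst|exact: cont_cst| |].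
- by move=> x y; exact: der1_cst.
- by move=> x y; exact: der1_id.
Qed.

Lemma conserved_eq (D : set (R * R)) (A A' C C' E E' : R * R -> R) :
  conserved D A C E -> A =1 A' -> C =1 C' -> E =1 E' -> conserved D A' C' E'.
Proof. by move=> H /funext <- /funext <- /funext <-. Qed.

Section Euler.
Variables (g : R) (D : set (R * R)) (cut : has_cutoffs D).
Variables (q v P ux uy vx vy Px Py : R * R -> R).
Hypotheses (Hq : forall b, weak_partial D b q (sel b ux uy))
  (Hv : forall b, weak_partial D b v (sel b vx vy))
  (HP : forall b, weak_partial D b P (sel b Px Py)).
Hypothesis euler : {ae @mu2 R, forall z, D z ->
  [/\ q z * ux z + v z * uy z = - Px z, q z * vx z + v z * vy z = - Py z - g &
      ux z + vy z = 0]}.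

Let c0 (k : R) : continuous (fun _ : R * R => k) := @cont_cst R _ k.

Lemma euler_mass : conserved D q v (fun=> 0).
Proof.
apply: (weak_conserved (Hq true) (Hv false)); first exact: c0.
by apply: ae_sub euler => z H /H[].
Qed.

Lemma euler_momx : conserved D (fun z => P z + q z ^+ 2) (fun z => q z * v z) (fun=> 0).
Proof.
have A := weak_partialD (HP true) (weak_Leibniz cut (Hq true) (Hq true)).
have C := weak_Leibniz cut (Hq false) (Hv false).
apply: (conserved_eq (weak_conserved A C (@c0 0) _)) => //=.
apply: ae_sub euler => z H /H[h1 h2 h3] /=.
have -> : Px z = - (q z * ux z + v z * uy z) by rewrite h1 opprK.
have -> : vy z = - ux z by apply/eqP; rewrite -addr_eq0 addrC h3.
by ring.
Qed.

Lemma euler_momy : conserved D (fun z => q z * v z) (fun z => v z ^+ 2 + P z) (fun=> - g).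
Proof.
have A := weak_Leibniz cut (Hq true) (Hv true).
have C := weak_partialD (weak_Leibniz cut (Hv false) (Hv false)) (HP false).
apply: (conserved_eq (weak_conserved A C (@c0 (- g)) _)) => //=.
apply: ae_sub euler => z H /H[h1 h2 h3] /=.
have -> : Py z = - (q z * vx z + v z * vy z) - g by rewrite h2; ring.
have -> : ux z = - vy z by apply/eqP; rewrite -addr_eq0 h3.
by ring.
Qed.

Lemma euler_bernoulli : conserved D (fun z => bernoulli g q v P z * q z)
  (fun z => bernoulli g q v P z * v z) (fun=> 0).
Proof.
have half b := C1_weak_partial D b (C1fun_cst 2^-1).
have G b := weak_Leibniz cut (C1_weak_partial D b (C1fun_cst g)) (C1_weak_partial D b C1fun_height).
have K b := weak_Leibniz cut (half b)
  (weak_partialD (weak_Leibniz cut (Hq b) (Hq b)) (weak_Leibniz cut (Hv b) (Hv b))).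
have B b := weak_partialD (weak_partialD (HP b) (K b)) (G b).
have A := weak_Leibniz cut (B true) (Hq true).
have C := weak_Leibniz cut (B false) (Hv false).
apply: (conserved_eq (weak_conserved A C (@c0 0) _)) => //=.
- apply: ae_sub euler => z H /H[h1 h2 h3] /=.
  have -> : Px z = - (q z * ux z + v z * uy z) by rewrite h1 opprK.
  have -> : Py z = - (q z * vx z + v z * vy z) - g by rewrite h2; ring.
  have -> : vy z = - ux z by apply/eqP; rewrite -addr_eq0 addrC h3.
  by field.
- by move=> z; rewrite /bernoulli; field.
- by move=> z; rewrite /bernoulli; field.
Qed.

End Euler.

Lemma limit_lower (a b c k e : R) : a - c <= - k -> - e <= a - b -> b <= c - k + e.
Proof. by move=> ? ?; lra. Qed.

Section FromSolitaryWave.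
Variables (g d c alpha r : R) (u v P : R * R -> R) (eta U : R -> R).
Hypotheses (g0 : 0 < g) (d0 : 0 < d) (r1 : 1 <= r).
Hypothesis wave : solitary_wave g d c r alpha u v P eta U.
Hypothesis eta0 : forall x, 0 <= eta x.
Hypothesis subcritical : sup_below c (fluid d eta) u.

Definition profile y := c - U (Num.max (- d) (Num.min y 0)).

Lemma profile_id y : - d <= y <= 0 -> profile y = c - U y.
Proof. by move=> /andP[h1 h2]; rewrite /profile (min_l h2) (max_r h1). Qed.

(** The profile stays at distance [delta] from stagnation because it is the limit
    of [c - u] along each horizontal line, heights above 0 being clamped to 0. *)
Lemma solitary_wave_steady_flow : exists delta,
  steady_flow g d delta eta (derive1 eta) (fun z => u (clamp d eta z) - c)
    (fun z => v (clamp d eta z)) (fun z => P (clamp d eta z)) profile.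
Proof.
have de : deriv_of eta (derive1 eta).
  by move=> x; have [h _ _] := sw_eta wave; apply: DeriveDef; [exact: h|rewrite derive1E].
have ce := is_derive_continuous de.
have ce' : continuous (derive1 eta) by have [_ h _] := sw_eta wave.
have depth := sw_depth wave.
have cl z : closure (fluid d eta) (clamp d eta z) by exact: clamp_closure.
have cc := @cont_clamp R d eta ce.
have cu := continuous_within_comp (sw_u_cont wave) cc cl.
have cv := continuous_within_comp (sw_v_cont wave) cc cl.
have cP := continuous_within_comp (sw_P_cont wave) cc cl.
have cm : continuous (fun y : R => Num.max (- d) (Num.min y 0)).
  have cc0 := @cont_clamp R d (fun=> 0) (@cont_cst R R 0).
  exact: (@cont_slice2 R _ 0 (cont_comp (@cont_snd R) cc0)).
have cW : continuous profile.
  apply: cont_sub; first exact: cont_cst.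
  apply: (continuous_within_comp (sw_U_cont wave) cm).
  move=> y; rewrite /= in_itv /= le_max lexx /= ge_max ge_min lexx orbT andbT.
  by rewrite oppr_le0 ltW.
have dom x y : fluid d eta (x, y) -> - d <= y <= eta x.
  by move=> [/= /ltW -> /ltW ->].
have [delta delta0 ule] : exists2 delta, 0 < delta & forall z, fluid d eta z -> u z <= c - delta.
  apply: sup_below_gap => //; exists (0, (eta 0 - d) / 2).
  by rewrite /fluid /=; have := depth 0; split; lra.
have q_le z : u (clamp d eta z) - c <= - delta.
  by have := closure_le (sw_u_cont wave) ule (cl z); lra.
have cut := @fluid_has_cutoffs R d eta _ de ce'.
have vlim := vanishes_norm (sw_v_lim wave).
have qlim := vanishes_norm (sw_u_lim wave).
have [ux [uy [vx [vy [Px [Py [Wu Wv WP euler]]]]]]] := sw_euler wave.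
have ext (w : R * R -> R) z : fluid d eta z -> w (clamp d eta z) = w z.
  by case: z => x y /dom/clamp_id ->.
have Hu b := W1r_weak_partial b r1 ce depth Wu cu (ext u).
have Hv b := W1r_weak_partial b r1 ce depth Wv cv (ext v).
have HP b := W1r_weak_partial b r1 ce depth WP cP (ext P).
have Hq b : weak_partial (fluid d eta) b (fun z => u (clamp d eta z) - c) (sel b ux uy).
  have := weak_partialD (Hu b) (C1_weak_partial (fluid d eta) b (C1fun_cst (- c))).
  have -> : (fun z => sel b ux uy z + sel b (fun=> 0 : R) (fun=> 0) z) = sel b ux uy => //.
  by apply/funext => z; case: b; rewrite /= addr0.
have Eu : {ae @mu2 R, forall z, fluid d eta z ->
  [/\ (u (clamp d eta z) - c) * ux z + v (clamp d eta z) * uy z = - Px z,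
      (u (clamp d eta z) - c) * vx z + v (clamp d eta z) * vy z = - Py z - g &
      ux z + vy z = 0]}.
  by apply: ae_sub euler => z H Dz; rewrite !ext//; exact: H.
have surf x : clamp d eta (x, eta x) = (x, eta x).
  by rewrite clamp_id// lexx ltW// depth.
have W_ge y : delta <= profile y.
  rewrite /profile; set y1 := Num.max _ _.
  have y1d : - d <= y1 <= 0.
    by rewrite /y1 le_max lexx /= ge_max ge_min lexx orbT andbT oppr_le0 ltW.
  suff : U y1 <= c - delta by lra.
  apply/ler_addgt0Pr => e e0; have [X HX] := qlim e e0.
  have y1e : - d <= y1 <= eta `|X|.
    by move: y1d => /andP[-> /le_trans h] /=; exact: h.
  have := HX `|X| y1 _ y1e; rewrite normr_id ler_norm => /(_ isT).
  have := q_le (`|X|, y1); rewrite clamp_id//.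
  move: y1d => /andP[_ /min_l ->]; rewrite ler_norml => h1 /andP[h2 h3].
  exact: limit_lower h1 h2.
exists delta; split => //.
- move=> e e0; have [/cvgrPdist_lt l1 /cvgrPdist_lt l2] := sw_eta_lim wave.
  have [X HX] := near_infty_both (l1 e e0) (l2 e e0).
  by exists X => x /HX; rewrite sub0r normrN => /ltW.
- exact: (euler_mass Hq Hv Eu).
- exact: (euler_momx cut Hq Hv HP Eu).
- exact: (euler_momy cut Hq Hv HP Eu).
- exact: (euler_bernoulli cut Hq Hv HP Eu).
- by move=> x; rewrite clamp_id ?(sw_bottom wave)// lexx ltW ?depth.
- by move=> x; rewrite surf (sw_kinematic wave).
- by move=> x; rewrite surf (sw_dynamic wave).
- move=> e /vlim[X HX]; exists X => x y h1 h2; rewrite clamp_id//; exact: HX.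
- move=> e /qlim[X HX]; exists X => x y h1 h2; rewrite clamp_id//.
  have := HX x y h1 h2; rewrite /profile.
  have /andP[y1 y2] := h2.
  rewrite (max_r (_ : - d <= Num.min y 0)); last first.
    by rewrite le_min y1 oppr_le0 ltW.
  by congr (`|_| <= _); ring.
Qed.

End FromSolitaryWave.

Lemma powR_half_bound (F b : R) : 0 < F -> 0 < b -> b < 1 / F ^+ 2 -> F < b `^ (- (1 / 2)).
Proof.
move=> F0 b0 h; have s0 : 0 < Num.sqrt b by rewrite sqrtr_gt0.
rewrite powRN div1r powR12_sqrt ?(ltW b0)// -[ltRHS]div1r ltr_pdivlMr//.
have F2 : 0 < F ^+ 2 by rewrite exprn_gt0.
rewrite -(@ltr_pXn2r _ 2) ?nnegrE ?mulr_ge0 ?(ltW F0) ?(ltW s0)//.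
by rewrite exprMn (sqr_sqrtr (ltW b0)) expr1n mulrC -ltr_pdivlMr.
Qed.

Lemma lt_2_sqrt3 (L : R) : 0 < L -> L < 2 / Num.sqrt 3 -> 0 < 1 - 3 / 4 * L ^+ 2.
Proof.
move=> L0 h; have s0 : 0 < Num.sqrt 3 :> R by rewrite sqrtr_gt0.
have s3 : Num.sqrt 3 ^+ 2 = 3 :> R by rewrite sqr_sqrtr.
have : (L * Num.sqrt 3) ^+ 2 < 2 ^+ 2.
  rewrite ltr_pXn2r ?nnegrE ?mulr_ge0 ?(ltW L0) ?(ltW s0)//.
  by rewrite -ltr_pdivlMr.
by rewrite exprMn s3; lra.
Qed.

Lemma froude_arith (m w L i : R) : 0 < L -> m = w / L -> 0 < w ->
  m ^+ 2 * (1 - i) < 3 / 4 * w ^+ 2 -> 1 - 3 / 4 * L ^+ 2 < i.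
Proof.
move=> L0 mE w0 h.
have m0 : 0 < m ^+ 2 by rewrite exprn_gt0// mE divr_gt0.
have wE : w = m * L by rewrite mE divfK// gt_eqF.
rewrite wE exprMn in h.
have : m ^+ 2 * (1 - i) < m ^+ 2 * (3 / 4 * L ^+ 2) by lra.
rewrite ltr_pM2l//; lra.
Qed.

End Solitary.

Theorem theorem1p2 (R : realType) (g d c alpha r : R)
    (u v P : R * R -> R) (eta U : R -> R) (Lambda F : R) :
  0 < g -> 0 < d -> 0 < c ->
  0 < alpha -> alpha < 1 -> r = 2 / (1 - alpha) ->
  solitary_wave g d c r alpha u v P eta U ->
  elevation eta ->
  sup_below c (fluid d eta) u ->
  is_max (shear_ratios d c U) Lambda ->
  Lambda < 2 / Num.sqrt 3 ->
  is_froude g d c U F ->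
  F < (1 - 3 / 4 * Lambda ^+ 2) `^ (- (1 / 2)).
Proof.
move=> g0 d0 _ a0 a1 rE wave [eta0 etaN0] sub [Lin Lub] Llt [F0 FE].
have r1 : 1 <= r by rewrite rE ler_pdivlMr ?subr_gt0// mul1r; lra.
have [delta S] := solitary_wave_steady_flow g0 d0 r1 wave eta0 sub.
have W0 y : 0 < profile d c U y := lt_le_trans (sf_delta S) (sf_W_ge S y).
have id0 : - d <= 0 <= 0 by rewrite oppr_le0 (ltW d0) /=.
have L0 : 0 < Lambda.
  case: Lin => y; rewrite /= in_itv /= => yd <-.
  by rewrite -!(@profile_id _ d)// divr_gt0.
pose mu := profile d c U 0 / Lambda.
have mu0 : 0 < mu by rewrite divr_gt0.
have muW y : mu <= profile d c U y.
  have [y1 y1d ->] : exists2 y1, - d <= y1 <= 0 & profile d c U y = profile d c U y1.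
    have h : - d <= Num.max (- d) (Num.min y 0) <= 0.
      by rewrite le_max lexx /= ge_max ge_min lexx orbT andbT oppr_le0 ltW.
    by exists (Num.max (- d) (Num.min y 0)) => //; rewrite (profile_id _ _ h).
  rewrite /mu ler_pdivrMr// mulrC -ler_pdivrMr//.
  by apply: Lub; exists y1; rewrite /= ?in_itv// !profile_id.
have [s cs sK] := far_height S.
have := froude_gap S mu0 muW cs sK etaN0.
have cI : continuous (fun y => 1 / profile d c U y ^+ 2).
  apply: cont_mul; first exact: cont_cst.
  apply: cont_inv; last by apply: cont_exp; exact: sf_W S.
  by move=> y; rewrite expf_neq0// gt_eqF.
rewrite (oint_Rintegral _ cI) ?oppr_le0 ?(ltW d0)//.
have -> : \int[@mu1 R]_(y in `[- d, 0]) (1 / profile d c U y ^+ 2) =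
    \int[@mu1 R]_(y in `[- d, 0]) (1 / (c - U y) ^+ 2).
  by apply: eq_Rintegral; move=> y; rewrite inE /= in_itv /= => yd; rewrite profile_id.
rewrite -FE => gap.
apply: powR_half_bound => //; first exact: lt_2_sqrt3.
exact: (froude_arith L0 erefl (W0 0) gap).
Qed.
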